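(* Let $Q>0$, let $(Z,d,\mu)$ be a $Q$-Ahlfors regular metric measure space, let $\lambda\in(0,Q]$, and let $F\subset Z$ be a closed and porous $\lambda$-Ahlfors regular subset, equipped with the metric $d_{|F}$ and the Hausdorff $\lambda$-measure $\nu$. Suppose that $0<s<1$, $\max\big(Q/(\lambda+s),(Q-\lambda)/s\big)<p<\infty$ and $Q/(Q+s)<q\le\infty$. Then there exist bounded linear operators $$\mathcal R\colon \dot{\mathcal F}^{s}_{p,q}(Z)\to \dot{\mathcal B}^{s-\frac{Q-\lambda}{p}}_{p,p}(F)\quad\text{and}\quad \mathcal E\colon \dot{\mathcal B}^{s-\frac{Q-\lambda}{p}}_{p,p}(F)\to\dot{\mathcal F}^{s}_{p,q}(Z)$$ such that (i) $\mathcal R f=f_{|F}$ for all continuous functions $f$ in $\dot{\mathcal F}^{s}_{p,q}(Z)$, and (ii) $\mathcal R(\mathcal E f)=f$ for all $f\in\dot{\mathcal B}^{s-\frac{Q-\lambda}{p}}_{p,p}(F)$ (pointwise $\nu$-almost everywhere in $F$).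
   Context: **Metric measure spaces.** All metric measure spaces $(Z,d,\mu)$ are such that $\mu$ is Borel regular and every ball $B(\xi,r)=\{\eta: d(\eta,\xi)<r\}$ has positive and finite measure. $(Z,d,\mu)$ is $Q$-Ahlfors regular if $\mu(B(\xi,r))\approx r^Q$ uniformly in $\xi\in Z$ and $0<r<\operatorname{diam}Z$. A closed subset $F\subset Z$ (of Hausdorff dimension $\lambda$) is $\lambda$-Ahlfors regular if the metric measure space $(F,d_{|F},\nu)$, with $\nu$ the Hausdorff $\lambda$-measure on $F$, is $\lambda$-Ahlfors regular. A closed set $F\subset Z$ is porous if there exists $c\in(0,1)$ such that for all balls $B\subset Z$ with radius $r<\operatorname{diam}Z$ and $B\cap F\ne\emptyset$ there exists $\xi\in Z$ with $B(\xi,cr)\subset B\setminus F$. $L^1_{\rm loc}(Z)$ denotes the complex-valued $\mu$-measurable functions on $Z$ that are integrable on every ball. **Hyperbolic filling.** For each $n\in\mathbb Z$ let $(\xi_x)_{x\in X_n}$ be a maximal set of points of $Z$ with $d(\xi_x,\xi_{x'})\ge 2^{-n-1}$ for distinct $x,x'\in X_n$ ($X_n$ an index set). Put $B(x):=B(\xi_x,2^{-n})$ and $|x|:=n$ for $x\in X_n$, and $X:=\bigsqcup_{n\in\mathbb Z}X_n$. The graph $(X,E)$ has an edge joining $x$ and $x'$ (written $x\sim x'$) iff $x\ne x'$, $||x|-|x'||\le1$ and $B(x)\cap B(x')\neq\emptyset$. Each edge is given one orientation, with starting point $e_-$ and endpoint $e_+$, such that $e_+$ is the vertex of higher level when the levels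 differ. Put $|e|:=\min(|e_-|,|e_+|)$ and $B(e):=B(e_-)\cup B(e_+)$. For $u\colon X\to\mathbb C$ let $du(e):=u(e_+)-u(e_-)$, $e\in E$. For $f\in L^1_{\rm loc}(Z)$ let $Pf(x):=\frac1{\mu(B(x))}\int_{B(x)}f\,d\mu$, $x\in X$. **Function spaces.** Let $Z$ be $Q$-Ahlfors regular. For $0<s\le1$, $Q/(Q+s)<p\le\infty$ and $0<q\le\infty$, $\dot{\mathcal B}^s_{p,q}(Z)$ is the space of $f\in L^1_{\rm loc}(Z)$ such that $$\|f\|_{\dot{\mathcal B}^s_{p,q}(Z)}:=\Big(\sum_{k\in\mathbb Z}2^{ksq}\Big\|\sum_{|e|=k}|d(Pf)(e)|\chi_{B(e)}\Big\|_{L^p(Z)}^q\Big)^{1/q}<\infty.$$ For $0<s\le1$, $Q/(Q+s)<p<\infty$ and $Q/(Q+s)<q\le\infty$, $\dot{\mathcal F}^s_{p,q}(Z)$ is the space of $f\in L^1_{\rm loc}(Z)$ such that $$\|f\|_{\dot{\mathcal F}^s_{p,q}(Z)}:=\Big(\int_Z\Big(\sum_{e\in E}\big[2^{|e|s}|d(Pf)(e)|\big]^q\chi_{B(e)}(\xi)\Big)^{p/q}d\mu(\xi)\Big)^{1/p}<\infty$$ (with suprema in place of $\ell^q$ sums if $q=\infty$). Different choices of the hyperbolic filling give equivalent quasi-norms. Strictly speaking these are quasi-normed spaces after dividing out functions that are constant $\mu$-almost everywhere; ''$f\in$'' is used both for functions and for equivalence classes. The spaces on $F$ are defined in the same way with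 $(F,d_{|F},\nu)$ and $\lambda$ in place of $(Z,d,\mu)$ and $Q$. *)

(* Defs.v *)
From HB Require Import structures.
From mathcomp Require Import all_boot all_order all_algebra.
From mathcomp Require Import all_classical all_reals all_analysis.
From mathcomp Require Import complex.

Set Implicit Arguments.
Unset Strict Implicit.
Unset Printing Implicit Defensive.

Import Order.TTheory GRing.Theory Num.Theory.
Import numFieldTopology.Exports numFieldNormedType.Exports.

Local Open Scope classical_set_scope.
Local Open Scope ring_scope.

(* Measurable types are pointed in MathComp-Analysis, so metric spaces carrying
   a measure have to be nonempty.  The distinguished point plays no role. *)
#[short(type="pmetricType")]
HB.structure Definition PointedMetric (R : numDomainType) :=
  {M of Pointed M & Metric R M}.

Section subset_metric.
Context {R : realType} {X : metricType R} (A : set X).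

Let dist (x y : set_type A) : R := mdist (set_val x) (set_val y).

Let dist_ge0 x y : 0 <= dist x y.
Proof. exact: mdist_ge0. Qed.

Let dist_positivity x y : dist x y = 0 -> x = y.
Proof. by move=> /mdist_positivity/val_inj. Qed.

Let ballEdist (x : set_type A) e : ball x e = [set y | dist x y < e].
Proof. by rewrite -initial_ballE ballEmdist. Qed.

HB.instance Definition _ := @PseudoMetric_isMetric.Build R (set_type A)
  dist dist_ge0 dist_positivity ballEdist.

End subset_metric.

Definition nonempty_subset {R : realType} {X : metricType R} {A : set X}
  (A0 : A !=set0) : Type := set_type A.

Section nonempty_subset.
Context {R : realType} {X : metricType R} {A : set X} (A0 : A !=set0).

HB.instance Definition _ := Metric.on (nonempty_subset A0).
HB.instance Definition _ := isPointed.Build (nonempty_subset A0)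
  (exist _ (projT1 (cid A0)) (mem_set (projT2 (cid A0)))).

Definition subset_incl (x : nonempty_subset A0) : X := set_val x.

End nonempty_subset.

Section hausdorff_measure.
Context {R : realType} {M : metricType R}.
Implicit Types (A : set M) (s d : R).
Local Open Scope ereal_scope.

(* The point 0 makes the diameter of the empty set 0 rather than -oo. *)
Definition diam A : \bar R :=
  ereal_sup (0 |` [set (mdist x.1 x.2)%:E | x in A `*` A]).

(* The case distinction is only relevant for s = 0, where 0 `^ 0 = 1. *)
Definition hausdorff_gauge s A : \bar R :=
  if pselect (A = set0) then 0 else diam A `^ s.

Definition hausdorff_content s d A : \bar R :=
  ereal_inf [set \sum_(i <oo) hausdorff_gauge s (U i) | U in
    [set U : (set M)^nat |
      (forall i, diam (U i) <= d%:E) /\ A `<=` \bigcup_i U i]].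

Definition hausdorff_measure s A : \bar R :=
  ereal_sup [set hausdorff_content s d A | d in [set d : R | (0 < d)%R]].

Lemma diam0 : diam set0 = 0.
Proof.
rewrite /diam set0X image_set0 setU0; exact: ereal_sup1.
Qed.

Lemma hausdorff_gauge0 s : hausdorff_gauge s set0 = 0.
Proof. by rewrite /hausdorff_gauge; case: pselect. Qed.

Lemma hausdorff_gauge_ge0 s A : 0 <= hausdorff_gauge s A.
Proof. by rewrite /hausdorff_gauge; case: pselect => [//|?]; exact: poweR_ge0. Qed.

Lemma hausdorff_content_ge0 s d A : 0 <= hausdorff_content s d A.
Proof.
apply: le_ereal_inf_tmp => _ [U _ <-].
by apply: nneseries_ge0 => *; exact: hausdorff_gauge_ge0.
Qed.

Lemma hausdorff_content0 s d : (0 < d)%R -> hausdorff_content s d set0 = 0.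
Proof.
move=> d0; apply/eqP; rewrite eq_le hausdorff_content_ge0 andbT.
apply: ereal_inf_lbound; exists (fun=> set0).
  by split=> // i; rewrite diam0 lee_fin ltW.
by rewrite eseries0// => i _ _; exact: hausdorff_gauge0.
Qed.

Lemma le_hausdorff_content s d :
  {homo hausdorff_content s d : A B / A `<=` B >-> A <= B}.
Proof.
move=> A B AB; apply/ereal_inf_le_tmp => _ [U [Ud BU] <-].
by exists U => //; split => //; exact: subset_trans AB BU.
Qed.

Lemma hausdorff_content_sigma_subadditive s d :
  sigma_subadditive (hausdorff_content s d).
Proof.
move=> A.
have [[i ioo]|] := pselect (exists i, hausdorff_content s d (A i) = +oo).
  rewrite (eseries_pinfty _ _ ioo) ?leey// => n _.
  by rewrite -ltNye (lt_le_trans _ (hausdorff_content_ge0 _ _ _)).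
rewrite -forallNE => Aoo.
suff add2e (e : {posnum R}) : hausdorff_content s d (\bigcup_n A n) <=
    \sum_(i <oo) hausdorff_content s d (A i) + e%:num%:E.
  by apply/lee_addgt0Pr => _/posnumP[].
rewrite (le_trans _ (epsilon_trick _ _ _))//; last first.
  by move=> n; exact: hausdorff_content_ge0.
pose P n (B : (set M)^nat) :=
  ((forall i, diam (B i) <= d%:E) /\ A n `<=` \bigcup_i B i) /\
  \sum_(k <oo) hausdorff_gauge s (B k) <=
    hausdorff_content s d (A n) + (e%:num / (2 ^ n.+1)%:R)%:E.
have [G PG] : {G : ((set M)^nat)^nat & forall n, P n (G n)}.
  apply: (@choice _ _ P) => n; rewrite /P /hausdorff_content.
  set S := (X in ereal_inf X); move infS : (ereal_inf S) => iS.
  case: iS infS => [r Sr|Soo|Soo].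
  - have en1 : (0 < e%:num / (2 ^ n.+1)%:R)%R by [].
    have /(lb_ereal_inf_adherent en1) : ereal_inf S \is a fin_num by rewrite Sr.
    move=> [x [B mB muBx] xS].
    by exists B; split => //; rewrite muBx -Sr; exact/ltW.
  - by have := Aoo n; rewrite /hausdorff_content -/S Soo.
  - suff : lbound S 0 by move/le_ereal_inf_tmp; rewrite Soo.
    move=> /= _ [B _ <-]; apply: nneseries_ge0 => *.
    exact: hausdorff_gauge_ge0.
have G_ge0 x : 0 <= (hausdorff_gauge s \o uncurry G) x.
  exact: hausdorff_gauge_ge0.
apply: (@le_trans _ _ (\esum_(i in setT) (hausdorff_gauge s \o uncurry G) i)).
  apply: ereal_inf_lbound => /=.
  have /card_esym/ppcard_eqP[f] := card_nat2.
  exists (uncurry G \o f).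
    split => [i|]; first by rewrite /= /uncurry; case: (f i) => a b; apply (PG a).1.1.
    apply: (@subset_trans _  (\bigcup_n \bigcup_k G n k)) => [t [i _]|].
      by move=> /((PG i).1.2) -[j _ ?]; exists i => //; exists j.
    move=> t [i _ [j _ Bijt]]; exists (f^-1%FUN (i, j)) => //=.
    by rewrite invK ?inE.
  rewrite -(esum_pred_image (hausdorff_gauge s \o uncurry G) _ xpredT)
    ?[fun=> _]set_true//.
  by rewrite image_eq.
rewrite (_ : esum _ _ =
    \sum_(i <oo) \sum_(j <oo) hausdorff_gauge s (G i j)); last first.
  pose J : nat -> set (nat * nat) := fun i => [set (i, j) | j in setT].
  rewrite (_ : setT = \bigcup_k J k); last first.
    by rewrite predeqE => -[a b]; split => // _; exists a => //; exists b.
  rewrite esum_bigcupT /=; last 2 first.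
    - apply/trivIsetP => i j _ _ ij.
      rewrite predeqE => -[n m] /=; split => //= -[] [_] _ [<-{n} _].
      by move=> [m' _] [] /esym/eqP; rewrite (negbTE ij).
    - by move=> /= [n m]; exact: hausdorff_gauge_ge0.
  rewrite -(image_id [set: nat]) -fun_true esum_pred_image//; last first.
    by move=> n _; apply: esum_ge0 => *; exact: hausdorff_gauge_ge0.
  apply: eq_eseriesr => /= j _.
  rewrite -(esum_pred_image (hausdorff_gauge s \o uncurry G) (pair j) predT)//=;
    first last.
  - by move=> ? ? _ _; exact: (@can_inj _ _ _ snd).
  - by move=> *; exact: hausdorff_gauge_ge0.
  by congr esum; rewrite predeqE => -[a b]; split; move=> [i _ <-]; exists i.
apply: lee_lim.
- apply: is_cvg_nneseries => n *.
  by apply: nneseries_ge0 => m *; exact: (G_ge0 (n, m)).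
- apply: is_cvg_nneseries => n *; apply: adde_ge0 => //.
  exact: hausdorff_content_ge0.
- by near=> n; apply: lee_sum => i _; exact: (PG i).2.
Unshelve. all: by end_near. Qed.

Lemma hausdorff_measure0 s : hausdorff_measure s set0 = 0.
Proof.
rewrite /hausdorff_measure; apply/eqP; rewrite eq_le; apply/andP; split.
  by apply: ge_ereal_sup => _ [d /= d0 <-]; rewrite hausdorff_content0.
by apply: ereal_sup_ubound; exists 1%R; rewrite ?hausdorff_content0/=.
Qed.

Lemma hausdorff_measure_ge0 s A : 0 <= hausdorff_measure s A.
Proof.
apply: (le_trans (hausdorff_content_ge0 s 1 A)).
by apply: ereal_sup_ubound; exists 1%R => /=.
Qed.

Lemma le_hausdorff_measure s :
  {homo hausdorff_measure s : A B / A `<=` B >-> A <= B}.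
Proof.
move=> A B AB; apply: ge_ereal_sup => _ [d /= d0 <-].
apply: (le_trans (le_hausdorff_content s d AB)).
by apply: ereal_sup_ubound; exists d.
Qed.

Lemma hausdorff_measure_sigma_subadditive s :
  sigma_subadditive (hausdorff_measure s).
Proof.
move=> A; apply: ge_ereal_sup => _ [d /= d0 <-].
apply: (le_trans (hausdorff_content_sigma_subadditive s d A)).
apply: lee_nneseries => [i *|i _]; first exact: hausdorff_content_ge0.
by apply: ereal_sup_ubound; exists d.
Qed.

HB.instance Definition _ s := isOuterMeasure.Build R M (hausdorff_measure s)
  (hausdorff_measure0 s) (hausdorff_measure_ge0 s) (@le_hausdorff_measure s)
  (@hausdorff_measure_sigma_subadditive s).

End hausdorff_measure.

Section metric_measure_space.
Context {R : realType} {M : pmetricType R}.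
(* Measures on M are outer measures; "mu-measurable" refers to Caratheodory
   measurability and integrals are taken over `caratheodory_type mu`. *)
Variable mu : {outer_measure set M -> \bar R}.

Definition cara : {measure set (caratheodory_type mu) -> \bar R} := mu.

Definition borel_regular : Prop :=
  (forall A : set M, <<s @open M >> A -> mu.-caratheodory A) /\
  (forall A : set M, exists2 B : set M,
     <<s @open M >> B & A `<=` B /\ mu B = mu A).

Definition metric_measure_space : Prop :=
  borel_regular /\
  (forall (x : M) (r : R), 0 < r -> (0 < mu (ball x r) < +oo)%E).

Definition ahlfors_regular (Q : R) : Prop :=
  exists2 C : R, 0 < C &
    forall (x : M) (r : R), 0 < r -> (r%:E < diam [set: M])%E ->
      ((C^-1 * r `^ Q)%:E <= mu (ball x r) <= (C * r `^ Q)%:E)%E.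

Definition L1loc (f : M -> R[i]) : Prop :=
  [/\ measurable_fun [set: caratheodory_type mu]
        (fun x : caratheodory_type mu => complex.Re (f x)),
      measurable_fun [set: caratheodory_type mu]
        (fun x : caratheodory_type mu => complex.Im (f x)) &
      forall (x : M) (r : R), 0 < r ->
        cara.-integrable (ball x r) (fun y => (complex.Re (f y))%:E) /\
        cara.-integrable (ball x r) (fun y => (complex.Im (f y))%:E)].

Definition average (B : set M) (f : M -> R[i]) : R[i] :=
  Complex ((fine (mu B))^-1 * \int[cara]_(y in B) complex.Re (f y))
          ((fine (mu B))^-1 * \int[cara]_(y in B) complex.Im (f y)).

End metric_measure_space.

Definition porous {R : realType} {M : metricType R} (F : set M) : Prop :=
  exists2 c : R, 0 < c < 1 &
    forall (x : M) (r : R), 0 < r -> (r%:E < diam [set: M])%E ->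
      ball x r `&` F !=set0 ->
      exists y : M, ball y (c * r) `<=` ball x r `\` F.

Section hyperbolic_filling.
Context {R : realType} {M : metricType R}.

Definition separated_by (d : R) (S : set M) : Prop :=
  forall x y, S x -> S y -> x <> y -> d <= mdist x y.

Definition maximal_separated (d : R) (S : set M) : Prop :=
  separated_by d S /\
  (forall T : set M, separated_by d T -> S `<=` T -> T = S).

(* A vertex x at level |x| = n with centre xi_x is the pair (n, xi_x). *)
Definition vball (v : int * M) : set M := ball v.2 (2 ^ (- v.1)).

Definition vertex_adjacent (net : int -> set M) (v w : int * M) : Prop :=
  [/\ net v.1 v.2, net w.1 w.2, v <> w, `|v.1 - w.1| <= 1 &
      vball v `&` vball w !=set0].

(* `edges` holds the oriented edges (e_-, e_+). *)
Record hyperbolic_filling := HyperbolicFilling {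
  net : int -> set M ;
  edges : set ((int * M) * (int * M)) ;
  net_maximal : forall n, maximal_separated (2 ^ (- n - 1)) (net n) ;
  edges_adjacent : forall e, edges e -> vertex_adjacent net e.1 e.2 ;
  edges_oriented : forall v w, vertex_adjacent net v w ->
    edges (v, w) <-> ~ edges (w, v) ;
  edges_upward : forall e, edges e -> e.1.1 <= e.2.1 }.

Definition elevel (e : (int * M) * (int * M)) : int := Num.min e.1.1 e.2.1.

Definition eball (e : (int * M) * (int * M)) : set M := vball e.1 `|` vball e.2.

Definition graph_diff (u : int * M -> R[i]) (e : (int * M) * (int * M)) : R[i] :=
  u e.2 - u e.1.

End hyperbolic_filling.

Definition lq_norm {R : realType} {I : choiceType} (q : \bar R) (S : set I)
    (a : I -> \bar R) : \bar R :=
  (match q with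
   | r%:E => (\esum_(i in S) (a i `^ r)) `^ r^-1
   | _ => ereal_sup (0 |` [set a i | i in S])
   end)%E.

Section function_spaces.
Context {R : realType} {M : pmetricType R}.
Variables (mu : {outer_measure set M -> \bar R}).
Variable (X : @hyperbolic_filling R M).
Implicit Types (f : M -> R[i]) (s p : R) (q : \bar R).

Definition discretize f (v : int * M) : R[i] := average mu (vball v) f.

Definition edge_diff f (e : (int * M) * (int * M)) : R :=
  Normc.normc (graph_diff (discretize f) e).

Definition besov_norm s (p : \bar R) q f : \bar R :=
  lq_norm q [set: int] (fun k : int =>
    (2 `^ (k%:~R * s))%:E *
    Lnorm (cara mu) p (fun x : M =>
      \esum_(e in [set e | edges X e /\ elevel e = k])
        (edge_diff f e * \1_(eball e) x)%:E))%E.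

Definition besov s (p : \bar R) q : set (M -> R[i]) :=
  [set f | L1loc mu f /\ (besov_norm s p q f < +oo)%E].

Definition triebel_lizorkin_norm s p q f : \bar R :=
  Lnorm (cara mu) p%:E (fun x : M => lq_norm q (edges X) (fun e =>
    (2 `^ ((elevel e)%:~R * s) * edge_diff f e * \1_(eball e) x)%:E)).

Definition triebel_lizorkin s p q : set (M -> R[i]) :=
  [set f | L1loc mu f /\ (triebel_lizorkin_norm s p q f < +oo)%E].

End function_spaces.

(* L is defined on functions, but acts on classes: it respects equality almost
   everywhere and equality almost everywhere up to additive constants, and
   linearity is understood almost everywhere. *)
Definition bounded_linear_operator {R : realType} {M N : pmetricType R}
    (mu : {outer_measure set M -> \bar R})
    (nu : {outer_measure set N -> \bar R})
    (A : set (M -> R[i])) (normA : (M -> R[i]) -> \bar R)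
    (B : set (N -> R[i])) (normB : (N -> R[i]) -> \bar R)
    (L : (M -> R[i]) -> (N -> R[i])) : Prop :=
  [/\ forall f, A f -> B (L f),
      forall f g, A f -> A g ->
        {ae cara mu, forall x, f x = g x} ->
        {ae cara nu, forall y, L f y = L g y},
      forall f g, A f -> A g ->
        (exists c, {ae cara mu, forall x, f x - g x = c}) ->
        (exists c, {ae cara nu, forall y, L f y - L g y = c}),
      forall (a : R[i]) f g, A f -> A g ->
        {ae cara nu, forall y, L (fun x => a * f x + g x) y = a * L f y + L g y} &
      exists2 C : R, 0 <= C &
        forall f, A f -> (normB (L f) <= C%:E * normA f)%E].

(* Main.v *)
(* Write d = d(., F).  Averages of f over vertices of level k whose balls contain
   a point t of F telescope as k grows, and R f(t) is their limit.  Porosity puts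
   into each ball meeting F a hole of comparable radius whose distance to F is
   also comparable, so holes of different levels essentially do not overlap: on
   the holes the inner norm of F^s_{p,q} dominates a single term, whatever q is,
   and integrating gives the sum of 2^{k(sp-Q)} |osc f|^p over the vertices
   meeting F.  A Schur test for levels turns this into the Besov norm on F.

   Conversely, E g(x) averages g over F at scale d(x).  At a point w with
   d(w) ~ 2^{-j}, an edge of level n >= j sees E g as Lipschitz at scale 2^{-j},
   which gives the factor 2^{-(n-j)}; an edge of level n < j is bounded by
   oscillations of g near w at all levels >= n.  After multiplication by 2^{ns}
   both bounds decay geometrically in |n - j|, in the first case because s < 1
   and in the second because porosity forces lambda < Q, so again q is
   irrelevant; the same Schur test gives boundedness.  The bound for low-level
   edges also shows that the averages of E g along the chains approaching F
   have the same limits as those of g, whence R E g = g.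

   All Hoelder-type steps are made for p < 1 as well.  The Lebesgue
   differentiation theorem is proved in the mean over dyadic averages, so no
   covering lemma or maximal function is needed. *)

Require Import Defs.
From HB Require Import structures.
From mathcomp Require Import all_boot all_order all_algebra finmap.
From mathcomp Require Import all_classical all_reals all_analysis.
From mathcomp Require Import measurable_realfun.
From mathcomp Require Import complex.
From mathcomp Require Import zify ring lra.

Import Order.TTheory GRing.Theory Num.Theory.
Import numFieldTopology.Exports numFieldNormedType.Exports.

Set Implicit Arguments.
Unset Strict Implicit.
Unset Printing Implicit Defensive.

Local Open Scope classical_set_scope.
Local Open Scope ring_scope.

(** The lower volume bound of a regular space fails for radii far beyond the diameter, and this
    shapes many statements: a radius is called essential when the bound is available, and at the
    other levels all balls are the whole space, so all averages coincide. The lower bound on p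
    enters through one gap of exponents, lam p - lam max(0, p - 1) + (s p - Q) > 0. This is what the
    Schur test asks for when a vertex k levels finer carries the fraction 2^(-k lam) of the mass and
    there are about 2^(k lam) of them; it reads p > (Q - lam)/s for p >= 1 and p > Q/(lam + s) for p
    <= 1. Moreover sigma = s - (Q - lam)/p is positive and sigma p - lam = s p - Q, so oscillations
    on the subset and in the space carry the same weights. The integrands of the norms are not shown
    to be measurable; they are compared with countable sums of multiples of indicators. Real and
    imaginary parts are treated separately, both dominated by the oscillation of the complex
    function. *)

Lemma powRD_pos {R : realType} (x r t : R) : 0 < x ->
  x `^ (r + t) = x `^ r * x `^ t.
Proof. by move=> x0; rewrite powRD// (gt_eqF x0) implybT. Qed.

Lemma powR_div {R : realType} (x y r : R) : 0 <= x -> 0 <= y ->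
  (x / y) `^ r = x `^ r * y `^ (- r).
Proof.
move=> x0 y0; rewrite powRM ?invr_ge0//; congr (_ * _).
by rewrite -powR_inv1// -powRrM mulN1r.
Qed.

(** * Unordered sums *)

Section nonnegative_sums.
Context {R : realType}.
Local Open Scope ereal_scope.

Lemma ge_esum_term (I : choiceType) (S : set I) (a : I -> \bar R) i :
  (forall j, S j -> 0 <= a j) -> S i -> a i <= \esum_(j in S) a j.
Proof.
move=> a0 Si; apply: esum_ge; exists [set i]; last by rewrite fsbig_set1.
by split; [exact: finite_set1 | move=> _ ->].
Qed.

Lemma esum_leP (I : choiceType) (S : set I) (a : I -> \bar R) c :
  (forall F, finite_set F -> F `<=` S -> \sum_(i \in F) a i <= c) ->
  \esum_(i in S) a i <= c.
Proof. by move=> h; apply: ge_ereal_sup => _ [F [Ff FS] <-]; exact: h. Qed.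

Lemma subset_le_esum (I : choiceType) (S T : set I) (a : I -> \bar R) :
  (forall i, T i -> 0 <= a i) -> S `<=` T ->
  \esum_(i in S) a i <= \esum_(i in T) a i.
Proof.
move=> a0 ST; apply: esum_leP => F Ff FS; apply: esum_ge; exists F => //.
by split => //; exact: subset_trans ST.
Qed.

Lemma esumZl (I : choiceType) (S : set I) (a : I -> \bar R) c :
  0 <= c -> (forall i, S i -> 0 <= a i) ->
  \esum_(i in S) (c * a i) = c * \esum_(i in S) a i.
Proof.
have le_Zl d (b : I -> \bar R) : 0 <= d -> (forall i, S i -> 0 <= b i) ->
    \esum_(i in S) (d * b i) <= d * \esum_(i in S) b i.
  move=> d0 b0; apply: esum_leP => F Ff FS.
  rewrite fsbig_finite//= big_seq_cond -ge0_sume_distrr; last first.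
    move=> i /andP[+ _]; rewrite in_fset_set// inE => /FS; exact: b0.
  apply: lee_wpmul2l => //; rewrite -big_seq_cond -fsbig_finite//.
  by apply: esum_ge; exists F.
move=> c0 a0; apply/eqP; rewrite eq_le le_Zl//=.
case: c c0 => [r| |//] c0.
  have [->|rn0] := eqVneq r 0%R; first by rewrite mul0e esum_ge0// => i _; rewrite mul0e.
  have r0 : (0 < r)%R by rewrite lt_neqAle eq_sym rn0 -lee_fin.
  rewrite -lee_pdivlMl//.
  apply: le_trans (le_Zl r^-1%:E (fun i => r%:E * a i) _ _) => //.
  - apply: le_esum => i Si; rewrite muleA -EFinM mulVf ?mul1e//.
  - by rewrite lee_fin invr_ge0 ltW.
  - by move=> i Si; rewrite mule_ge0// a0.
have [s0|s0] := eqVneq (\esum_(i in S) a i) 0.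
  rewrite s0 mule0; apply: esum_ge0 => i Si; rewrite mule_ge0// a0//.
have [i Si ai] : exists2 i, S i & 0 < a i.
  apply: contrapT => h; move/eqP: s0; apply; apply: esum1 => i Si.
  apply/eqP; rewrite eq_le a0// andbT leNgt; apply/negP => ai; apply: h.
  by exists i.
apply: le_trans (ge_esum_term (i := i) _ Si); last first.
  by move=> j Sj; rewrite mule_ge0// a0.
by rewrite [leRHS]gt0_mulye// leey.
Qed.

Lemma exchange_esum (I J : choiceType) (S : set I) (T : I -> set J)
    (T' : set J) (S' : J -> set I) (a : I -> J -> \bar R) :
  (forall i j, S i /\ T i j <-> T' j /\ S' j i) ->
  (forall i j, S i -> T i j -> 0 <= a i j) ->
  \esum_(i in S) \esum_(j in T i) a i j = \esum_(j in T') \esum_(i in S' j) a i j.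
Proof.
move=> ST a0; rewrite esum_esum// esum_esum; last first.
  by move=> j i Tj Sji; have [? ?] := (ST i j).2 (conj Tj Sji); exact: a0.
rewrite (@reindex_esum _ _ _ (T' `*`` S') _ (fun k => (k.2, k.1)) (fun k : I * J => a k.1 k.2))//; split => /=.
- by move=> [j i] /= h; exact/ST.
- by move=> [j i] [j' i'] _ _ /= [-> ->].
- by move=> [i j] /= /ST h; exists (j, i).
Qed.

Lemma esum_fiber (I J : choiceType) (S : set I) (f : I -> J) (a : I -> \bar R) :
  (forall i, S i -> 0 <= a i) ->
  \esum_(i in S) a i = \esum_(j in [set: J]) \esum_(i in S `&` [set i | f i = j]) a i.
Proof.
move=> a0.
rewrite (@exchange_esum _ _ setT _ S (fun i => [set f i]))//.
- by apply: eq_esum => i Si; rewrite esum_set1// a0.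
- move=> j i; split => [[_ [Si <-]]//|[Si ->]]; split => //.
- by move=> j i _ [] /a0.
Qed.

Lemma esum_geometric (e : R) : (0 < e)%R ->
  \esum_(j in [set: nat]) (2 `^ (- j%:R * e))%:E <= ((1 - 2 `^ (- e))^-1)%:E.
Proof.
move=> e0; set r : R := (2 `^ (- e))%R.
have r0 : (0 < r)%R by exact: powR_gt0.
have r1 : (r < 1)%R.
  by rewrite /r powRN invf_lt1 ?powR_gt0// -[ltLHS](congr1 (@^~ e) (powR1 R)) gt0_ltr_powR// ?nnegrE// ltr1n.
have E j : (2 `^ (- j%:R * e) = r ^+ j)%R.
  by rewrite /r -powR_mulrn ?powR_ge0// -powRrM; congr (_ `^ _)%R; ring.
rewrite -nneseries_esumT => [|j]; last by rewrite lee_fin powR_ge0.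
apply: lime_le; first by apply: is_cvg_nneseries => *; rewrite lee_fin powR_ge0.
apply: nearW => n; rewrite sumEFin lee_fin.
under eq_bigr do rewrite E.
have H : ((1 - r) * \sum_(0 <= j < n) r ^+ j = 1 - r ^+ n)%R.
  elim: n => [|n IH]; first by rewrite big_nil expr0 subrr mulr0.
  by rewrite big_nat_recr//= mulrDr IH exprS; ring.
rewrite -(ler_pM2l (x := 1 - r)%R) ?subr_gt0// H divff ?gt_eqF ?subr_gt0//.
by rewrite lerBlDr lerDl exprn_ge0// ltW.
Qed.

(** Grouped by level, level k contributes at most N 2^(-(k - m)(ka - th)): a count growing at rate
    [th] is beaten by a weight decaying at the faster rate [ka], and a geometric series remains. *)
Lemma esum_level_decay (I : choiceType) (S : set I) (l : I -> int) (m : int)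
    (th ka N : R) : (th < ka)%R -> (0 <= N)%R ->
  (forall i, S i -> (m <= l i)%R) ->
  (forall k, (m <= k)%R -> \esum_(i in S `&` [set i | l i = k]) 1 <=
     (N * 2 `^ ((k - m)%:~R * th))%:E) ->
  \esum_(i in S) (2 `^ (- (l i - m)%:~R * ka))%:E <=
    (N * (1 - 2 `^ (- (ka - th)))^-1)%:E.
Proof.
move=> thka N0 Sm cnt.
rewrite (esum_fiber l) => [|i _]; last by rewrite lee_fin powR_ge0.
pose S' k := S `&` [set i | l i = k].
have -> : \esum_(k in [set: int]) \esum_(i in S' k) (2 `^ (- (l i - m)%:~R * ka))%:E
   = \esum_(k in [set k | (m <= k)%R]) \esum_(i in S' k) (2 `^ (- (k - m)%:~R * ka))%:E.
  rewrite [RHS]esum_mkcond; apply: eq_esum => k _; case: ifPn => [_|].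
    by apply: eq_esum => i [_ /= <-].
  rewrite notin_setE/= => mk; apply: esum1 => i [/Sm + /= lik].
  by rewrite lik => /mk.
rewrite (@reindex_esum _ _ _ [set: nat] _ (fun j : nat => (m + j%:Z)%R)); last first.
  split => [j _ /=|i j _ _ /addrI []//|k /= mk]; first by rewrite lerDl.
  by exists `|k - m|%N => //; rewrite gez0_abs ?subr_ge0//; ring.
have h j : \esum_(i in S' (m + j%:Z)%R) (2 `^ (- (m + j%:Z - m)%:~R * ka))%:E <=
    N%:E * (2 `^ (- j%:R * (ka - th)))%:E.
  have -> : (m + j%:Z - m = j%:Z)%R by ring.
  under eq_esum do rewrite -[X in X%:E]mulr1 EFinM.
  rewrite esumZl ?lee_fin ?powR_ge0//.
  apply: (@le_trans _ _ ((2 `^ (- j%:~R * ka))%:E * (N * 2 `^ (j%:R * th))%:E)).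
    apply: lee_wpmul2l; first by rewrite lee_fin powR_ge0.
    apply: le_trans (cnt (m + j%:Z)%R _) _; first by rewrite lerDl.
    by rewrite (_ : (m + j%:Z - m = j%:Z)%R)//; ring.
  rewrite -!EFinM lee_fin mulrCA -powRD ?pnatr_eq0 ?implybT//.
  by rewrite le_eqVlt; apply/orP; left; apply/eqP; congr (_ * _ `^ _)%R; ring.
apply: le_trans (le_esum (fun j _ => h j)) _.
rewrite esumZl ?lee_fin//.
rewrite [leRHS]EFinM; apply: lee_wpmul2l; first by rewrite lee_fin.
by apply: esum_geometric; rewrite subr_gt0.
Qed.

Lemma finite_esum1 (I : choiceType) (S : set I) :
  \esum_(i in S) (1 : \bar R) < +oo -> finite_set S.
Proof.
move=> h; apply: contrapT => Sinf.
have : \esum_(i in S) (1 : \bar R) \is a fin_num.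
  by rewrite ge0_fin_numE// esum_ge0.
move=> /fineK; set t := fine _ => tE.
have [A AS cA] := infinite_set_fset (Num.truncn t).+1 Sinf.
pose X : set I := [set` A].
have Xfin : finite_set X by exact: finite_fset.
have : \sum_(i \in X) (1 : \bar R) <= t%:E.
  by rewrite tE; apply: esum_ge; exists X.
rewrite fsbig_finite//= set_fsetK sumEFin lee_fin.
rewrite big_const_seq count_predT iter_addr_0 => h2.
have := truncnS_gt t; rewrite ltNge => /negP; apply.
by apply: le_trans h2; rewrite ler_nat.
Qed.

(* Young-type splitting replacing Hoelder's inequality: compare each term with
   the mean value of the sequence. *)
Lemma esum_poweR_weighted (I : choiceType) (S : set I) (w : I -> R)
    (t : I -> \bar R) (p C0 : R) : (0 < p)%R -> (0 < C0)%R ->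
  (forall i, (0 < w i)%R) -> (forall i, S i -> 0 <= t i) ->
  ((1 < p)%R -> \esum_(i in S) (w i)%:E <= C0%:E) ->
  (\esum_(i in S) t i) `^ p <= (2 `^ p * C0 `^ Num.max 0 (p - 1))%:E *
    \esum_(i in S) ((w i `^ (- Num.max 0 (p - 1)))%:E * t i `^ p).
Proof.
move=> p0 C0_gt0 w0 t0 sw.
set c := Num.max _ _; set B := \esum_(i in S) (_ * _).
have K0 : (0 < 2 `^ p * C0 `^ c :> R)%R by rewrite mulr_gt0 ?powR_gt0.
have term0 i : S i -> 0 <= (w i `^ (- c))%:E * t i `^ p.
  by move=> _; rewrite mule_ge0 ?lee_fin ?powR_ge0 ?poweR_ge0.
have B0 : 0 <= B by exact: esum_ge0.
have tB i : S i -> (w i `^ (- c))%:E * t i `^ p <= B.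
  by move=> Si; apply: ge_esum_term.
have [Boo|Boo] := eqVneq B +oo.
  by rewrite Boo gt0_muley ?lte_fin// leey.
have BE : B = (fine B)%:E by rewrite fineK// ge0_fin_numE// ltey.
set b := fine B in BE.
have b0 : (0 <= b)%R by rewrite -lee_fin -BE.
have tfin i : S i -> t i = (fine (t i))%:E.
  move=> Si; rewrite fineK// ge0_fin_numE ?t0// ltey; apply/negP => /eqP tE.
  have := tB i Si; rewrite tE poweRyr ?gt_eqF// gt0_muley ?lte_fin ?powR_gt0//.
  by rewrite leye_eq (negbTE Boo).
have ft0 i : S i -> (0 <= fine (t i))%R by move=> Si; rewrite fine_ge0// t0.
have tb i : S i -> (w i `^ (- c) * fine (t i) `^ p <= b)%R.
  by move=> Si; rewrite -lee_fin -BE EFinM -(poweR_EFin (fine (t i))) -tfin//; exact: tB.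
have [b_eq0|bn0] := eqVneq b 0%R.
  rewrite BE b_eq0 mule0 esum1 ?poweR0r ?gt_eqF// => i Si.
  have := tb i Si; rewrite b_eq0 => ti0.
  have /eqP : (w i `^ (- c) * fine (t i) `^ p = 0)%R.
    by apply/eqP; rewrite eq_le ti0 mulr_ge0 ?powR_ge0.
  rewrite mulf_eq0 gt_eqF/= ?powR_gt0// => /eqP/powR_eq0_eq0 fti.
  by rewrite tfin// fti.
have b_gt0 : (0 < b)%R by rewrite lt_neqAle eq_sym bn0.
suff : \esum_(i in S) t i <= (2 * C0 `^ (c / p) * b `^ p^-1)%:E.
  move=> h.
  apply: (@le_trans _ _ ((2 * C0 `^ (c / p) * b `^ p^-1)%:E `^ p)).
    apply: gt0_ler_poweR => //; rewrite ?in_itv/= ?leey ?andbT ?esum_ge0//; first exact: ltW.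
    by rewrite lee_fin !mulr_ge0 ?powR_ge0.
  rewrite poweR_EFin BE -EFinM lee_fin !powRM ?mulr_ge0 ?powR_ge0//.
  by rewrite -!powRrM mulVf ?gt_eqF// divfK ?gt_eqF// powRr1.
have [p1|p1] := leP p 1%R.
  have cE : c = 0%R by apply/max_idPl; rewrite subr_le0.
  have sB : \esum_(i in S) (fine (t i) `^ p)%:E = b%:E.
    rewrite -BE; apply: eq_esum => i Si.
    by rewrite cE oppr0 powRr0 mul1e [in RHS]tfin.
  rewrite cE mul0r powRr0 mulr1.
  apply: (@le_trans _ _ ((b `^ (p^-1 - 1))%:E * b%:E)).
    rewrite -sB -esumZl ?lee_fin ?powR_ge0//; last first.
      by move=> i _; rewrite lee_fin powR_ge0.
    apply: le_esum => i Si; rewrite [leLHS]tfin// -EFinM lee_fin.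
    have := tb i Si; rewrite cE oppr0 powRr0 mul1r => tib.
    have [->|fti] := eqVneq (fine (t i)) 0%R.
      by rewrite mulr_ge0 ?powR_ge0.
    have E : (fine (t i) = (fine (t i) `^ p) `^ (p^-1 - 1) * fine (t i) `^ p)%R.
      rewrite -powRrM -powRD ?fti ?implybT// -[LHS]powRr1 ?ft0//.
      by congr (_ `^ _)%R; field; rewrite gt_eqF.
    rewrite [leLHS]E; apply: ler_wpM2r; first exact: powR_ge0.
    apply: ge0_ler_powR; rewrite ?nnegrE ?powR_ge0//.
    by rewrite subr_ge0 invf_ge1.
  rewrite -EFinM lee_fin -[X in (_ * X <= _)%R]powRr1// -powRD ?bn0 ?implybT//.
  by rewrite subrK ler_peMl ?powR_ge0// ler1n.
have cE : (c = p - 1)%R by apply/max_idPr; rewrite subr_ge0 ltW.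
(* A term at most w_i M is summed by means of the weights; a larger one is at most M^(1 - p) w_i^(1
   - p) t_i^p. This M makes both bounds equal to C0^((p - 1)/p) b^(1/p). *)
pose M := ((b / C0) `^ p^-1)%R.
have M0 : (0 < M)%R by rewrite powR_gt0 ?divr_gt0.
apply: (@le_trans _ _ (\esum_(i in S) ((w i)%:E * M%:E +
    (M `^ (1 - p))%:E * ((w i `^ (- c))%:E * t i `^ p)))).
  apply: le_esum => i Si; rewrite [in leLHS]tfin// [in leRHS]tfin// poweR_EFin.
  rewrite -!EFinM -EFinD lee_fin; set f := fine (t i).
  have [fM|fM] := leP f (w i * M)%R.
    by apply: le_trans fM _; rewrite lerDl !mulr_ge0 ?powR_ge0.
  have f0 : (0 < f)%R by apply: lt_trans fM; rewrite mulr_gt0.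
  rewrite -[leLHS]add0r; apply: lerD; first by rewrite mulr_ge0// ltW.
  have -> : (M `^ (1 - p) * (w i `^ (- c) * f `^ p) = (f / (w i * M)) `^ (p - 1) * f)%R.
    have fp : (f `^ p = f `^ (p - 1) * f)%R.
      by rewrite -[X in (_ = _ * X)%R]powRr1 ?ltW// -powRD ?gt_eqF ?implybT// subrK.
    have wM0 : (0 <= w i * M)%R by rewrite mulr_ge0 ?ltW.
    have E : ((f / (w i * M)) `^ (p - 1) =
        f `^ (p - 1) * (w i `^ (- (p - 1)) * M `^ (1 - p)))%R.
      rewrite (powRM _ (ltW f0)) ?invr_ge0//; congr (_ * _)%R.
      rewrite -powR_inv1// -powRrM mulN1r (powRM _ (ltW (w0 i)) (ltW M0)).
      by rewrite opprB.
    rewrite cE fp E.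
    by ring.
  rewrite ler_peMl ?(ltW f0)// -[leLHS](powRr0 (f / (w i * M))).
  rewrite ler_powR ?subr_ge0 ?(ltW p1)//.
  by rewrite ler_pdivlMr ?mulr_gt0// mul1r ltW.
rewrite esumD//; last 2 first.
- by move=> i _; rewrite -EFinM lee_fin mulr_ge0// ltW.
- by move=> i Si; rewrite mule_ge0 ?term0// lee_fin powR_ge0.
under eq_esum do rewrite muleC.
rewrite !esumZl ?lee_fin ?powR_ge0 ?(ltW M0)//; last first.
  by move=> i _; rewrite lee_fin ltW.
rewrite -/B BE.
apply: (@le_trans _ _ (M%:E * C0%:E + (M `^ (1 - p))%:E * b%:E)).
  by apply: leeD => //; apply: lee_wpmul2l; [rewrite lee_fin ltW | exact: sw].
rewrite -!EFinM -EFinD lee_fin cE.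
have pn0 : p != 0%R by rewrite gt_eqF.
have bC : ((b / C0) `^ p^-1 = b `^ p^-1 * C0 `^ (- p^-1))%R.
  by rewrite powR_div// ltW.
have -> : (M * C0 = C0 `^ ((p - 1) / p) * b `^ p^-1)%R.
  rewrite /M bC -mulrA -[X in (_ * (_ * X))%R]powRr1 ?(ltW C0_gt0)//.
  by rewrite -powRD_pos// mulrC; congr (_ `^ _ * _)%R; field.
have -> : (M `^ (1 - p) * b = C0 `^ ((p - 1) / p) * b `^ p^-1)%R.
  rewrite /M bC powRM ?powR_ge0// -!powRrM -[X in (_ * _ * X)%R = _]powRr1//.
  by rewrite mulrAC -powRD_pos// mulrC; congr (_ `^ _ * _ `^ _)%R; field.
by rewrite le_eqVlt; apply/orP; left; apply/eqP; ring.
Qed.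

End nonnegative_sums.

(** * Integrals of sums *)

Section measure_preliminaries.
Context {R : realType} d (T : measurableType d) (m : {measure set T -> \bar R}).
Local Open Scope ereal_scope.
Implicit Types f g : T -> \bar R.

(* Unlike ge0_le_integral, no measurability is required: the integral of a
   nonnegative function is a supremum over simple functions. *)
Lemma le_integral_nonmeasurable f g :
  (forall x, 0 <= f x) -> (forall x, f x <= g x) -> \int[m]_x f x <= \int[m]_x g x.
Proof.
move=> f0 fg; have g0 x : 0 <= g x by exact: le_trans (fg x).
rewrite !ge0_integralTE//; apply: le_ereal_sup => _ [h hf <-].
by exists h => // x; apply: le_trans (fg x); exact: hf.
Qed.

(** The exceptional set is removed by raising [g] to +oo on a null set containing it: [g] stays
    measurable, its integral does not change, and the inequality then holds everywhere. *)
Lemma ae_le_integral_nonmeasurable f g :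
  (forall x, 0 <= f x) -> (forall x, 0 <= g x) -> measurable_fun [set: T] g ->
  {ae m, forall x, f x <= g x} -> \int[m]_x f x <= \int[m]_x g x.
Proof.
move=> f0 g0 mg [N [mN N0 fgN]].
pose h x := g x + +oo * (\1_N x)%:E.
have hN x : x \in N -> h x = +oo.
  by move=> xN; rewrite /h indicE xN mule1 addey// gt_eqF// (lt_le_trans _ (g0 x)).
have hNN x : x \notin N -> h x = g x.
  by move=> xN; rewrite /h indicE (negbTE xN) mule0 adde0.
have h0 x : 0 <= h x by rewrite adde_ge0// mule_ge0// lee_fin.
have mh : measurable_fun [set: T] h.
  apply: emeasurable_funD => //; apply: measurable_funeM.
  exact/measurable_EFinP.
apply: (@le_trans _ _ (\int[m]_x h x)).
  apply: le_integral_nonmeasurable => // x.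
  have [/hN ->|xN] := boolP (x \in N); first by rewrite leey.
  rewrite hNN//; move: xN; rewrite notin_setE => xN.
  by apply: contrapT => fgx; apply: xN; apply: fgN.
rewrite le_eqVlt; apply/orP; left; apply/eqP.
apply: ge0_ae_eq_integral => //.
exists N; split => // x /= hx; apply: contrapT => xN; apply: hx => _.
by rewrite hNN// notin_setE.
Qed.

Section countable_sums.
Context (I : choiceType) (S : set I) (cS : countable S).

(** A bijection with a set of naturals transfers monotone convergence for series to unordered
    sums. *)
Let reindex : S !=set0 -> exists (B : set nat) (e : nat -> I), set_bij B S e.
Proof.
move=> [i0 Si0].
have [f finj] := countable_injP _ cS.
exists (f @` S), (fun n => xget i0 [set i | S i /\ f i = n]).
have K i : S i -> xget i0 [set j | S j /\ f j = f i] = i.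
  move=> Si; have [] := @xgetPex _ i0 [set j | S j /\ f j = f i]; first by exists i.
  by move=> Sj /finj; rewrite !inE => /(_ Sj Si).
split.
- by move=> _ [i Si <-]; rewrite K.
- by move=> n k; rewrite !inE => -[i Si <-] [j Sj <-]; rewrite !K// => ->.
- by move=> i Si; exists (f i); [exists i | rewrite K].
Qed.

Lemma measurable_esum (F : I -> T -> \bar R) :
  (forall i, S i -> measurable_fun [set: T] (F i)) ->
  (forall i x, S i -> 0 <= F i x) ->
  measurable_fun [set: T] (fun x => \esum_(i in S) F i x).
Proof.
move=> mF F0.
have [S0|/set0P/reindex[B [e be]]] := eqVneq S set0.
  by rewrite S0; under eq_fun do rewrite esum_set0; exact: measurable_cst.
have Se n : B n -> S (e n) by case: be => + _ _ Bn; apply.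
under eq_fun => x.
  rewrite (reindex_esum B S e (fun i => F i x) be) esum_mkcond -nneseries_esumT; last first.
    by move=> n; case: ifPn => // /set_mem Bn; apply: F0; exact: Se.
  over.
apply: ge0_emeasurable_sum => [n x _ _|n _].
  by case: ifPn => // /set_mem Bn; apply: F0; exact: Se.
have [/set_mem Bn|_] := boolP (n \in B); last exact: measurable_cst.
by apply: mF; exact: Se.
Qed.

Lemma integral_esum (F : I -> T -> \bar R) :
  (forall i, S i -> measurable_fun [set: T] (F i)) ->
  (forall i x, S i -> 0 <= F i x) ->
  \int[m]_x (\esum_(i in S) F i x) = \esum_(i in S) \int[m]_x F i x.
Proof.
move=> mF F0.
have [S0|/set0P/reindex[B [e be]]] := eqVneq S set0.
  rewrite S0 esum_set0; under eq_integral do rewrite esum_set0.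
  by rewrite integral0.
have Se n : B n -> S (e n) by case: be => + _ _ Bn; apply.
pose G n x := if n \in B then F (e n) x else 0.
have G0 n x : 0 <= G n x.
  by rewrite /G; case: ifPn => // /set_mem Bn; apply: F0; exact: Se.
have mG n : measurable_fun [set: T] (G n).
  rewrite /G; have [/set_mem Bn|_] := boolP (n \in B); last exact: measurable_cst.
  by apply: mF; exact: Se.
have -> : \int[m]_x (\esum_(i in S) F i x) = \int[m]_x (\sum_(n <oo) G n x).
  apply: eq_integral => x _.
  rewrite (reindex_esum B S e (fun i => F i x) be) esum_mkcond -nneseries_esumT//.
  by move=> n; exact: G0.
rewrite integral_nneseries// nneseries_esumT; last by move=> n; apply: integral_ge0.
rewrite (reindex_esum B S e (fun i => \int[m]_x F i x) be) [RHS]esum_mkcond.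
by apply: eq_esum => n _; rewrite /G; case: ifPn => // _; rewrite integral0.
Qed.

End countable_sums.

Lemma integral_cst_indic (A : set T) (c : \bar R) : measurable A -> 0 <= c ->
  \int[m]_x (c * (\1_A x)%:E) = c * m A.
Proof.
move=> mA c0; rewrite ge0_integralZl//; last exact/measurable_EFinP.
by rewrite integral_indic// setIT.
Qed.

Lemma integral_mulr_indic (A : set T) f : measurable A ->
  \int[m]_(x in A) f x = \int[m]_x (f x * (\1_A x)%:E).
Proof.
move=> mA; rewrite integral_mkcond; apply: eq_integral => x _.
by rewrite epatch_indic.
Qed.

Lemma esum_measure_le (I : choiceType) (S : set I) (F : I -> set T) (A : set T) :
  measurable A -> (forall i, S i -> measurable (F i)) ->
  (forall i, S i -> F i `<=` A) -> trivIset S F ->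
  \esum_(i in S) m (F i) <= m A.
Proof.
move=> mA mF FA tF; apply: esum_leP => X Xfin XS.
rewrite -measure_fin_bigcup//; last 2 first.
- exact: sub_trivIset tF.
- by move=> i /XS; exact: mF.
apply: le_measure; rewrite ?inE//.
  by apply: fin_bigcup_measurable => // i /XS; exact: mF.
by move=> x [i /XS Si]; exact: FA.
Qed.

End measure_preliminaries.

(** * Balls and hyperbolic fillings *)

Section dyadic_radius.
Context {R : realType}.

Definition rad (n : int) : R := 2 `^ (- n%:~R).

Lemma radE n : (2 : R) ^ (- n) = rad n.
Proof. by rewrite /rad -powR_intmul// mulrNz. Qed.

Lemma rad_gt0 n : 0 < rad n. Proof. exact: powR_gt0. Qed.

Lemma rad_ge0 n : 0 <= rad n. Proof. exact: powR_ge0. Qed.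

Lemma rad_sub n (k : nat) : rad (n - k%:Z) = 2 ^+ k * rad n.
Proof.
by rewrite /rad -powR_mulrn// -powRD_pos//; congr (_ `^ _); rewrite intrB; ring.
Qed.

Lemma rad_add n (k : nat) : rad n = 2 ^+ k * rad (n + k%:Z).
Proof. by rewrite -rad_sub addrK. Qed.

Lemma le_rad n k : n <= k -> rad k <= rad n.
Proof. by move=> nk; apply: ler_powR; rewrite ?ler1n// lerN2 ler_int. Qed.

Lemma rad_lt_imp n k : rad k < rad n -> n < k.
Proof. by move=> h; rewrite ltNge; apply/negP => /le_rad; rewrite leNgt h. Qed.

Lemma rad_powR n r : rad n `^ r = 2 `^ (- n%:~R * r).
Proof. by rewrite /rad -powRrM. Qed.

Lemma ltr_pow2 (x y : R) : (2 `^ x < 2 `^ y) = (x < y).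
Proof.
apply/idP/idP => h; rewrite ltNge; apply/negP => h'.
  by move: h; rewrite ltNge ler_powR ?ler1n.
have : (2 : R) `^ x = 2 `^ y.
  by apply/eqP; rewrite eq_le h' ler_powR ?ler1n// ltW.
have ln2 : ln (2 : R) != 0 by rewrite gt_eqF// ln_gt0// ltr1n.
move=> /(congr1 (@ln R)); rewrite !ln_powR => /(mulIf ln2) xy.
by rewrite xy ltxx in h.
Qed.

Lemma exists_rad (r : R) : 0 < r -> exists j, rad j <= r < 2 * rad j.
Proof.
move=> r0; pose t := ln r / ln 2; have ln2 : 0 < ln (2 : R) by apply: ln_gt0; rewrite ltr1n.
have rE : r = 2 `^ t.
  by apply: ln_inj; rewrite ?posrE ?powR_gt0// ln_powR divfK// gt_eqF.
exists (- Num.floor t); rewrite /rad mulrNz opprK rE; apply/andP; split.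
  by rewrite ler_powR ?ler1n// ge_floor.
rewrite -[X in X * _ `^ _]powRr1// -powRD_pos// ltr_pow2 addrC.
by have := floorD1_gt t; rewrite intrD.
Qed.

End dyadic_radius.

Section metric_measurability.
Context {R : realType} {M : pmetricType R} (mu : {outer_measure set M -> \bar R}).
Hypothesis mm : metric_measure_space mu.
Let T := caratheodory_type mu.

Lemma in_ball (x y : M) (r : R) : ball x r y <-> mdist x y < r.
Proof. by rewrite ballEmdist. Qed.

Lemma open_ballE (x : M) (r : R) : open (ball x r).
Proof.
rewrite openE => y /in_ball xy; apply/nbhs_ballP.
exists (r - mdist x y) => /=; first by rewrite subr_gt0.
move=> z /in_ball yz; apply/in_ball.
by apply: le_lt_trans (metric_triangle x y z) _; rewrite addrC -ltrBrDr.
Qed.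

Lemma open_caratheodory (A : set M) : open A -> measurable (A : set T).
Proof. by move=> oA; apply: mm.1.1; apply: sub_gen_smallest. Qed.

Lemma closed_caratheodory (A : set M) : closed A -> measurable (A : set T).
Proof.
move=> cA; rewrite -(setCK A); apply: measurableC.
by apply: open_caratheodory; exact: closed_openC.
Qed.

Lemma measurable_ball_cara (x : M) (r : R) : measurable (ball x r : set T).
Proof. by apply: open_caratheodory; exact: open_ballE. Qed.

Lemma measurable_continuous (f : M -> R) :
  continuous f -> measurable_fun [set: T] (f : T -> R).
Proof.
move=> cf; apply: (measurability _ (RGenOInfty.measurableE R)) => //.
move=> _ [_ [a ->] <-]; rewrite setTI; apply: open_caratheodory.
by apply: open_comp; [move=> x _; exact: cf | exact: interval_open].
Qed.

Lemma ball_measure_fin (x : M) (r : R) : (mu (ball x r) < +oo)%E.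
Proof.
have [r0|r0] := ltP 0 r; first by case/andP: (mm.2 x r r0).
rewrite (_ : ball x r = set0) ?outer_measure0//; apply/seteqP; split=> // y.
by move=> /in_ball; rewrite ltNge (le_trans r0)// mdist_ge0.
Qed.

Lemma fine_ball_gt0 (x : M) (r : R) : 0 < r -> 0 < fine (mu (ball x r)).
Proof. by move=> r0; apply: fine_gt0; exact: mm.2. Qed.

Lemma ball_fineE (x : M) (r : R) : mu (ball x r) = (fine (mu (ball x r)))%:E.
Proof.
by rewrite fineK// ge0_fin_numE ?ball_measure_fin// outer_measure_ge0.
Qed.

Lemma fine_ball_mulV (x : M) (r : R) : 0 < r ->
  ((fine (mu (ball x r)))^-1%:E * mu (ball x r) = 1)%E.
Proof.
by move=> r0; rewrite [X in (_ * X)%E]ball_fineE -EFinM mulVf// gt_eqF// fine_ball_gt0.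
Qed.

Lemma le_mu (A B : set M) : A `<=` B -> (mu A <= mu B)%E.
Proof. by move=> AB; apply: le_outer_measure. Qed.

End metric_measurability.

(* Lower volume bounds hold only at radii not much larger than the diameter. *)
Definition essential {R : realType} (M : pmetricType R) (r : R) : Prop :=
  exists x y : M, r <= 4 * mdist x y.

Lemma essential_le {R : realType} (M : pmetricType R) (r t : R) :
  t <= r -> essential M r -> essential M t.
Proof. by move=> tr [x [y rxy]]; exists x, y; exact: le_trans rxy. Qed.

Lemma inessential_mdist {R : realType} (M : pmetricType R) (r : R) (x y : M) :
  ~ essential M r -> mdist x y < r / 4.
Proof.
move=> h; rewrite ltNge; apply/negP => rxy; apply: h; exists x, y.
by move: rxy; rewrite ler_pdivrMr// mulrC.
Qed.

(** Ahlfors regularity in the form used below. The upper bound is extended to all radii; the lower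
    bound is asked on the essential radii, a class that is stable under shrinking and under passing
    from a subset to the space, and that reaches beyond the diameter by a bounded factor. *)
Definition regular_bounds {R : realType} {M : pmetricType R}
    (mu : {outer_measure set M -> \bar R}) (Q C : R) : Prop :=
  1 <= C /\ forall (x : M) (r : R), 0 < r ->
    (mu (ball x r) <= (C * r `^ Q)%:E)%E /\
    (essential M r -> ((C^-1 * r `^ Q)%:E <= mu (ball x r))%E).

(** If the diameter D is finite, a ball of radius above D is the whole space, of measure m, and m <=
    (m / D^Q) r^Q for r >= D; the two points ensure D > 0. An essential radius r satisfies r / 8 <
    diam, which costs 8^Q in the lower bound. *)
Lemma ahlfors_regular_bounds {R : realType} {M : pmetricType R}
    (mu : {outer_measure set M -> \bar R}) (Q : R) (z1 z2 : M) :
  0 < Q -> metric_measure_space mu -> ahlfors_regular mu Q -> z1 <> z2 ->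
  exists C, regular_bounds mu Q C.
Proof.
move=> Q0 mm [C C0 CP] z12.
have mdiam (x y : M) : ((mdist x y)%:E <= diam [set: M])%E.
  by apply: ereal_sup_ubound; right; exists (x, y).
have [C1 C1P] : exists C1 : R, forall (x : M) (r : R), 0 < r ->
    (mu (ball x r) <= (C1 * r `^ Q)%:E)%E.
  have d12 : 0 < mdist z1 z2 by rewrite mdist_gt0; apply/eqP.
  case E : (diam [set: M]) => [D| |].
  - have D0 : 0 < D by rewrite (lt_le_trans d12)// -lee_fin -E.
    have BT x (r : R) : D < r -> ball x r = [set: M].
      move=> Dr; apply/seteqP; split=> // y _; apply/in_ball.
      by apply: le_lt_trans Dr; rewrite -lee_fin -E.
    pose m := fine (mu [set: M]).
    have mE : mu [set: M] = m%:E.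
      by rewrite /m -(BT z1 (D + 1)) ?ltrDl// (ball_fineE mm).
    have m0 : 0 <= m by rewrite -lee_fin -mE outer_measure_ge0.
    exists (C + m / D `^ Q) => x r r0.
    have [rD|Dr] := ltP r D.
      have rdiam : (r%:E < diam [set: M])%E by rewrite E lte_fin.
      have /andP[_ h] := CP x r r0 rdiam; apply: le_trans h _.
      rewrite lee_fin; apply: ler_wpM2r; first exact: powR_ge0.
      by rewrite lerDl divr_ge0 ?powR_ge0.
    apply: (@le_trans _ _ m%:E); first by rewrite -mE; exact: le_mu.
    rewrite lee_fin mulrDl -[leLHS]add0r lerD ?mulr_ge0 ?powR_ge0//; first exact: ltW.
    rewrite -mulrA ler_peMr// mulrC ler_pdivlMr ?powR_gt0// mul1r.
    by apply: ge0_ler_powR; rewrite ?nnegrE ?(ltW Q0) ?(ltW D0) ?(ltW r0).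
  - exists C => x r r0.
    have rdiam : (r%:E < diam [set: M])%E by rewrite E ltry.
    by have /andP[] := CP x r r0 rdiam.
  - by have := mdiam z1 z2; rewrite E.
pose C2 := C * 8 `^ Q.
have C20 : 0 < C2 by rewrite mulr_gt0 ?powR_gt0.
exists (1 + `|C1| + C2); split; first by rewrite -addrA lerDl addr_ge0// ltW.
move=> x r r0; split.
  apply: le_trans (C1P x r r0) _; rewrite lee_fin; apply: ler_wpM2r; first exact: powR_ge0.
  by rewrite (le_trans (ler_norm _))// addrAC lerDr addr_ge0// ltW.
move=> [y [z ryz]].
apply: (@le_trans _ _ (C2^-1 * r `^ Q)%:E).
  rewrite lee_fin; apply: ler_wpM2r; first exact: powR_ge0.
  by rewrite lef_pV2 ?posrE ?ltr_wpDl ?addr_ge0// lerDr addr_ge0.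
have r1 : 0 < r / 8 by rewrite divr_gt0.
have := CP x (r / 8) r1 => /(_ _)/andP[|+ _].
  apply: lt_le_trans (mdiam y z); rewrite lte_fin.
  by rewrite ltr_pdivrMr//; nra.
have -> : C^-1 * (r / 8) `^ Q = C2^-1 * r `^ Q.
  by rewrite (powR_div _ (ltW r0))// powRN /C2 invfM; ring.
move=> h.
apply: le_trans h _; apply: le_mu; apply: le_ball.
by rewrite ler_pdivrMr// ler_peMr ?(ltW r0)// ler1n.
Qed.

Lemma int_dist_le1 (a b : int) : a <= b -> b <= a + 1 -> `|a - b| <= 1.
Proof. by lia. Qed.

Lemma normc_distC {R : rcfType} (x y : R[i]) :
  Normc.normc (x - y) = Normc.normc (y - x).
Proof. by case: x y => a b [c d] /=; congr Num.sqrt; ring. Qed.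

Section filling.
Context {R : realType} {M : pmetricType R} (X : @hyperbolic_filling R M).

Definition vertices : set (int * M) := [set v | net X v.1 v.2].

Lemma vballE (v : int * M) : vball v = ball v.2 (rad v.1).
Proof. by rewrite /vball radE. Qed.

Lemma in_vball (v : int * M) y : vball v y <-> mdist v.2 y < rad v.1.
Proof. by rewrite vballE; exact: in_ball. Qed.

Lemma vball_center (v : int * M) : vball v v.2.
Proof. by apply/in_vball; rewrite mdistxx rad_gt0. Qed.

Lemma net_separated n (x y : M) : net X n x -> net X n y -> x <> y ->
  rad n / 2 <= mdist x y.
Proof.
have [+ _] := net_maximal X n => h nx ny xy; apply: le_trans (h x y nx ny xy).
rewrite (_ : - n - 1 = - (n + 1)); last by ring.
by rewrite radE (rad_add n 1) expr1 mulrAC mulfV ?mul1r.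
Qed.

Lemma net_dense n (z : M) : exists2 x, net X n x & mdist z x < rad n / 2.
Proof.
apply: contrapT => h.
have far x : net X n x -> rad n / 2 <= mdist z x.
  by move=> nx; rewrite leNgt; apply/negP => zx; apply: h; exists x.
have r2 : (2 : R) ^ (- n - 1) = rad n / 2.
  rewrite (_ : - n - 1 = - (n + 1)); last by ring.
  by rewrite radE (rad_add n 1) expr1 mulrAC mulfV ?mul1r.
have [sep maxi] := net_maximal X n.
have nz : ~ net X n z.
  by move=> nz; have := far z nz; rewrite mdistxx leNgt divr_gt0// rad_gt0.
have E := maxi (net X n `|` [set z]) _ _; apply: nz; rewrite -E; [by right| |by left].
move=> x y [nx|->] [ny|->] xy.
- exact: sep.
- by rewrite r2 metric_sym far.
- by rewrite r2 far.
- by [].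
Qed.

(** Only edges of level [v.1] are counted: an edge between two levels belongs to its lower endpoint
    alone, an edge inside a level to both endpoints. *)
Definition osc (u : int * M -> R[i]) (v : int * M) : \bar R :=
  ereal_sup (0%E |` [set (Normc.normc (graph_diff u e))%:E |
    e in [set e | edges X e /\ elevel e = v.1 /\ (e.1 = v \/ e.2 = v)]]).

Lemma osc_ge0 u v : (0 <= osc u v)%E.
Proof. by apply: ereal_sup_ubound; left. Qed.

Lemma edge_le_osc u v e : edges X e -> elevel e = v.1 -> e.1 = v \/ e.2 = v ->
  ((Normc.normc (graph_diff u e))%:E <= osc u v)%E.
Proof. by move=> Xe le ev; apply: ereal_sup_ubound; right; exists e. Qed.

Lemma osc_le u v c : (0 <= c)%E ->
  (forall e, edges X e -> elevel e = v.1 -> e.1 = v \/ e.2 = v ->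
     ((Normc.normc (graph_diff u e))%:E <= c)%E) ->
  (osc u v <= c)%E.
Proof. by move=> c0 h; apply: ge_ereal_sup => _ [->//|[e [Xe [le ev]] <-]]; exact: h. Qed.

(** Two distinct vertices of this kind are joined by an edge in exactly one of the two orientations,
    and its level is [v.1] in either case. *)
Lemma adjacent_le_osc u (v w : int * M) : vertices v -> vertices w ->
  v.1 <= w.1 <= v.1 + 1 -> vball v `&` vball w !=set0 ->
  ((Normc.normc (u w - u v))%:E <= osc u v)%E.
Proof.
move=> vv vw /andP[vw1 vw2] vw0.
have [->|/eqP nvw] := eqVneq w v; first by rewrite subrr Normc.normc0 osc_ge0.
have adj : vertex_adjacent (net X) v w.
  split => //; first exact/nesym.
  exact: int_dist_le1.
have [e1|/(edges_oriented adj).2 e2] := pselect (edges X (w, v)); last first.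
  by apply: (edge_le_osc u e2); [rewrite /elevel /= ; apply/min_idPl | left].
rewrite (_ : Normc.normc _ = Normc.normc (graph_diff u (w, v))); last first.
  exact: normc_distC.
apply: (edge_le_osc u e1); last by right.
by have /= := edges_upward e1; rewrite /elevel /= => wv; apply/min_idPr.
Qed.

End filling.

Section sparse_sums.
Context {R : realType}.
Local Open Scope ereal_scope.

Lemma esum_le_single (I : choiceType) (S : set I) (a : I -> \bar R) c :
  0 <= c -> (forall i, S i -> 0 <= a i <= c) ->
  (forall i j, S i -> S j -> a i != 0 -> a j != 0 -> i = j) ->
  \esum_(i in S) a i <= c.
Proof.
move=> c0 ac uniq_a.
have [[i Si ai]|h] := pselect (exists2 i, S i & a i != 0); last first.
  rewrite esum1// => i Si; apply: contrapT => /eqP ai; apply: h.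
  by exists i.
apply: (@le_trans _ _ (\esum_(j in [set i]) a j)); last first.
  by rewrite esum_set1; have /andP[] := ac i Si.
rewrite esum_mkcond [leRHS]esum_mkcond; apply: le_esum => j _.
have [/set_mem Sj|_] := boolP (j \in S); last first.
  by case: ifPn => // /set_mem ->; have /andP[] := ac i Si.
have [->|aj] := eqVneq (a j) 0; first by case: ifP.
by rewrite (uniq_a j i)// mem_set.
Qed.

Lemma esum_le_count (I : choiceType) (S : set I) (a : I -> \bar R) (c : \bar R)
    (N : R) :
  0 <= c -> \esum_(i in S) 1 <= N%:E -> (forall i, S i -> 0 <= a i <= c) ->
  \esum_(i in S) a i <= N%:E * c.
Proof.
move=> c0 SN ac.
apply: (@le_trans _ _ (\esum_(i in S) (c * 1))).
  by apply: le_esum => i /ac/andP[_]; rewrite mule1.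
by rewrite esumZl// muleC; apply: lee_wpmul2r.
Qed.

End sparse_sums.

Section packing.
Context {R : realType} {M : pmetricType R} (mu : {outer_measure set M -> \bar R}).
Context (X : @hyperbolic_filling R M) (Q C : R).
Hypothesis (Q0 : 0 < Q) (mm : metric_measure_space mu) (rb : regular_bounds mu Q C).

Let C1 : 1 <= C. Proof. exact: rb.1. Qed.
Let C0 : 0 < C. Proof. by apply: lt_le_trans rb.1. Qed.

Definition packing_const : R := locked (C ^+ 2 * 8 `^ Q).

Lemma packing_const_ge1 : 1 <= packing_const.
Proof.
rewrite /packing_const -lock -[leLHS]mulr1 ler_pM// ?exprn_ege1//.
by rewrite -[leLHS](powRr0 8) ler_powR ?ler1n// ltW.
Qed.

Lemma packing_const_gt0 : 0 < packing_const.
Proof. exact: lt_le_trans packing_const_ge1. Qed.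

(** The balls of radius rad n / 4 about net points are disjoint, of measure at least (rad n / 4)^Q /
    C, and lie in the ball of radius 2 r about z, of measure at most C (2 r)^Q; the quotient gives
    C^2 8^Q. At an inessential level all points are closer than the net separation, so there is at
    most one net point. *)
Lemma vertices_packing (n : int) (z : M) (r : R) : rad n <= r ->
  (\esum_(v in vertices X `&` [set v | v.1 = n /\ (mdist z v.2 < r)%R]) 1 <=
    (packing_const * (r / rad n) `^ Q)%:E)%E.
Proof.
move=> nr; have rn0 := @rad_gt0 R n; have r0 : 0 < r by exact: lt_le_trans nr.
set S := vertices X `&` _.
have sep v w : S v -> S w -> v <> w -> rad n / 2 <= mdist v.2 w.2.
  case: v w => [k x] [l y] [/= vv [vn _]] [/= vw [wn _]] vw'; subst k l.
  by apply: (net_separated (X := X)) => // xy; apply: vw'; rewrite xy.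
have [ess|iness] := pselect (essential M (rad n)); last first.
  apply: (@le_trans _ _ 1%E).
    apply: esum_le_single => //; first by move=> i _; rewrite lee01 lexx.
    move=> v w Sv Sw _ _; apply: contrapT => /(sep v w Sv Sw).
    apply/negP; rewrite -ltNge; apply: lt_le_trans (inessential_mdist _ _ iness) _.
    by rewrite ler_pM2l// lef_pV2 ?posrE// ler_nat.
  rewrite lee_fin -[leLHS]mulr1 ler_pM// ?packing_const_ge1//.
  rewrite -[leLHS](powRr0 (r / rad n)) ler_powR ?(ltW Q0)//.
  by rewrite ler_pdivlMr// mul1r.
pose a := C^-1 * (rad n / 4) `^ Q.
have rn4 : 0 < rad n / 4 :> R by rewrite divr_gt0.
have a0 : 0 < a by rewrite mulr_gt0 ?invr_gt0 ?powR_gt0.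
have ess4 : essential M (rad n / 4).
  by apply: essential_le ess; rewrite ler_pdivrMr// ler_peMr ?(ltW rn0)// ler1n.
apply: (@le_trans _ _ (a^-1%:E * \esum_(v in S) mu (ball v.2 (rad n / 4)))%E).
  rewrite -esumZl ?lee_fin ?invr_ge0 ?(ltW a0)//.
  apply: le_esum => v _; apply: (@le_trans _ _ (a^-1%:E * a%:E)%E); first by rewrite -EFinM mulVf ?lt0r_neq0.
  apply: lee_wpmul2l; first by rewrite lee_fin invr_ge0 ltW.
  exact: (rb.2 v.2 (rad n / 4) rn4).2.
apply: (@le_trans _ _ (a^-1%:E * (C * (2 * r) `^ Q)%:E)%E).
  apply: lee_wpmul2l; first by rewrite lee_fin invr_ge0 ltW.
  apply: (@le_trans _ _ (mu (ball z (2 * r)))); last first.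
    by apply: (rb.2 z (2 * r) _).1; rewrite mulr_gt0.
  apply: (@esum_measure_le _ _ _ (cara mu)).
  - exact: measurable_ball_cara.
  - by move=> *; exact: measurable_ball_cara.
  - move=> v [_ [_ zv]] y /in_ball vy; apply/in_ball.
    apply: le_lt_trans (metric_triangle z v.2 y) _.
    by rewrite mulr_natl mulr2n ltrD// (lt_le_trans vy)// (le_trans _ nr)// ler_pdivrMr// ler_peMr ?(ltW rn0)// ler1n.
  - apply/trivIsetP => v w Sv Sw /eqP vw; rewrite -subset0 => y [/in_ball vy /in_ball wy].
    have := sep v w Sv Sw vw; apply/negP; rewrite -ltNge.
    apply: le_lt_trans (metric_triangle v.2 y w.2) _.
    by rewrite (metric_sym y); lra.
rewrite -EFinM lee_fin /a /packing_const -lock.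
rewrite !powR_div ?(ltW r0) ?(ltW rn0)// (powRM _ _ (ltW r0))//.
rewrite !powRN (_ : (8 : R) = 4 * 2); last by ring.
rewrite powRM// le_eqVlt; apply/orP; left; apply/eqP; field.
by rewrite !gt_eqF// powR_gt0.
Qed.

Lemma countable_vertices : countable (vertices X).
Proof.
rewrite (_ : vertices X = \bigcup_(k in [set: int]) \bigcup_(j in [set: nat])
   (vertices X `&` [set v | v.1 = k /\ mdist point v.2 < rad k + j%:R])); last first.
  apply/seteqP; split => [v Vv|v [k _ [j _ []]]//].
  exists v.1 => //; exists (Num.truncn (mdist point v.2)).+1 => //; split=> //=; split => //.
  by apply: lt_le_trans (truncnS_gt _) _; rewrite lerDr rad_ge0.
do 2 (apply: bigcup_countable => // ? _); apply: finite_set_countable.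
apply: finite_esum1; apply: le_lt_trans (vertices_packing _ _) (ltry _).
by rewrite lerDl.
Qed.

(** The vertex of least index in an enumeration is selected among those close enough to t. The
    selection has countably many values, and its fibres are Boolean combinations of preimages of
    balls, so its composition with any [g] is measurable. *)
Lemma measurable_selection d (T : measurableType d) (io : T -> M) :
  (forall x r, measurable (io @^-1` ball x r)) ->
  exists sel : int -> T -> M,
    [/\ forall n t, vertices X (n, sel n t),
        forall n t, mdist (io t) (sel n t) < rad n / 2 &
        forall n (g : M -> R), measurable_fun [set: T] (fun t => g (sel n t))].
Proof.
move=> mio.
have [f finj] := countable_injP _ countable_vertices.
pose e k := xget (0, point) [set v | vertices X v /\ f v = k].
have eK v : vertices X v -> e (f v) = v.
  move=> Vv; have [] := @xgetPex _ (0, point) [set w | vertices X w /\ f w = f v]; first by exists v.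
  by move=> Vw /finj; rewrite !inE; apply.
pose P n t k := `[< vertices X (e k) /\ (e k).1 = n /\ mdist (io t) (e k).2 < rad n / 2 >].
have exP n t : exists k, P n t k.
  have [x nx xt] := net_dense X n (io t); exists (f (n, x)).
  by apply/asboolP; rewrite eK.
exists (fun n t => (e (ex_minn (exP n t))).2); split.
- move=> n t; case: ex_minnP => k /asboolP[+ [+ _]] _.
  by case: (e k) => l x /= Vx <-.
- by move=> n t; case: ex_minnP => k /asboolP[_ [_ ?]] _.
- move=> n g _ B mB; rewrite setTI.
  have mP k : measurable [set t | P n t k].
    have [h|h] := pselect (vertices X (e k) /\ (e k).1 = n); last first.
      rewrite (_ : [set _ | _] = set0)//; apply/seteqP; split=> // t /asboolP[? [? _]].
      by apply: h.
    rewrite (_ : [set _ | _] = io @^-1` ball (e k).2 (rad n / 2))//.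
    apply/seteqP; split => t /=.
      by move=> /asboolP[_ [_ ?]]; apply/in_ball; rewrite metric_sym.
    by move=> /in_ball ht; apply/asboolP; rewrite metric_sym; case: h.
  rewrite (_ : _ @^-1` _ = \bigcup_(k in [set k | B (g (e k).2)])
      ([set t | P n t k] `\` \bigcup_(j in `I_k) [set t | P n t j])).
    apply: bigcup_measurable => k _; apply: measurableD => //.
    by apply: bigcup_measurable.
  apply/seteqP; split => t /=.
    case: ex_minnP => k Pk mink Bk; exists k => //; split => // -[j /= jk Pj].
    by have := mink j Pj; rewrite leqNgt jk.
  move=> [k Bk [Pk nPj]]; case: ex_minnP => l Pl minl.
  have lk := minl k Pk; have [->//|lk'] := eqVneq l k.
  by exfalso; apply: nPj; exists l => //=; rewrite ltn_neqAle lk'.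
Qed.

End packing.

(** * Averages and Lebesgue differentiation *)

Section averages.
Context {R : realType} {M : pmetricType R} (mu : {outer_measure set M -> \bar R}).
Hypothesis mm : metric_measure_space mu.
Let T := caratheodory_type mu.

Definition ravg (B : set M) (g : M -> R) : R :=
  (fine (mu B))^-1 * \int[cara mu]_(y in B) g y.

Lemma averageE B (f : M -> R[i]) : average mu B f =
  Complex (ravg B (fun y => complex.Re (f y))) (ravg B (fun y => complex.Im (f y))).
Proof. by []. Qed.

Definition locint (g : M -> R) : Prop :=
  measurable_fun [set: T] (g : T -> R) /\
  forall x r, (cara mu).-integrable (ball x r) (fun y => (g y)%:E).

Lemma L1loc_locint (f : M -> R[i]) : L1loc mu f ->
  locint (fun y => complex.Re (f y)) /\ locint (fun y => complex.Im (f y)).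
Proof.
move=> [mre mim fi].
have B0 (x : M) (r : R) : ~ 0 < r -> ball x r = set0.
  move=> r0; apply/seteqP; split => // y /in_ball xy; apply: r0.
  by apply: le_lt_trans xy; exact: mdist_ge0.
split; split => // x r; have [/(fi x)[//]|/B0->] := pselect (0 < r);
  exact: integrable_set0.
Qed.

Lemma locint_L1loc (f : M -> R[i]) : locint (fun y => complex.Re (f y)) ->
  locint (fun y => complex.Im (f y)) -> L1loc mu f.
Proof. by move=> [? ire] [? iim]; split. Qed.

Lemma locint_lin (a b : R) g h : locint g -> locint h ->
  locint (fun y => a * g y + b * h y).
Proof.
move=> [mg ig] [mh ih]; split.
  by apply: measurable_funD; apply: measurable_funM => //; exact: measurable_cst.
move=> x r; under eq_fun do rewrite EFinD !EFinM.
apply: integrableD; first exact: measurable_ball_cara.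
  by apply: integrableZl => //; exact: measurable_ball_cara.
by apply: integrableZl => //; exact: measurable_ball_cara.
Qed.

Lemma locint_cst (c : R) : locint (fun=> c).
Proof.
split; first exact: measurable_cst.
move=> x r; have mB := measurable_ball_cara mm x r.
apply: (measurable_bounded_integrable mB (f := fun=> c)).
- exact: ball_measure_fin.
- exact: measurable_cst.
- exists `|c|; split; first exact: num_real.
  by move=> K cK y _ /=; exact: ltW.
Qed.

Lemma locint_ext g h : (forall y, g y = h y) -> locint g -> locint h.
Proof. by move=> gh; rewrite (_ : g = h)//; apply/funext. Qed.

Lemma locint_subc g c : locint g -> locint (fun y => g y - c).
Proof.
move=> gi; apply: locint_ext (locint_lin 1 (-1) gi (locint_cst c)) => y.
by rewrite mul1r mulN1r.
Qed.

Lemma ravg_lin x r a b g h : locint g -> locint h ->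
  ravg (ball x r) (fun y => a * g y + b * h y) =
  a * ravg (ball x r) g + b * ravg (ball x r) h.
Proof.
move=> [mg ig] [mh ih]; have mB := measurable_ball_cara mm x r.
rewrite /ravg RintegralD//; last 2 first.
- exact: (integrableZl mB a (ig x r)).
- exact: (integrableZl mB b (ih x r)).
by rewrite !RintegralZl//; ring.
Qed.

Lemma ravg_cst x r c : 0 < r -> ravg (ball x r) (fun=> c) = c.
Proof.
move=> r0; rewrite /ravg Rintegral_cst; last exact: measurable_ball_cara.
by rewrite mulrCA mulVf ?mulr1// gt_eqF// fine_ball_gt0.
Qed.

Lemma ravg_ae x r g h : locint g -> locint h ->
  {ae cara mu, forall y, g y = h y} -> ravg (ball x r) g = ravg (ball x r) h.
Proof.
move=> [mg _] [mh _] gh; rewrite /ravg /Rintegral; congr (_ * fine _).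
apply: ae_eq_integral.
- exact: measurable_ball_cara.
- by apply/measurable_EFinP; exact: measurable_funS mg.
- by apply/measurable_EFinP; exact: measurable_funS mh.
- move: gh => [N [mN N0 gN]]; exists N; split=> // y /= neq; apply: gN => /= gy.
  by apply: neq => _; rewrite gy.
Qed.

Lemma dist_ravg_le x r g c : 0 < r -> locint g ->
  ((`|ravg (ball x r) g - c|)%:E <= (fine (mu (ball x r)))^-1%:E *
    \int[cara mu]_y (`|g y - c| * \1_(ball x r) y)%:E)%E.
Proof.
move=> r0 gi; have mB := measurable_ball_cara mm x r.
have gci := locint_subc c gi.
have -> : ravg (ball x r) g - c = ravg (ball x r) (fun y => g y - c).
  rewrite -[X in _ - X](ravg_cst x c r0).
  rewrite (_ : (fun y => g y - c) = fun y => 1 * g y + -1 * c).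
    by rewrite (ravg_lin x r 1 (-1) gi (locint_cst c)) mul1r mulN1r.
  by apply/funext => y; rewrite mul1r mulN1r.
rewrite /ravg normrM EFinM ger0_norm ?invr_ge0 ?fine_ge0 ?outer_measure_ge0//.
apply: lee_wpmul2l; first by rewrite lee_fin invr_ge0 fine_ge0 ?outer_measure_ge0.
have fint := integrable_fin_num mB (gci.2 x r).
rewrite /Rintegral -abse_EFin fineK//.
apply: le_trans (le_abse_integral (cara mu) mB _) _.
  by apply/measurable_EFinP; exact: measurable_funS gci.1.
rewrite integral_mulr_indic//.
Qed.

End averages.

Section distance_to_set.
Context {R : realType} {M : pmetricType R} (A : set M).
Hypothesis A0 : A !=set0.

Definition dist_to (x : M) : R := inf [set mdist x y | y in A].

Let lb0 x : lbound [set mdist x y | y in A] 0.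
Proof. by move=> _ [y _ <-]; exact: mdist_ge0. Qed.

Let im0 x : [set mdist x y | y in A] !=set0.
Proof. by case: A0 => y Ay; exists (mdist x y), y. Qed.

Lemma dist_to_ge0 x : 0 <= dist_to x.
Proof. exact: lb_le_inf. Qed.

Lemma dist_to_le x y : A y -> dist_to x <= mdist x y.
Proof. by move=> Ay; apply: ge_inf; [exists 0; exact: lb0 | exists y]. Qed.

Lemma dist_to_lt x r : dist_to x < r -> exists2 y, A y & mdist x y < r.
Proof. by move=> /(inf_lt (im0 x))[_ [y Ay <-] yr]; exists y. Qed.

Lemma dist_to_triangle x y : dist_to x <= dist_to y + mdist x y.
Proof.
rewrite -lerBlDr; apply: lb_le_inf => // _ [z Az <-]; rewrite lerBlDr addrC.
exact: le_trans (dist_to_le x Az) (metric_triangle x y z).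
Qed.

Lemma dist_to_lipschitz x y : `|dist_to x - dist_to y| <= mdist x y.
Proof.
rewrite ler_norml lerBlDl dist_to_triangle andbT lerNl opprB lerBlDl metric_sym.
exact: dist_to_triangle.
Qed.

Lemma dist_to_gt0 x : closed A -> ~ A x -> 0 < dist_to x.
Proof.
move=> cA nAx; rewrite lt_neqAle dist_to_ge0 andbT; apply/eqP => d0; apply: nAx.
apply: cA => B /nbhs_ballP[e /= e0 eB].
have [|y Ay xy] := @dist_to_lt x e; first by rewrite -d0.
by exists y; split => //; apply: eB; exact/in_ball.
Qed.

Lemma dist_to_eq0 x : A x -> dist_to x = 0.
Proof.
by move=> Ax; apply/eqP; rewrite eq_le dist_to_ge0 andbT -(mdistxx x) dist_to_le.
Qed.

End distance_to_set.

Lemma lipschitz_continuous {R : realType} {M : pmetricType R} (h : M -> R) (L : R) :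
  (forall x y, `|h x - h y| <= L * mdist x y) -> continuous h.
Proof.
move=> hL x; apply/(@cvgrPdist_lt _ R^o) => e e0.
have L0 : 0 < `|L| + 1 by rewrite ltr_wpDl.
near=> y; apply: le_lt_trans (hL x y) _.
apply: (@le_lt_trans _ _ ((`|L| + 1) * mdist x y)).
  by rewrite ler_wpM2r ?mdist_ge0// (le_trans (ler_norm _))// lerDl.
rewrite -ltr_pdivlMl// mulrC.
near: y; apply/nbhs_ballP; exists (e / (`|L| + 1)) => /=; first exact: divr_gt0.
by move=> y /in_ball.
Unshelve. all: by end_near. Qed.

Lemma indic_in {R : pzRingType} {T : Type} (A : set T) (x : T) :
  A x -> \1_A x = 1 :> R.
Proof. by move=> Ax; rewrite indicE mem_set. Qed.

Lemma indic_notin {R : pzRingType} {T : Type} (A : set T) (x : T) :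
  ~ A x -> \1_A x = 0 :> R.
Proof. by move=> Ax; rewrite indicE memNset. Qed.

(** * Convergence of dyadic averages in the mean *)

Section L1_differentiation.
Context {R : realType} {M : pmetricType R} (mu : {outer_measure set M -> \bar R}).
Context (X : @hyperbolic_filling R M) (Q C : R).
Hypothesis (Q0 : 0 < Q) (mm : metric_measure_space mu) (rb : regular_bounds mu Q C).
Let T := caratheodory_type mu.
Variable sel : int -> M -> M.
Hypothesis sel_vertex : forall n t, vertices X (n, sel n t).
Hypothesis sel_near : forall n t, mdist t (sel n t) < rad n / 2.
Hypothesis sel_meas : forall n (g : M -> R),
  measurable_fun [set: T] (fun t : T => g (sel n t)).

Let mball := measurable_ball_cara mm.

Definition Tavg (k : int) (g : M -> R) (t : M) : R :=
  ravg mu (ball (sel k t) (rad k)) g.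

Lemma measurable_Tavg k g : measurable_fun [set: T] (Tavg k g : T -> R).
Proof. exact: (sel_meas k (fun x => ravg mu (ball x (rad k)) g)). Qed.

Definition Iabs (B : set M) (h : M -> R) : \bar R :=
  \int[cara mu]_x (`|h x| * \1_B x)%:E.

Let nm (B : set M) (h : M -> R) x : (0 <= (`|h x| * \1_B x)%:E)%E.
Proof. by rewrite lee_fin mulr_ge0. Qed.

Let mnm B (h : M -> R) : measurable_fun [set: T] (h : T -> R) ->
  measurable (B : set T) ->
  measurable_fun [set: T] (fun x : T => (`|h x| * \1_B x)%:E).
Proof.
move=> mh mB; apply/measurable_EFinP; apply: measurable_funM => //.
exact: measurableT_comp.
Qed.

Lemma Iabs_ge0 B h : (0 <= Iabs B h)%E.
Proof. exact: integral_ge0. Qed.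

Lemma le_Iabs B B' g h : B `<=` B' -> (forall x, `|g x| <= `|h x|) ->
  (Iabs B g <= Iabs B' h)%E.
Proof.
move=> BB' gh; apply: le_integral_nonmeasurable => // x.
rewrite lee_fin; have [Bx|Bx] := pselect (B x).
  by rewrite !indic_in ?mulr1//; exact: BB'.
by rewrite [X in X <= _](_ : _ = 0) ?mulr_ge0// indic_notin ?mulr0.
Qed.

Lemma Iabs_cat z r (f g h : M -> R) :
  measurable_fun [set: T] (f : T -> R) -> measurable_fun [set: T] (g : T -> R) ->
  (forall x, `|h x| <= `|f x| + `|g x|) ->
  (Iabs (ball z r) h <= Iabs (ball z r) f + Iabs (ball z r) g)%E.
Proof.
move=> mf mg hfg; rewrite -ge0_integralD//; last 2 first.
- exact: mnm.
- exact: mnm.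
apply: le_integral_nonmeasurable => // x; rewrite -EFinD lee_fin -mulrDl.
by rewrite ler_wpM2r.
Qed.

Lemma IabsZ z r a g : measurable_fun [set: T] (g : T -> R) ->
  Iabs (ball z r) (fun x => a * g x) = (`|a|%:E * Iabs (ball z r) g)%E.
Proof.
move=> mg; rewrite -ge0_integralZl//; last exact: mnm.
by apply: eq_integral => x _; rewrite -EFinM mulrA normrM.
Qed.

Lemma Iabs_locint_lty z r g : locint mu g -> (Iabs (ball z r) g < +oo)%E.
Proof.
move=> gi; have /integrableP[_] := gi.2 z r.
by rewrite integral_mulr_indic.
Qed.

(** The value at x is at most the mean of |g| over the selected ball. Integrating in x cancels the
    volume of that ball, and the balls of one level overlap at most [packing_const] times. The bound
    is uniform in k >= 0, where radii are at most 1; this is what carries convergence from simple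
    functions to all others. *)
Lemma Tavg_bound z r g k : locint mu g -> 0 <= k ->
  (Iabs (ball z r) (Tavg k g) <=
   (packing_const Q C)%:E * Iabs (ball z (r + 2)) g)%E.
Proof.
move=> gi k0; have rk1 : rad k <= 1 :> R.
  by rewrite /rad -[leRHS](powRr0 2) ler_powR ?ler1n// oppr_le0 ler0z.
pose S := vertices X `&` [set v | v.1 = k /\ mdist z v.2 < r + 1].
have cS : countable S.
  apply: sub_countable (countable_vertices X Q0 mm rb).
  by apply: subset_card_le => v [].
pose a (v : int * M) := ((fine (mu (vball v)))^-1%:E * Iabs (vball v) g)%E.
have a0 v : (0 <= a v)%E.
  by rewrite mule_ge0 ?Iabs_ge0// lee_fin invr_ge0 fine_ge0.
have mv (v : int * M) : measurable (vball v : set T) by rewrite vballE.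
apply: (@le_trans _ _ (\int[cara mu]_x \esum_(v in S) (a v * (\1_(vball v) x)%:E))%E).
  apply: le_integral_nonmeasurable => // x.
  have [zx|zx] := pselect (ball z r x); last first.
    by rewrite indic_notin// mulr0 esum_ge0// => v _; rewrite mule_ge0// lee_fin.
  rewrite indic_in// mulr1; pose v := (k, sel k x).
  have xv : vball v x.
    apply/in_vball => /=; rewrite metric_sym (lt_trans (sel_near k x))//.
    by rewrite ltr_pdivrMr// ltr_pMr ?ltr1n// rad_gt0.
  have Sv : S v.
    split; first exact: sel_vertex.
    split => //=; have /in_ball zx' := zx.
    apply: le_lt_trans (metric_triangle z x _) _; rewrite ltrD//.
    apply: lt_le_trans (sel_near k x) _; rewrite ler_pdivrMr// mul1r.
    by rewrite (le_trans rk1)// ler1n.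
  apply: le_trans (ge_esum_term (i := v) _ Sv); last first.
    by move=> w _; rewrite mule_ge0// lee_fin.
  rewrite indic_in// mule1 /a vballE -[Tavg k g x]subr0.
  have := dist_ravg_le mm (sel k x) 0 (rad_gt0 k) gi.
  rewrite subr0 => /le_trans; apply; rewrite /Iabs le_eqVlt; apply/orP; left; apply/eqP.
  by congr (_ * _)%E; apply: eq_integral => y _; rewrite subr0.
rewrite (integral_esum (cara mu) cS); last 2 first.
- move=> v _; apply: emeasurable_funM; first exact: measurable_cst.
  exact/measurable_EFinP.
- by move=> v x _; rewrite mule_ge0// lee_fin.
apply: (@le_trans _ _ (\esum_(v in S) Iabs (vball v) g)%E).
  apply: le_esum => v _; rewrite integral_cst_indic// /a.
  rewrite [leLHS]muleAC -[leRHS]mul1e; apply: lee_wpmul2r; first exact: Iabs_ge0.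
  by rewrite vballE -[leRHS](fine_ball_mulV mm v.2 (rad_gt0 v.1)).
rewrite -integral_esum//; last by move=> v _; apply: mnm => //; exact: gi.1.
rewrite /Iabs -ge0_integralZl//; last 2 first.
- by apply: mnm => //; exact: gi.1.
- by rewrite lee_fin ltW// (packing_const_gt0 Q0 rb).
apply: le_integral_nonmeasurable => [x|x]; first by apply: esum_ge0 => v _.
have [[v Sv vx]|h] := pselect (exists2 v, S v & vball v x); last first.
  rewrite esum1 ?mule_ge0// ?lee_fin ?(ltW (packing_const_gt0 Q0 rb))// => v Sv.
  by rewrite indic_notin ?mulr0// => vx; apply: h; exists v.
have zx : ball z (r + 2) x.
  apply/in_ball; case: Sv => _ [v1 zv]; move/in_vball: vx => vx.
  apply: le_lt_trans (metric_triangle z v.2 x) _.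
  rewrite (_ : r + 2 = (r + 1) + 1); last by ring.
  by rewrite ltrD// (lt_le_trans vx)// v1.
rewrite (indic_in zx) mulr1.
pose S' := S `&` [set v | vball v x].
apply: (@le_trans _ _ (\esum_(v in S') `|g x|%:E)%E).
  rewrite esum_mkcond [leRHS]esum_mkcond; apply: le_esum => w _.
  have [/set_mem Sw|nSw] := boolP (w \in S); last by case: ifP.
  have [wx|wx] := pselect (vball w x).
    by rewrite mem_set// indic_in// mulr1.
  by rewrite indic_notin// mulr0; case: ifP => _; rewrite ?lee_fin.
apply: esum_le_count => //; last by move=> *; rewrite lexx andbT.
have := vertices_packing X Q0 mm rb x (lexx (rad k)).
rewrite divff ?gt_eqF ?rad_gt0// powR1 mulr1; apply: le_trans.
apply: subset_le_esum => // w [[Vw [wk _]] /in_vball wx]; split => //.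
by split => //; rewrite metric_sym -wk.
Qed.

Definition L1conv (g : M -> R) : Prop := forall z (r e : R), 0 < e ->
  exists K : nat, forall k : nat, (K <= k)%N ->
    (Iabs (ball z r) (fun x => (Tavg k%:Z g x - g x)%R) <= e%:E)%E.

Lemma Tavg_lin k a b g h x : locint mu g -> locint mu h ->
  Tavg k (fun y => a * g y + b * h y) x = a * Tavg k g x + b * Tavg k h x.
Proof. exact: ravg_lin. Qed.

Lemma L1conv_ext g h : (forall y, g y = h y) -> L1conv g -> L1conv h.
Proof. by move=> gh; rewrite (_ : g = h)//; apply/funext. Qed.

Lemma L1conv_lin a b g h : locint mu g -> locint mu h -> L1conv g -> L1conv h ->
  L1conv (fun y => a * g y + b * h y).
Proof.
move=> gi hi cg ch z r e e0.
have pos (c : R) : 0 < e / (2 * (`|c| + 1)) by rewrite divr_gt0// mulr_gt0// ltr_wpDl.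
have [K1 h1] := cg z r _ (pos a); have [K2 h2] := ch z r _ (pos b).
exists (maxn K1 K2) => k; rewrite geq_max => /andP[/h1 {}h1 /h2 {}h2].
have md (f : M -> R) : locint mu f ->
    measurable_fun [set: T] (fun x : T => Tavg k f x - f x).
  by move=> fi; apply: measurable_funB; [exact: measurable_Tavg | exact: fi.1].
apply: (@le_trans _ _ (Iabs (ball z r) (fun x => (a * (Tavg k g x - g x))%R) +
                       Iabs (ball z r) (fun x => (b * (Tavg k h x - h x))%R))%E).
  apply: Iabs_cat.
  - by apply: measurable_funM; [exact: measurable_cst | exact: md].
  - by apply: measurable_funM; [exact: measurable_cst | exact: md].
  - move=> x; rewrite Tavg_lin//; apply: le_trans (ler_normD _ _).
    by rewrite le_eqVlt; apply/orP; left; apply/eqP; congr `|_|; ring.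
rewrite !IabsZ//; [|exact: md..].
have aux (c : R) (I : \bar R) : (I <= (e / (2 * (`|c| + 1)))%:E)%E ->
    (`|c|%:E * I <= (e / 2)%:E)%E.
  move=> hI; apply: (@le_trans _ _ (`|c|%:E * (e / (2 * (`|c| + 1)))%:E)%E).
    by apply: lee_wpmul2l.
  rewrite -EFinM lee_fin invfM mulrCA ler_pM2l// mulrCA ler_piMr// ler_pdivrMr.
    by rewrite mul1r lerDl.
  by rewrite ltr_wpDl.
apply: le_trans (leeD (aux _ _ h1) (aux _ _ h2)) _.
by rewrite -EFinD -splitr.
Qed.

Lemma L1conv_approx g : locint mu g ->
  (forall z r (e : R), 0 < e -> exists h, [/\ locint mu h, L1conv h &
     (Iabs (ball z r) (fun x => (1 * g x + -1 * h x)%R) <= e%:E)%E]) ->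
  L1conv g.
Proof.
move=> gi ap z r e e0; set N := packing_const Q C.
have N0 : 0 < N by exact: (packing_const_gt0 Q0 rb).
(* With this delta the three terms of the splitting add up to N delta + e / 2 + delta = e. *)
have e1 : 0 < e / (2 * (N + 1)) by rewrite divr_gt0// mulr_gt0// addr_gt0.
have [h [hi ch gh]] := ap z (r + 2) _ e1.
have e2 : 0 < e / 2 by rewrite divr_gt0.
have [K hK] := ch z r _ e2; exists K => k /hK {}hK.
have ghi := locint_lin mm 1 (-1) gi hi.
have b1 := Tavg_bound z r (k := k%:Z) ghi isT.
apply: (@le_trans _ _ (Iabs (ball z r) (Tavg k (fun x => (1 * g x + -1 * h x)%R)) +
   (Iabs (ball z r) (fun x => (Tavg k h x - h x)%R) +
    Iabs (ball z r) (fun x => (1 * g x + -1 * h x)%R)))%E).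
  apply: (@le_trans _ _ (Iabs (ball z r) (Tavg k (fun x => (1 * g x + -1 * h x)%R)) +
    Iabs (ball z r) (fun x => (`|Tavg k h x - h x| + `|1 * g x + -1 * h x|)%R))%E).
    apply: Iabs_cat.
    - exact: measurable_Tavg.
    - apply: measurable_funD; apply: measurableT_comp => //; last exact: ghi.1.
      by apply: measurable_funB; [exact: measurable_Tavg | exact: hi.1].
    - move=> x; rewrite Tavg_lin// [X in _ <= _ + X]ger0_norm ?addr_ge0//.
      rewrite addrA; apply: le_trans (lerD (ler_normD _ _) (lexx _)).
      rewrite -(normrN (1 * g x + _)); apply: le_trans (ler_normD _ _).
      by rewrite le_eqVlt; apply/orP; left; apply/eqP; congr `|_|; ring.
  rewrite leeD2l//; apply: Iabs_cat; last by move=> x; rewrite ger0_norm ?addr_ge0.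
    by apply: measurable_funB; [exact: measurable_Tavg | exact: hi.1].
  exact: ghi.1.
have gh' : (Iabs (ball z r) (fun x => (1 * g x + -1 * h x)%R) <= (e / (2 * (N + 1)))%:E)%E.
  by apply: le_trans gh; apply: le_Iabs => //; apply: le_ball; rewrite lerDl.
apply: (@le_trans _ _ (N%:E * (e / (2 * (N + 1)))%:E + ((e / 2)%:E + (e / (2 * (N + 1)))%:E))%E).
  apply: leeD; last exact: leeD.
  by apply: le_trans b1 _; apply: lee_wpmul2l => //; rewrite lee_fin ltW.
rewrite -EFinM -!EFinD lee_fin le_eqVlt; apply/orP; left; apply/eqP; field.
by rewrite gt_eqF// addr_gt0.
Qed.

Lemma locint_dom g h : measurable_fun [set: T] (h : T -> R) -> locint mu g ->
  (forall x, `|h x| <= `|g x|) -> locint mu h.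
Proof.
move=> mh [mg gi] hg; split => // x r; apply: le_integrable (gi x r) => //; last by move=> y _; rewrite lee_fin hg.
by apply/measurable_EFinP; exact: measurable_funS mh.
Qed.

Lemma L1conv_limit (h : nat -> M -> R) g : locint mu g ->
  (forall n, measurable_fun [set: T] (h n : T -> R)) ->
  (forall n x, `|h n x| <= `|g x|) ->
  (forall x, h n x @[n --> \oo] --> g x) ->
  (forall n, L1conv (h n)) -> L1conv g.
Proof.
move=> gi mh hg hlim ch; apply: L1conv_approx => // z r e e0.
have mB := mball z r.
have mES (f : M -> R) : measurable_fun [set: T] (f : T -> R) ->
    measurable_fun (ball z r : set T) (fun x : T => (f x)%:E).
  by move=> mf; apply/measurable_EFinP; exact: measurable_funS mf.
have [] := @dominated_convergence _ _ _ (cara mu) (ball z r) mB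
  (fun n x => (h n x)%:E) (fun x => (g x)%:E) (fun x => `|(g x)%:E|%E).
- by move=> n; exact: mES.
- exact: mES gi.1.
- by apply: aeW => x _; apply/fine_cvgP; split; [exact: nearW | exact: hlim].
- exact: integrable_abse (gi.2 z r).
- by apply: aeW => x n _; rewrite lee_fin.
move=> _ + _ => /fine_cvgP[fin0 /cvgrPdist_le/(_ e e0) near_e].
have [n [fn en]] : exists n,
    (\int[cara mu]_(x in ball z r) `|(h n x)%:E - (g x)%:E|)%E \is a fin_num /\
    (fine (\int[cara mu]_(x in ball z r) `|(h n x)%:E - (g x)%:E|)%E <= e).
  have [n _ hn] := filterI fin0 near_e; exists n; have [/= ? +] := hn n (leqnn n).
  rewrite sub0r normrN ger0_norm// fine_ge0//; exact: integral_ge0.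
exists (h n); split => //; first exact: locint_dom (mh n) gi (hg n).
rewrite -lee_fin fineK// in en; apply: le_trans en.
rewrite integral_mulr_indic//; apply: le_integral_nonmeasurable => // x.
by rewrite -EFinM lee_fin distrC mul1r mulN1r.
Qed.

Lemma L1conv_lipschitz (h : M -> R) L : locint mu h ->
  (forall x y, `|h x - h y| <= L * mdist x y) -> L1conv h.
Proof.
move=> hi hL z r e e0.
have mh := hi.1.
pose c := `|L| * fine (mu (ball z r)) + 1.
have c0 : 0 < c by rewrite ltr_wpDl// mulr_ge0// fine_ge0.
have [j /andP[rj _]] := exists_rad (divr_gt0 e0 (mulr_gt0 (ltr0Sn R 1) c0)).
exists `|j|%N => k jk.
have jk' : (j <= k%:Z)%R by lia.
have Tx x : `|Tavg k h x - h x| <= `|L| * (2 * rad k%:Z).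
  rewrite -lee_fin /Tavg.
  apply: le_trans (dist_ravg_le mm (sel k x) (h x) (rad_gt0 k%:Z) hi) _.
  have m0 := fine_ball_gt0 mm (sel k%:Z x) (rad_gt0 k%:Z).
  apply: (@le_trans _ _ ((fine (mu (ball (sel k x) (rad k))))^-1%:E *
    ((`|L| * (2 * rad k%:Z))%:E * mu (ball (sel k x) (rad k))))%E); last first.
    by rewrite (ball_fineE mm) -!EFinM lee_fin mulrCA mulVf ?mulr1// gt_eqF.
  apply: lee_wpmul2l; first by rewrite lee_fin invr_ge0 ltW.
  rewrite -(@integral_cst_indic _ _ _ (cara mu))//; last first.
    by rewrite lee_fin !mulr_ge0// rad_ge0.
  apply: le_integral_nonmeasurable => y; first by rewrite lee_fin mulr_ge0.
  rewrite -EFinM lee_fin.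
  have [/in_ball yk|yk] := pselect (ball (sel k x) (rad k) y); last first.
    by rewrite indic_notin// !mulr0.
  rewrite ler_wpM2r//; apply: le_trans (hL _ _) _.
  apply: (@le_trans _ _ (`|L| * mdist y x)).
    by rewrite ler_wpM2r ?ler_norm ?mdist_ge0.
  rewrite ler_wpM2l//; apply: le_trans (metric_triangle y (sel k x) x) _.
  have := sel_near k%:Z x; have := @rad_gt0 R k%:Z.
  by move: yk; rewrite (metric_sym y) (metric_sym _ x); lra.
apply: (@le_trans _ _ ((`|L| * (2 * rad k%:Z))%:E * mu (ball z r))%E).
  rewrite -(@integral_cst_indic _ _ _ (cara mu))//; last first.
    by rewrite lee_fin !mulr_ge0// rad_ge0.
  apply: le_integral_nonmeasurable => y //.
  by rewrite -EFinM lee_fin ler_wpM2r.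
rewrite (ball_fineE mm) -EFinM lee_fin.
apply: (@le_trans _ _ (2 * c * rad j)).
  rewrite mulrAC mulrA [2 * c * _]mulrAC [2 * _ * c]mulrC -mulrA ler_pM//.
  - by rewrite mulr_ge0// fine_ge0.
  - by rewrite mulr_ge0// rad_ge0.
  - by rewrite lerDl.
  - by rewrite ler_pM2l// le_rad.
by rewrite mulrC -ler_pdivlMr// mulr_gt0.
Qed.

Lemma locint_indic (A : set M) : measurable (A : set T) -> locint mu \1_A.
Proof.
move=> mA; apply: locint_dom (locint_cst mm 1) _.
  exact: measurable_indic.
by move=> x; rewrite indicE normr1; case: (x \in A); rewrite ?normr1 ?normr0.
Qed.

(** The indicator is the increasing limit of the Lipschitz functions min(1, n d(x)), with d the
    distance to the complement. The whole space, whose complement is empty, is treated apart. *)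
Lemma L1conv_open (U : set M) : open U -> L1conv \1_U.
Proof.
move=> oU; have cU : closed (~` U) by exact: open_closedC.
have mU := open_caratheodory mm oU.
have [U0|U0] := pselect ((~` U) !=set0); last first.
  apply: (@L1conv_lipschitz _ 0); first exact: locint_indic.
  move=> x y; rewrite mul0r.
  have inU t : t \in U by rewrite inE; apply: contrapT => Ut; apply: U0; exists t.
  by rewrite !indicE !inU subrr normr0.
pose d := dist_to (~` U).
pose h n x : R := Num.min 1 (n%:R * d x).
have h0 n x : 0 <= h n x by rewrite le_min ler01 mulr_ge0// dist_to_ge0.
have hle n x : `|h n x| <= `|\1_U x : R|.
  rewrite ger0_norm// ger0_norm//.
  have [Ux|Ux] := pselect (U x); first by rewrite indic_in// ge_min lexx.
  by rewrite indic_notin// /h /d dist_to_eq0// mulr0 ge_min lexx orbT.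
have hlip n x y : `|h n x - h n y| <= n%:R * mdist x y.
  have H (x' y' : M) : h n x' - h n y' <= n%:R * mdist x' y'.
    rewrite lerBlDr /h; have [_|_] := leP 1 (n%:R * d y').
      by rewrite ge_min lerDr mulr_ge0// mdist_ge0.
    apply: (@le_trans _ _ (n%:R * d x')); first by rewrite ge_min lexx orbT.
    by rewrite -mulrDr ler_wpM2l// addrC dist_to_triangle.
  by rewrite ler_norml H andbT lerNl opprB metric_sym H.
have mh n : measurable_fun [set: T] (h n : T -> R).
  by apply: measurable_continuous => //; exact: (lipschitz_continuous (hlip n)).
have Ui := locint_indic mU.
apply: (L1conv_limit Ui mh hle) => [x|n]; last first.
  by apply: L1conv_lipschitz (hlip n); exact: locint_dom (mh n) Ui (hle n).
have [Ux|Ux] := pselect (U x); last first.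
  rewrite indic_notin// (_ : (fun n => h n x) = fun=> 0); first exact: cvg_cst.
  apply/funext => n; rewrite /h /d dist_to_eq0// mulr0.
  by apply/min_idPr.
rewrite indic_in//; apply: cvg_near_cst.
have d0 : 0 < d x by apply: dist_to_gt0 => //; apply.
exists (Num.truncn (d x)^-1).+1 => // n /= hn; apply/min_idPl.
by rewrite -ler_pdivrMr// div1r ltW// (lt_le_trans (truncnS_gt _))// ler_nat.
Qed.

(** Open sets are stable under intersection, and the measurable sets with this convergence form a
    lambda-system: differences by linearity, increasing unions by dominated convergence. *)
Lemma L1conv_borel (A : set M) : <<s @open M >> A -> L1conv \1_A.
Proof.
pose D := [set B : set M | measurable (B : set T) /\ L1conv \1_B].
suff : <<s @open M >> `<=` D by move=> /[apply] -[].
apply: lambda_system_subset => //.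
- by move=> U V oU oV; exact: openI.
- split => //.
  + split; first exact: measurableT.
    by apply: L1conv_open; exact: openT.
  + move=> B B' B'B [mB cB] [mB' cB']; split; first exact: measurableD.
    apply: L1conv_ext (L1conv_lin 1 (-1) (locint_indic mB) (locint_indic mB') cB cB') => y.
    rewrite mul1r mulN1r; have [B'y|B'y] := pselect (B' y).
      rewrite (indic_in B'y) (indic_in (B'B _ B'y)) subrr indic_notin//.
      by move=> [_].
    rewrite (indic_notin B'y) subr0; have [By|By] := pselect (B y).
      by rewrite !indic_in.
    by rewrite !indic_notin// => -[].
  + move=> G ndG DG; have mG : measurable (\bigcup_n G n : set T).
      by apply: bigcup_measurable => n _; exact: (DG n).1.
    split => //; apply: (L1conv_limit (h := fun n => \1_(G n)) (locint_indic mG)).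
    * by move=> n; apply: measurable_indic; exact: (DG n).1.
    * move=> n x; have [Gx|Gx] := pselect (G n x); last first.
        by rewrite indic_notin// normr0.
      by rewrite !indic_in//; exists n.
    * move=> x; have [[n _ Gnx]|Gx] := pselect ((\bigcup_n G n) x).
        rewrite indic_in; last by exists n.
        apply: cvg_near_cst; exists n => // m /= n_m; rewrite indic_in//.
        by have /subsetPset := ndG _ _ n_m; apply.
      rewrite indic_notin// (_ : (fun n => \1_(G n) x) = fun=> 0); first exact: cvg_cst.
      by apply/funext => n; rewrite indic_notin// => Gnx; apply: Gx; exists n.
    * by move=> n; exact: (DG n).2.
- by move=> U oU; split; [exact: open_caratheodory | exact: L1conv_open].
Qed.

(** Borel regularity gives a Borel set B of the same measure containing the part of A in the ball.
    That measure is finite, so the excess of B is a null set and the indicators of A and B agree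
    almost everywhere in the ball. *)
Lemma L1conv_indic (A : set M) : measurable (A : set T) -> L1conv \1_A.
Proof.
move=> mA; apply: L1conv_approx; first exact: locint_indic.
move=> z r e e0; have mB := mball z r.
have [B bB [AB BE]] := mm.1.2 (A `&` ball z r).
have mBo : measurable (B : set T) by exact: mm.1.1.
have mAB : measurable (A `&` ball z r : set T) by exact: measurableI.
exists \1_B; split; [exact: locint_indic | exact: L1conv_borel |].
apply: (@le_trans _ _ 0%E); last by rewrite lee_fin ltW.
apply: (@le_trans _ _ (cara mu (B `\` (A `&` ball z r)))).
  rewrite -[leRHS]mul1e -(@integral_cst_indic _ _ _ (cara mu))//; last exact: measurableD.
  apply: le_integral_nonmeasurable => // x; rewrite mul1e lee_fin.
  rewrite mul1r mulN1r.
  have [zx|zx] := pselect (ball z r x); last by rewrite (indic_notin zx) mulr0.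
  rewrite (indic_in zx) mulr1; have [Bx|Bx] := pselect (B x); last first.
    by rewrite (indic_notin Bx) indic_notin ?subrr ?normr0// => Ax; apply: Bx; apply: AB.
  rewrite (indic_in Bx); have [Ax|Ax] := pselect (A x).
    by rewrite (indic_in Ax) subrr normr0.
  rewrite (indic_notin Ax) sub0r normrN normr1 indic_in//.
  by split => // -[].
rewrite measureD//; last first.
  rewrite [ltLHS]BE; apply: le_lt_trans (ball_measure_fin mm z r).
  by apply: le_mu => x [].
rewrite [X in (_ - X)%E](_ : _ = cara mu B); last first.
  by rewrite [RHS]BE; congr (mu _); apply/setIidr.
rewrite subee// ge0_fin_numE//.
rewrite [ltLHS]BE; apply: le_lt_trans (ball_measure_fin mm z r).
by apply: le_mu => x [].
Qed.

Lemma L1conv_step (s : seq R) (B : R -> set M) :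
  (forall y, measurable (B y : set T)) ->
  locint mu (fun x => \sum_(y <- s) y * \1_(B y) x) /\
  L1conv (fun x => \sum_(y <- s) y * \1_(B y) x).
Proof.
move=> mB; elim: s => [|y s [IHi IHc]].
  have E : (fun=> 0) = (fun x : M => \sum_(y <- [::]) y * \1_(B y) x).
    by apply/funext => x; rewrite big_nil.
  rewrite -E; split; first exact: locint_cst.
  apply: (@L1conv_lipschitz _ 0); first exact: locint_cst.
  by move=> x y; rewrite subrr normr0 mul0r.
have E : (fun x => y * \1_(B y) x + 1 * \sum_(y <- s) y * \1_(B y) x) =
    (fun x : M => \sum_(y <- y :: s) y * \1_(B y) x).
  by apply/funext => x; rewrite big_cons mul1r.
rewrite -E; split.
  by apply: locint_lin => //; exact: locint_indic.
by apply: L1conv_lin => //; [exact: locint_indic | exact: L1conv_indic].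
Qed.

Import HBNNSimple.

Lemma L1conv_ge0 g : (forall x, 0 <= g x) -> locint mu g -> L1conv g.
Proof.
move=> g0 gi.
have mg : measurable_fun [set: T] (fun x : T => (g x)%:E).
  by apply/measurable_EFinP; exact: gi.1.
have g0' (x : T) : [set: T] x -> (0 <= (g x)%:E)%E by move=> _; rewrite lee_fin.
pose h n := nnsfun_approx measurableT mg n.
have hg n (x : T) : h n x <= g x.
  by rewrite -lee_fin /h nnsfun_approxE; exact: le_approx.
apply: (L1conv_limit (h := fun n (x : M) => h n (x : T))) => //.
- by move=> n x; rewrite !ger0_norm.
- by move=> x; have /fine_cvgP[] := cvg_nnsfun_approx measurableT mg g0' (x := x) I.
- move=> n; apply: (@L1conv_ext (fun x => \sum_(y <- finmap.enum_fset (fset_set (range (h n))))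
      y * \1_(h n @^-1` [set y]) x)).
    by move=> y; rewrite [in RHS]fimfunE fsbig_finite.
  by apply: (L1conv_step _ _).2.
Qed.

Theorem L1_differentiation g : locint mu g -> L1conv g.
Proof.
move=> gi.
have ni : locint mu (fun x => `|g x|).
  have mn : measurable_fun [set: T] (fun x : T => `|g x|).
    by apply: measurableT_comp => //; exact: gi.1.
  by apply: (locint_dom mn gi) => x; rewrite normr_id.
have h (a : R) : `|a| <= 2^-1 -> let f := fun x => 2^-1 * `|g x| + a * g x in
    locint mu f /\ L1conv f.
  move=> a2 f; have fi : locint mu f by exact: locint_lin.
  split => //; apply: L1conv_ge0 => // x.
  have : - (a * g x) <= 2^-1 * `|g x|.
    by apply: le_trans (ler_norm _) _; rewrite normrN normrM ler_wpM2r.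
  by rewrite -subr_ge0 opprK.
have [|i1 c1] := h 2^-1; first by rewrite ger0_norm.
have [|i2 c2] := h (- 2^-1); first by rewrite normrN ger0_norm.
apply: L1conv_ext (L1conv_lin 1 (-1) i1 i2 c1 c2) => x.
by field.
Qed.

End L1_differentiation.

(** * Besov and Triebel-Lizorkin norms *)

Section power_monotonicity.
Context {R : realType}.
Local Open Scope ereal_scope.

Lemma le_poweR (x y : \bar R) (r : R) : (0 <= r)%R -> 0 <= x -> x <= y ->
  x `^ r <= y `^ r.
Proof.
move=> r0 x0 xy; apply: gt0_ler_poweR => //; rewrite in_itv/= leey andbT//.
exact: le_trans xy.
Qed.

Lemma poweRK (x : \bar R) (r : R) : (0 < r)%R -> 0 <= x -> (x `^ r^-1) `^ r = x.
Proof. by move=> r0 x0; rewrite -poweRrM mulVf ?gt_eqF// poweRe1. Qed.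

Lemma poweRVK (x : \bar R) (r : R) : (0 < r)%R -> 0 <= x -> (x `^ r) `^ r^-1 = x.
Proof. by move=> r0 x0; rewrite -poweRrM mulfV ?gt_eqF// poweRe1. Qed.

Lemma lq_norm_ge0 (I : choiceType) q (S : set I) (a : I -> \bar R) :
  0 <= lq_norm q S a.
Proof.
case: q => [r| |] /=; first exact: poweR_ge0.
- by apply: ereal_sup_ubound; left.
- by apply: ereal_sup_ubound; left.
Qed.

Lemma le_lq_norm_term (I : choiceType) (q : \bar R) (S : set I) (a : I -> \bar R) i :
  0 < q -> (forall j, S j -> 0 <= a j) -> S i -> a i <= lq_norm q S a.
Proof.
case: q => [r| |//] q0 a0 Si /=; last by apply: ereal_sup_ubound; right; exists i.
rewrite lte_fin in q0; rewrite -[leLHS](poweRVK q0 (a0 i Si)).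
apply: le_poweR; rewrite ?poweR_ge0 ?invr_ge0 ?(ltW q0)//.
by apply: (ge_esum_term (a := fun i => a i `^ r)) => // j _; exact: poweR_ge0.
Qed.

(** Levels above and below j are summed as two geometric series, the latter after changing the sign
    of the levels; for q = +oo the largest term suffices. The constant depends only on q, [ka] and
    [N], so it is uniform over the points at which the norm is taken. *)
Lemma lq_norm_decay (q : \bar R) (ka N : R) : 0 < q -> (0 < ka)%R -> (0 <= N)%R ->
  exists2 K : R, (0 < K)%R &
  forall (I : choiceType) (S : set I) (l : I -> int) (j : int) (a : I -> \bar R) (A : R),
    (0 <= A)%R ->
    (forall k, \esum_(i in S `&` [set i | l i = k]) 1 <= N%:E) ->
    (forall i, S i -> 0 <= a i <= (A * 2 `^ (- `|(l i - j)%:~R| * ka))%:E) ->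
    lq_norm q S a <= (K * A)%:E.
Proof.
case: q => [r| |//] q0 ka0 N0; last first.
  exists 1%R => // I S l j a A A0 _ aA; rewrite mul1r.
  apply: ge_ereal_sup => _ [->|[i Si <-]]; first by rewrite lee_fin.
  have /andP[_ h] := aA i Si; apply: le_trans h _.
  rewrite lee_fin ler_piMr// -[leRHS](powRr0 2) ler_powR ?ler1n//.
  by rewrite mulNr oppr_le0 mulr_ge0// ltW.
rewrite lte_fin in q0; have kar : (0 < ka * r)%R by rewrite mulr_gt0.
set G : R := ((1 - 2 `^ (- (ka * r - 0)))^-1)%R.
have G0 : (0 <= G)%R.
  rewrite invr_ge0 subr_ge0 -[leRHS](powRr0 2) ler_powR ?ler1n//.
  by rewrite subr0 oppr_le0 ltW.
exists ((1 + 2 * (N * G)) `^ r^-1)%R.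
  by rewrite powR_gt0// ltr_wpDr// !mulr_ge0.
move=> I S l j a A A0 cnt aA /=.
have half (S' : set I) (l' : I -> int) (j' : int) : S' `<=` S ->
    (forall i, S' i -> (j' <= l' i)%R /\ `|l i - j|%R = (l' i - j')%R) ->
    (forall k, \esum_(i in S' `&` [set i | l' i = k]) 1 <= N%:E) ->
    \esum_(i in S') a i `^ r <= (A `^ r * (N * G))%:E.
  move=> S'S l'l cnt'.
  apply: (@le_trans _ _ (\esum_(i in S') ((A `^ r)%:E * (2 `^ (- (l' i - j')%:~R * (ka * r)))%:E))).
    apply: le_esum => i S'i; have /andP[a0 ai] := aA i (S'S _ S'i).
    apply: le_trans (le_poweR (ltW q0) a0 ai) _.
    rewrite poweR_EFin -EFinM lee_fin powRM ?powR_ge0// -powRrM.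
    by rewrite -intr_norm (l'l i S'i).2 mulrA.
  rewrite esumZl ?lee_fin ?powR_ge0// [leRHS]EFinM; apply: lee_wpmul2l.
    by rewrite lee_fin powR_ge0.
  apply: esum_level_decay => // [i /l'l[]//|k _].
  by rewrite mulr0 powRr0 mulr1.
rewrite [leRHS](_ : _ = ((A `^ r * (1 + 2 * (N * G)))%:E) `^ r^-1); last first.
  rewrite poweR_EFin powRM ?powR_ge0//; last by rewrite addr_ge0// !mulr_ge0.
  by rewrite -powRrM mulfV ?gt_eqF// powRr1// mulrC.
apply: le_poweR; rewrite ?invr_ge0 ?(ltW q0)//.
  by apply: esum_ge0 => *; exact: poweR_ge0.
rewrite (esumID [set i | j <= l i]%R); last by move=> *; exact: poweR_ge0.
apply: (@le_trans _ _ ((A `^ r * (N * G))%:E + (A `^ r * (N * G))%:E)); last first.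
  rewrite -EFinD lee_fin -mulrDr ler_wpM2l ?powR_ge0// -mulr2n -[X in (X <= _)%R]mulr_natl.
  by rewrite lerDr.
apply: leeD.
- apply: (half _ l j) => [i []//|i [_ /= ji]|k].
    by rewrite ger0_norm ?subr_ge0.
  apply: le_trans (cnt k); apply: subset_le_esum => // i [[Si _] lik].
  by split.
- apply: (half _ (fun i => - l i)%R (- j)%R) => [i []//|i [_ /= /negP ji]|k].
    rewrite -ltNge in ji; split; first by rewrite lerN2 ltW.
    by rewrite distrC ger0_norm ?subr_ge0 ?(ltW ji)// opprK addrC.
  apply: le_trans (cnt (- k)%R); apply: subset_le_esum => // i [[Si _] /= lik].
  by split => //=; rewrite -lik opprK.
Qed.

End power_monotonicity.

Section function_space_norms.
Context {R : realType} {M : pmetricType R} (mu : {outer_measure set M -> \bar R}).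
Context (X : @hyperbolic_filling R M) (Q C : R).
Hypothesis (Q0 : 0 < Q) (mm : metric_measure_space mu) (rb : regular_bounds mu Q C).
Let T := caratheodory_type mu.
Local Open Scope ereal_scope.

Lemma besov_norm_poweR (s p : R) f : (0 < p)%R ->
  besov_norm mu X s p%:E p%:E f `^ p =
  \esum_(k in [set: int]) ((2 `^ (k%:~R * (s * p)))%:E *
    \int[cara mu]_x (\esum_(e in [set e | edges X e /\ elevel e = k])
      (edge_diff mu f e * \1_(eball e) x)%:E) `^ p).
Proof.
move=> p0; rewrite /besov_norm /lq_norm poweRK//; last first.
  by apply: esum_ge0 => k _; exact: poweR_ge0.
apply: eq_esum => k _; rewrite poweRM ?lee_fin ?powR_ge0 ?Lnorm_ge0//.
rewrite poweR_EFin -powRrM mulrA poweR_Lnorm ?gt_eqF//; congr (_ * _).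
apply: eq_integral => x _; rewrite gee0_abs//; apply: esum_ge0 => e _.
by rewrite lee_fin mulr_ge0// /edge_diff; case: graph_diff => a b /=; exact: sqrtr_ge0.
Qed.

Lemma triebel_lizorkin_norm_poweR (s p : R) q f : (0 < p)%R ->
  triebel_lizorkin_norm mu X s p q f `^ p =
  \int[cara mu]_x (lq_norm q (edges X) (fun e =>
    (2 `^ ((elevel e)%:~R * s) * edge_diff mu f e * \1_(eball e) x)%:E)) `^ p.
Proof.
move=> p0; rewrite /triebel_lizorkin_norm poweR_Lnorm ?gt_eqF//.
by apply: eq_integral => x _; rewrite gee0_abs// lq_norm_ge0.
Qed.

Lemma edge_diff_ge0 f e : (0 <= edge_diff mu f e)%R.
Proof. by rewrite /edge_diff; case: graph_diff => a b /=; exact: sqrtr_ge0. Qed.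

Lemma edge_levels e : edges X e ->
  [/\ vertices X e.1, vertices X e.2, elevel e = e.1.1, (e.1.1 <= e.2.1)%R &
      (e.2.1 <= e.1.1 + 1)%R].
Proof.
move=> Xe; have up := edges_upward Xe; have [v1 v2 _ + _] := edges_adjacent Xe.
move=> d1; split => //; first by apply/min_idPl.
by move: d1 up; clear; case: e => [[n x] [k y]] /=; lia.
Qed.

Lemma inessential_ball (r : R) (x : M) : ~ essential M r -> forall t, (r / 4 <= t)%R -> ball x t = setT.
Proof.
move=> h t rt; apply/seteqP; split => // y _; apply/in_ball.
exact: lt_le_trans (inessential_mdist _ _ h) rt.
Qed.

(** All distances are below rad n / 4, while a vertex of level at most n + 1 has radius at least rad
    n / 2: its ball is the whole space. *)
Lemma inessential_discretize f v w (n : int) : ~ essential M (rad n : R) ->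
  (v.1 <= n + 1)%R -> (w.1 <= n + 1)%R -> discretize mu f v = discretize mu f w.
Proof.
move=> h vn wn; have full u : (u.1 <= n + 1)%R -> vball u = [set: M].
  move=> un; rewrite vballE; apply: (inessential_ball _ h).
  have := @le_rad R _ _ un; rewrite [X in (X / 4)%R](rad_add n 1) expr1.
  by have := @rad_gt0 R (n + 1); lra.
by rewrite /discretize !full.
Qed.

Lemma inessential_edge_diff f e : edges X e -> ~ essential M (rad (elevel e) : R) ->
  edge_diff mu f e = 0%R.
Proof.
move=> /edge_levels[_ _ -> e12 e21] h.
rewrite /edge_diff /graph_diff (inessential_discretize f (v := e.2) (w := e.1) h) ?lerDl//.
by rewrite subrr Normc.normc0.
Qed.

Lemma inessential_osc f v : ~ essential M (rad v.1 : R) -> osc X (discretize mu f) v = 0.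
Proof.
move=> h; apply/eqP; rewrite eq_le osc_ge0 andbT; apply: osc_le => // e Xe le _.
rewrite -[Normc.normc _]/(edge_diff mu f e) inessential_edge_diff//.
by rewrite le.
Qed.

(** All edges at a vertex v of level k cover the ball of radius rad k / 4 about v, and on one level
    these balls are disjoint. Hence at each point the inner sum of the norm is charged by at most
    one vertex; C 4^Q comes from the volume of these balls. *)
Lemma osc_besov (s p : R) f : (0 < p)%R ->
  \esum_(v in vertices X) ((2 `^ (v.1%:~R * (s * p - Q)))%:E *
      osc X (discretize mu f) v `^ p) <=
  (C * 4 `^ Q)%:E * besov_norm mu X s p%:E p%:E f `^ p.
Proof.
move=> p0; rewrite besov_norm_poweR//.
have C0 : (0 < C)%R by apply: lt_le_trans rb.1.
have C4 : (0 <= C * 4 `^ Q)%R by rewrite mulr_ge0 ?powR_ge0 ?ltW.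
rewrite (esum_fiber (fun v : int * M => v.1)); last first.
  by move=> v _; rewrite mule_ge0 ?lee_fin ?powR_ge0 ?poweR_ge0.
rewrite -esumZl ?lee_fin//; last first.
  move=> k _; rewrite mule_ge0 ?lee_fin ?powR_ge0//; apply: integral_ge0 => x _.
  exact: poweR_ge0.
apply: le_esum => k _; set S := vertices X `&` _.
have [ess|iness] := pselect (essential M (rad k : R)); last first.
  rewrite esum1; last first.
    move=> v [_ /= vk]; rewrite inessential_osc ?poweR0r ?gt_eqF ?mule0//.
    by rewrite vk.
  rewrite !mule_ge0 ?lee_fin ?powR_ge0//; apply: integral_ge0 => x _.
  exact: poweR_ge0.
pose b (v : int * M) := ball v.2 (rad k / 4 : R).
have rk0 := @rad_gt0 R k; have rk4 : (0 < rad k / 4 :> R)%R by rewrite divr_gt0.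
have ess4 : essential M (rad k / 4 : R).
  by apply: essential_le ess; rewrite ler_pdivrMr// ler_peMr ?(ltW rk0)// ler1n.
have mb v : measurable (b v : set T) by exact: measurable_ball_cara.
have cS : countable S.
  apply: sub_countable (countable_vertices X Q0 mm rb).
  by apply: subset_card_le => v [].
set o := osc X (discretize mu f).
have o0 v : 0 <= o v `^ p by exact: poweR_ge0.
apply: (@le_trans _ _ ((C * 4 `^ Q * 2 `^ (k%:~R * (s * p)))%:E *
   \esum_(v in S) (o v `^ p * mu (b v)))).
  rewrite -esumZl ?lee_fin ?mulr_ge0 ?powR_ge0 ?(ltW C0)//; last first.
    by move=> v _; rewrite mule_ge0.
  apply: le_esum => v [_ /= vk]; rewrite [leRHS]muleCA muleC.
  apply: lee_wpmul2l => //.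
  apply: (@le_trans _ _ ((C * 4 `^ Q * 2 `^ (k%:~R * (s * p)))%:E *
     (C^-1 * (rad k / 4) `^ Q)%:E)); last first.
    apply: lee_wpmul2l; first by rewrite lee_fin !mulr_ge0 ?powR_ge0 ?(ltW C0).
    exact: (rb.2 v.2 _ rk4).2.
  rewrite -EFinM lee_fin vk powR_div ?(ltW rk0)// powRN rad_powR mulrBr powRD_pos//.
  rewrite mulNr le_eqVlt; apply/orP; left; apply/eqP; field.
  by rewrite !gt_eqF// powR_gt0.
rewrite [leRHS]muleA -EFinM; apply: lee_wpmul2l; first by rewrite lee_fin !mulr_ge0 ?powR_ge0 ?(ltW C0).
apply: (@le_trans _ _ (\int[cara mu]_x \esum_(v in S) (o v `^ p * (\1_(b v) x)%:E))).
  rewrite (integral_esum (cara mu) cS); last 2 first.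
  - move=> v _; apply: emeasurable_funM; first exact: measurable_cst.
    by apply/measurable_EFinP; exact: measurable_indic.
  - by move=> v x _; rewrite mule_ge0// lee_fin.
  by apply: le_esum => v _; rewrite integral_cst_indic.
apply: le_integral_nonmeasurable => x.
  by apply: esum_ge0 => v _; rewrite mule_ge0// lee_fin.
have term0 e : 0 <= (edge_diff mu f e * \1_(eball e) x)%:E.
  by rewrite lee_fin mulr_ge0// edge_diff_ge0.
apply: esum_le_single; first exact: poweR_ge0.
- move=> v [Vv /= vk]; rewrite mule_ge0 ?lee_fin//=.
  have [bx|bx] := pselect (b v x); last by rewrite indic_notin// mule0 poweR_ge0.
  rewrite indic_in// mule1; apply: le_poweR; rewrite ?(ltW p0) ?osc_ge0//.
  apply: osc_le; first by apply: esum_ge0 => e _.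
  move=> e Xe le ev.
  have ex : eball e x.
    have vx : vball v x.
      apply/in_vball; move/in_ball: bx => bx; apply: lt_le_trans bx _.
      by rewrite vk ler_pdivrMr// ler_peMr ?(ltW rk0)// ler1n.
    by case: ev => <- in vx; [left | right].
  apply: le_trans (ge_esum_term (i := e) _ _); last 2 first.
  - by move=> e' _; exact: term0.
  - by split => //=; rewrite le.
  by rewrite indic_in// mulr1.
- move=> v w [Vv /= vk] [Vw /= wk].
  have [vx|vx] := pselect (b v x); last by rewrite indic_notin// mule0 eqxx.
  have [wx|wx] := pselect (b w x); last by rewrite (indic_notin wx) mule0 eqxx.
  move=> _ _; apply: contrapT => vw.
  have : (rad k / 2 <= mdist v.2 w.2)%R.
    case: v w Vv vk Vw wk vw {vx wx} => [n y] [l z] Vv /= nk Vw /= lk vw; subst n l.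
    by apply: (net_separated (X := X)) => // yz; apply: vw; rewrite yz.
  apply/negP; rewrite -ltNge; move/in_ball: vx; move/in_ball: wx => wx vx.
  apply: le_lt_trans (metric_triangle v.2 x w.2) _.
  by move: wx; rewrite (metric_sym w.2); lra.
Qed.

End function_space_norms.

(** * A discrete Schur test *)

Section schur_test.
Context {R : realType}.
Local Open Scope ereal_scope.

Let mule_regroup (a b c e f K : R) (D : \bar R) : (a * (b * c) = e * f)%R ->
  K%:E * (a%:E * (b%:E * (c%:E * D))) = K%:E * (e%:E * (f%:E * D)).
Proof. by move=> E; congr (_ * _); rewrite !muleA -!EFinM -E mulrA. Qed.

(** The weight in [esum_poweR_weighted] is 2^(-(l x - l' y)(th + ep)), summable over the x related
    to y because their number on a level grows at rate [th]. For p > 1 it uses up (th + ep)(p - 1)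
    of the decay al p; what is left, together with [ta], sums over y after the two sums are
    exchanged. *)
Lemma schur_levels (I J : choiceType) (V : set I) (W : set J) (l : I -> int)
    (l' : J -> int) (rel : J -> I -> Prop) (th al ta p N : R) :
  (0 < p)%R -> (0 <= N)%R ->
  (0 < al * p - th * Num.max 0 (p - 1) + ta)%R ->
  (forall y x, W y -> V x -> rel y x -> (l' y <= l x)%R) ->
  (forall y k, W y -> (l' y <= k)%R ->
     \esum_(x in V `&` [set x | rel y x /\ l x = k]) 1 <=
     (N * 2 `^ ((k - l' y)%:~R * th))%:E) ->
  (forall x k, V x -> \esum_(y in W `&` [set y | rel y x /\ l' y = k]) 1 <= N%:E) ->
  exists2 K : R, (0 <= K)%R & forall d : I -> \bar R, (forall x, 0 <= d x) ->
    \esum_(y in W) ((2 `^ ((l' y)%:~R * ta))%:E *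
      (\esum_(x in V `&` rel y) ((2 `^ (- (l x - l' y)%:~R * al))%:E * d x)) `^ p) <=
    K%:E * \esum_(x in V) ((2 `^ ((l x)%:~R * ta))%:E * d x `^ p).
Proof.
move=> p0 N0; set c := Num.max _ _; set ka := (_ + ta)%R => ka0 lele cntV cntW.
have c0 : (0 <= c)%R by rewrite le_max lexx.
(* Small enough to leave the decay ka' = ka - ep c > ka / 2. *)
pose ep := (ka / (2 * (c + 1)))%R.
have c1 : (0 < c + 1)%R by rewrite ltr_wpDl.
have ep0 : (0 < ep)%R by rewrite divr_gt0// mulr_gt0.
pose ka' := (ta + al * p - (th + ep) * c)%R.
have ka'0 : (0 < ka')%R.
  have -> : (ka' = ka - ep * c)%R by rewrite /ka' /ka; ring.
  rewrite subr_gt0 /ep -mulrA gtr_pMr// mulrC ltr_pdivrMr ?mulr_gt0// mul1r.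
  lra.
have geo0 (e : R) : (0 < e)%R -> (0 <= (1 - 2 `^ (- e))^-1)%R.
  move=> e0; rewrite invr_ge0 subr_ge0 -[leRHS](powRr0 2) ler_powR ?ler1n//.
  by rewrite oppr_le0 ltW.
pose C0 := (N * (1 - 2 `^ (- (th + ep - th)))^-1 + 1)%R.
have C00 : (0 < C0)%R.
  by rewrite ltr_wpDl// mulr_ge0// geo0// addrAC subrr add0r.
pose C1 := (N * (1 - 2 `^ (- (ka' - 0)))^-1)%R.
have C10 : (0 <= C1)%R by rewrite mulr_ge0// geo0// subr0.
have K0 : (0 <= 2 `^ p * C0 `^ c * C1)%R by rewrite mulr_ge0// mulr_ge0 ?powR_ge0.
exists (2 `^ p * C0 `^ c * C1)%R => //.
move=> d d0.
pose w y x : R := (2 `^ (- (l x - l' y)%:~R * (th + ep)))%R.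
pose k y x : R := (2 `^ (- (l x - l' y)%:~R * al))%R.
have step y : W y -> (\esum_(x in V `&` rel y) ((k y x)%:E * d x)) `^ p <=
    (2 `^ p * C0 `^ c)%:E *
    \esum_(x in V `&` rel y) ((w y x `^ (- c))%:E * ((k y x)%:E * d x) `^ p).
  move=> Wy; apply: esum_poweR_weighted => //.
  - by move=> x; exact: powR_gt0.
  - by move=> x _; rewrite mule_ge0// lee_fin powR_ge0.
  - move=> _; apply: (@le_trans _ _ (C0 - 1)%:E).
      rewrite addrK; apply: esum_level_decay => //.
      + by rewrite ltrDl.
      + by move=> x [Vx yx]; exact: lele.
      + move=> j lj; apply: le_trans (cntV y j Wy lj).
        by apply: subset_le_esum => // x [[Vx yx] lx].
    by rewrite lee_fin lerBlDr lerDl.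
apply: (@le_trans _ _ (\esum_(y in W) \esum_(x in V `&` rel y)
   ((2 `^ p * C0 `^ c)%:E * ((2 `^ (- (l x - l' y)%:~R * ka'))%:E *
     ((2 `^ ((l x)%:~R * ta))%:E * d x `^ p))))).
  apply: le_esum => y Wy.
  apply: (@le_trans _ _ ((2 `^ ((l' y)%:~R * ta))%:E * ((2 `^ p * C0 `^ c)%:E *
    \esum_(x in V `&` rel y) ((w y x `^ (- c))%:E * ((k y x)%:E * d x) `^ p)))).
    by apply: lee_wpmul2l; rewrite ?lee_fin ?powR_ge0//; exact: step.
  rewrite muleCA -!esumZl ?lee_fin ?mulr_ge0 ?powR_ge0//; last 2 first.
  - by move=> x _; rewrite !mule_ge0 ?lee_fin ?powR_ge0 ?poweR_ge0.
  - by move=> x _; rewrite !mule_ge0 ?lee_fin ?powR_ge0 ?poweR_ge0.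
  apply: le_esum => x _; rewrite poweRM ?lee_fin ?powR_ge0// poweR_EFin.
  have E : (2 `^ ((l' y)%:~R * ta) * (w y x `^ (- c) * k y x `^ p) =
      2 `^ (- (l x - l' y)%:~R * ka') * 2 `^ ((l x)%:~R * ta) :> R)%R.
    rewrite /w /k -!powRrM -!powRD_pos//; congr (_ `^ _)%R.
    by rewrite /ka' !intrB; ring.
  by rewrite (mule_regroup _ _ E).
rewrite (@exchange_esum _ _ _ _ _ V (fun x => W `&` [set y | rel y x])); last 2 first.
- move=> y x; split => [[Wy [Vx xy]]|[Vx [Wy xy]]].
    exact: (conj Vx (conj Wy xy)).
  exact: (conj Wy (conj Vx xy)).
- by move=> y x _ _; rewrite !mule_ge0 ?lee_fin ?mulr_ge0 ?powR_ge0 ?poweR_ge0.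
rewrite -esumZl ?lee_fin//; last first.
  by move=> x _; rewrite mule_ge0 ?lee_fin ?powR_ge0 ?poweR_ge0.
apply: le_esum => x Vx.
set A := (2 `^ ((l x)%:~R * ta))%:E * d x `^ p.
have A0 : 0 <= A by rewrite mule_ge0 ?lee_fin ?powR_ge0 ?poweR_ge0.
rewrite esumZl ?lee_fin ?mulr_ge0 ?powR_ge0//; last first.
  by move=> y _; rewrite mule_ge0// lee_fin powR_ge0.
rewrite [leRHS](_ : _ = (2 `^ p * C0 `^ c)%:E * (C1%:E * A)); last first.
  by clearbody A; rewrite [in LHS]EFinM -muleA.
apply: lee_wpmul2l; first by rewrite lee_fin mulr_ge0 ?powR_ge0.
under eq_esum do rewrite muleC.
rewrite esumZl//.
rewrite muleC; apply: lee_wpmul2r => //.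
rewrite (_ : esum _ _ = \esum_(y in W `&` [set y | rel y x])
    (2 `^ (- (- l' y - - l x)%:~R * ka'))%:E); last first.
  by apply: eq_esum => y _; rewrite opprK [(- l' y + _)%R]addrC.
apply: esum_level_decay => //.
- by move=> y [Wy yx] /=; rewrite lerN2; exact: lele.
- move=> j _; rewrite mulr0 powRr0 mulr1; apply: le_trans (cntW x (- j)%R Vx).
  by apply: subset_le_esum => // y [[Wy yx] /= <-]; rewrite opprK.
Qed.

End schur_test.

(** * Porous subsets *)

Section embedded_pair.
Context {R : realType} {Z N : pmetricType R}.
Context (mu : {outer_measure set Z -> \bar R}) (nu : {outer_measure set N -> \bar R}).
Context (XZ : @hyperbolic_filling R Z) (XN : @hyperbolic_filling R N).
Context (Q lam CZ CN : R) (io : N -> Z).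
Hypothesis io_isometry : forall x y, mdist (io x) (io y) = mdist x y.
Hypothesis (Q0 : 0 < Q) (lam0 : 0 < lam).
Hypothesis (mmZ : metric_measure_space mu) (mmN : metric_measure_space nu).
Hypothesis (rbZ : regular_bounds mu Q CZ) (rbN : regular_bounds nu lam CN).
Let TZ := caratheodory_type mu.
Let TN := caratheodory_type nu.

Lemma open_preimage_io (A : set Z) : open A -> open (io @^-1` A).
Proof.
rewrite !openE => oA x /oA /nbhs_ballP[e /= e0 eA]; apply/nbhs_ballP; exists e => //.
by move=> y /in_ball xy; apply: eA; apply/in_ball; rewrite io_isometry.
Qed.

Lemma measurable_preimage_ball (z : Z) (r : R) :
  measurable (io @^-1` ball z r : set TN).
Proof. by apply: open_caratheodory => //; apply: open_preimage_io; exact: open_ballE. Qed.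

Lemma essential_io (r : R) : essential N r -> essential Z r.
Proof. by move=> [x [y xy]]; exists (io x), (io y); rewrite io_isometry. Qed.

(** The centre lies in the ambient space; recentring at one of the counted vertices doubles the
    radius. *)
Lemma verticesN_packing (k : int) (z : Z) (r : R) : rad k <= r ->
  (\esum_(v in vertices XN `&` [set v | v.1 = k /\ (mdist z (io v.2) < r)%R]) 1 <=
    (packing_const lam CN * (2 * r / rad k) `^ lam)%:E)%E.
Proof.
move=> kr; set S := vertices XN `&` _.
have r0 : 0 < r by apply: lt_le_trans kr; exact: rad_gt0.
have [[v1 [V1 [_ z1]]]|S0] := pselect (S !=set0); last first.
  rewrite esum1; last by move=> v Sv; exfalso; apply: S0; exists v.
  by rewrite lee_fin mulr_ge0 ?powR_ge0// ltW// (packing_const_gt0 lam0 rbN).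
apply: le_trans (vertices_packing XN lam0 mmN rbN v1.2 (r := 2 * r) _); last first.
  by apply: le_trans kr _; rewrite ler_peMl ?ltW// ltr1n.
apply: subset_le_esum => // v [Vv [vk zv]]; split => //; split => //.
rewrite -io_isometry; apply: le_lt_trans (metric_triangle _ z _) _.
by rewrite metric_sym mulr_natl mulr2n ltrD.
Qed.

Definition meeting : set (int * Z) :=
  vertices XZ `&` [set x | exists y, vball x (io y)].

Definition meeting_const : R :=
  packing_const Q CZ * 2 `^ Q * (packing_const lam CN * 6 `^ lam).

(** These are vertices of the space, yet counted with the exponent of the subset: each has a vertex
    of the subset within 2 rad k, and each vertex of the subset serves boundedly many. The radius
    grows from r to 2 (r + 2 rad k) <= 6 r, whence 6^lam. *)
Lemma meeting_packing (k : int) (z : Z) (r : R) : rad k <= r ->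
  (\esum_(x in meeting `&` [set x | x.1 = k /\ (mdist z x.2 < r)%R]) 1 <=
    (meeting_const * (r / rad k) `^ lam)%:E)%E.
Proof.
move=> kr; have rk0 := @rad_gt0 R k; have r0 : 0 < r by exact: lt_le_trans kr.
set S := meeting `&` _.
pose W := vertices XN `&` [set v | v.1 = k /\ mdist z (io v.2) < r + 2 * rad k].
pose near (x : int * Z) := W `&` [set v | mdist x.2 (io v.2) < 2 * rad k].
have near_ex x : S x -> exists v, near x v.
  move=> [[Vx [y /in_vball xy]] [xk zx]].
  have [w nw yw] := net_dense XN k y.
  have xw : mdist x.2 (io w) < 2 * rad k.
    apply: le_lt_trans (metric_triangle x.2 (io y) _) _.
    by rewrite io_isometry; move: xy yw; rewrite xk; lra.
  exists (k, w); split => //; split => //; split => //=.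
  by apply: le_lt_trans (metric_triangle z x.2 _) _; rewrite ltrD.
apply: (@le_trans _ _ (\esum_(x in S) \esum_(v in near x) 1)%E).
  apply: le_esum => x /near_ex[v xv].
  by apply: (ge_esum_term (a := fun=> 1%E)) xv.
rewrite (@exchange_esum _ _ _ _ _ W
  (fun v => S `&` [set x | mdist x.2 (io v.2) < 2 * rad k]))//; last first.
  move=> x v; split => [[Sx [Wv xv]]|[Wv [Sx xv]]].
    exact: (conj Wv (conj Sx xv)).
  exact: (conj Sx (conj Wv xv)).
have PZ0 := packing_const_gt0 Q0 rbZ; have PN0 := packing_const_gt0 lam0 rbN.
apply: (@le_trans _ _ (\esum_(v in W) ((packing_const Q CZ * 2 `^ Q)%:E * 1))%E).
  apply: le_esum => v _; rewrite mule1.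
  have k2 : rad k <= 2 * rad k :> R by rewrite ler_peMl ?ltW// ltr1n.
  have := vertices_packing XZ Q0 mmZ rbZ (io v.2) k2.
  rewrite mulfK ?gt_eqF//; apply: le_trans; apply: subset_le_esum => //.
  by move=> x [[[Vx _] [xk _]] xv]; split => //; split => //; rewrite metric_sym.
rewrite esumZl ?lee_fin ?mulr_ge0 ?powR_ge0 ?(ltW PZ0)//.
have kr2 : rad k <= r + 2 * rad k by rewrite (le_trans kr)// lerDl mulr_ge0 ?ltW.
apply: (@le_trans _ _ ((packing_const Q CZ * 2 `^ Q)%:E *
    (packing_const lam CN * (2 * (r + 2 * rad k) / rad k) `^ lam)%:E)%E).
  apply: lee_wpmul2l; last exact: verticesN_packing.
  by rewrite lee_fin mulr_ge0 ?powR_ge0 ?(ltW PZ0).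
rewrite -EFinM lee_fin /meeting_const -!mulrA.
do 3 (apply: ler_wpM2l; first by rewrite ?powR_ge0 ?ltW).
rewrite -powRM ?divr_ge0 ?(ltW r0) ?(ltW rk0)//.
apply: ge0_ler_powR; rewrite ?nnegrE ?(ltW lam0) ?mulr_ge0 ?divr_ge0 ?invr_ge0 ?(ltW r0) ?(ltW rk0)//.
  by rewrite addr_ge0 ?mulr_ge0 ?ltW.
by rewrite !mulrA ler_pM2r ?invr_gt0//; lra.
Qed.

Lemma meeting_const_ge0 : 0 <= meeting_const.
Proof.
have PZ0 := packing_const_gt0 Q0 rbZ; have PN0 := packing_const_gt0 lam0 rbN.
exact: mulr_ge0 (mulr_ge0 (ltW PZ0) (powR_ge0 _ _)) (mulr_ge0 (ltW PN0) (powR_ge0 _ _)).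
Qed.

Hypothesis cF : closed (range io).
Hypothesis poF : porous (range io).

Lemma range_io0 : range io !=set0. Proof. by exists (io point), point. Qed.

(** Porosity gives a hole of radius c r' with r' >= r / 8. The concentric ball of half that radius
    is kept: c r' / 2 >= (c / 16) r, and its points have at least this distance from the subset. *)
Lemma meeting_holes : exists2 c : R, 0 < c <= 1 & forall x, meeting x ->
  essential Z (rad x.1 : R) -> exists y, ball y (c * rad x.1) `<=` vball x /\
    forall w t, ball y (c * rad x.1) w -> c * rad x.1 <= mdist w (io t).
Proof.
have [c /andP[c0 c1] hole] := poF.
exists (c / 16); first by apply/andP; split; [exact: divr_gt0 | lra].
move=> x [Vx [t0 xt0]] [a [b ab]]; set r := rad x.1 in ab *.
have r0 : 0 < r by exact: rad_gt0.
have [z [r' [rr' r'd zx [t1 zt1]]]] : exists (z : Z) (r' : R), [/\ r / 8 <= r',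
    (r'%:E < diam [set: Z])%E, ball z r' `<=` vball x & exists t, ball z r' (io t)].
  have mdiam (u v : Z) : ((mdist u v)%:E <= diam [set: Z])%E.
    by apply: ereal_sup_ubound; right; exists (u, v).
  (* Porosity applies to radii strictly below the diameter. If r <= diam, a radius halfway between r
     and the distance from the centre to a point of the subset is admissible and the ball still
     contains that point. Otherwise [vball x] is the whole space and the ball of radius r / 8 about
     a point of the subset is taken; r / 8 < diam since r is essential. *)
  have [rd|dr] := leP r%:E (diam [set: Z]).
    move/in_vball : (xt0) => xt0'; rewrite -/r in xt0'.
    have d0 := mdist_ge0 x.2 (io t0).
    exists x.2, ((mdist x.2 (io t0) + r) / 2); split.
    - by lra.
    - by apply: lt_le_trans rd; rewrite lte_fin; lra.
    - by move=> y /in_ball h; apply/in_vball; rewrite -/r; lra.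
    - by exists t0; apply/in_ball; lra.
  exists (io t0), (r / 8); split => //.
  - by apply: lt_le_trans (mdiam a b); rewrite lte_fin; lra.
  - move=> y _; apply/in_vball; rewrite -/r -lte_fin.
    exact: le_lt_trans (mdiam x.2 y) dr.
  - by exists t0; apply/in_ball; rewrite mdistxx divr_gt0.
have r'0 : 0 < r' by apply: lt_le_trans rr'; rewrite divr_gt0.
have [|y yh] := hole z r' r'0 r'd; first by exists (io t1); split => //; exists t1.
have cr : c / 16 * r <= c * r' / 2.
  have := ler_wpM2l (ltW c0) rr'; rewrite mulrA (mulrAC c) mulrC; lra.
have cr'0 : 0 < c * r' by rewrite mulr_gt0.
exists y; split.
  move=> w /in_ball yw; apply: zx; apply: (yh w _).1; apply/in_ball; lra.
move=> w t /in_ball yw; rewrite leNgt; apply/negP => wt.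
have [|_] := yh (io t); last by apply; exists t.
apply/in_ball; apply: le_lt_trans (metric_triangle y w _) _; lra.
Qed.

(** A point w of the hole of x has distance between c rad x.1 and 2 rad x.1 from the subset. Hence
    the holes containing w belong to a bounded range of levels around the dyadic level of that
    distance, with boundedly many on each, and the sum of d over them is bounded by a multiple of
    [Phi w]. *)
Lemma holes_sum : exists2 K : R, 0 <= K &
  forall (Phi : Z -> \bar R) (d : int * Z -> \bar R) (S : set (int * Z)),
  (forall w, 0 <= Phi w)%E -> (forall x, 0 <= d x)%E ->
  (forall x, S x -> meeting x /\ essential Z (rad x.1 : R)) ->
  (forall x w, S x -> vball x w -> (d x <= Phi w)%E) ->
  (\esum_(x in S) ((2 `^ (- x.1%:~R * Q))%:E * d x) <=
   K%:E * \int[cara mu]_w Phi w)%E.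
Proof.
have [c /andP[c0 c1] hole] := meeting_holes.
have CZ0 : 0 < CZ by apply: lt_le_trans rbZ.1.
have PZ0 := packing_const_gt0 Q0 rbZ.
have [m cm] : exists m : nat, 2 / c <= 2 ^+ m.
  have [j /andP[_ jc]] := exists_rad (divr_gt0 (ltr0Sn R 1) c0).
  exists `|1 - j|%N; apply: ltW; apply: lt_le_trans jc _.
  have -> : 2 * rad j = rad (j - 1) :> R by rewrite -(rad_sub j 1).
  rewrite /rad -powR_mulrn// ler_powR ?ler1n// -mulrNz.
  rewrite (_ : `|1 - j|%N%:R = (`|1 - j|%N%:Z)%:~R)// ler_int.
  by lia.
(* The levels in question run from j - m to j + 1. On this range the factor 2^(m + 1) makes the
   weight 2^(-(k - (j - m))) at least 1, so [esum_level_decay] also bounds the plain count. *)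
pose N' := 2 `^ (m%:R + 1) * (packing_const Q CZ * (1 - 2 `^ (- (1 - 0)))^-1) + 1 : R.
have geo0 : 0 <= (1 - 2 `^ (- (1 - 0)) : R)^-1.
  by rewrite invr_ge0 subr_ge0 -[leRHS](powRr0 2) ler_powR ?ler1n// subr0 oppr_le0.
have N'0 : 0 < N'.
  exact: ltr_wpDl (mulr_ge0 (powR_ge0 _ _) (mulr_ge0 (ltW PZ0) geo0)) ltr01.
exists (CZ * c `^ (- Q) * N'); first by rewrite !mulr_ge0 ?powR_ge0 ?ltW.
move=> Phi d S Phi0 d0 Sm dPhi.
have [h hP] : {h : int * Z -> Z & forall x, S x -> ball (h x) (c * rad x.1) `<=` vball x /\
    forall w t, ball (h x) (c * rad x.1) w -> c * rad x.1 <= mdist w (io t)}.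
  apply: (@choice _ _ (fun x y => S x -> ball y (c * rad x.1) `<=` vball x /\
    forall w t, ball y (c * rad x.1) w -> c * rad x.1 <= mdist w (io t))) => x.
  have [Sx|nSx] := pselect (S x); last by exists point.
  by have [y ?] := hole x (Sm x Sx).1 (Sm x Sx).2; exists y.
pose H x := ball (h x) (c * rad x.1).
have mH x : measurable (H x : set TZ) by exact: measurable_ball_cara.
have cS : countable S.
  apply: sub_countable (countable_vertices XZ Q0 mmZ rbZ).
  by apply: subset_card_le => x /Sm[[]].
have step1 : (\esum_(x in S) ((2 `^ (- x.1%:~R * Q))%:E * d x) <=
    (CZ * c `^ (- Q))%:E * \esum_(x in S) (d x * mu (H x)))%E.
  rewrite -esumZl ?lee_fin ?mulr_ge0 ?powR_ge0 ?(ltW CZ0)//; last first.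
    by move=> x _; rewrite mule_ge0.
  apply: le_esum => x Sx; rewrite [leRHS]muleCA muleC.
  apply: lee_wpmul2l => //.
  have rx0 := @rad_gt0 R x.1; have cr0 : 0 < c * rad x.1 by rewrite mulr_gt0.
  have ess : essential Z (c * rad x.1).
    by apply: essential_le (Sm x Sx).2; rewrite ler_piMl// ltW.
  apply: le_trans (lee_wpmul2l _ ((rbZ.2 (h x) _ cr0).2 ess)); last first.
    by rewrite lee_fin mulr_ge0 ?powR_ge0 ?ltW.
  rewrite -EFinM lee_fin powRM ?(ltW c0) ?(ltW rx0)// powRN rad_powR le_eqVlt.
  by apply/orP; left; apply/eqP; field; rewrite !gt_eqF// powR_gt0.
apply: le_trans step1 _; rewrite [leRHS](_ : _ = (CZ * c `^ (- Q))%:E *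
  (N'%:E * \int[cara mu]_w Phi w))%E; last by rewrite EFinM muleA.
apply: lee_wpmul2l; first by rewrite lee_fin mulr_ge0 ?powR_ge0 ?ltW.
rewrite -lee_pdivrMl//.
have -> : (\esum_(x in S) (d x * mu (H x)) =
    \int[cara mu]_w \esum_(x in S) (d x * (\1_(H x) w)%:E))%E.
  rewrite (integral_esum (cara mu) cS); last 2 first.
  - move=> x _; apply: emeasurable_funM; first exact: measurable_cst.
    by apply/measurable_EFinP; exact: measurable_indic.
  - by move=> x w _; rewrite mule_ge0// lee_fin.
  by apply: eq_esum => x _; rewrite integral_cst_indic.
rewrite -ge0_integralZl//; last 3 first.
- apply: (measurable_esum cS) => x.
    move=> _; apply: emeasurable_funM; first exact: measurable_cst.
    by apply/measurable_EFinP; exact: measurable_indic.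
  by move=> w _; rewrite mule_ge0// lee_fin.
- by move=> w _; apply: esum_ge0 => x _; rewrite mule_ge0// lee_fin.
- by rewrite lee_fin invr_ge0 ltW.
apply: le_integral_nonmeasurable => w.
  by rewrite mule_ge0 ?lee_fin ?invr_ge0 ?(ltW N'0)//; apply: esum_ge0 => x _; rewrite mule_ge0// lee_fin.
rewrite lee_pdivrMl//.
pose S' := S `&` [set x | H x w].
apply: (@le_trans _ _ (\esum_(x in S') d x)%E).
  rewrite esum_mkcond [leRHS]esum_mkcond; apply: le_esum => x _.
  have [/set_mem Sx|nSx] := boolP (x \in S); last by case: ifP.
  have [Hx|Hx] := pselect (H x w); first by rewrite mem_set// indic_in// mule1.
  by rewrite indic_notin// mule0; case: ifP.
apply: esum_le_count => //; last first.
  by move=> x [Sx Hx]; rewrite d0 (dPhi x w)//; exact: (hP x Sx).1.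
have [[x1 S'x1]|S'0] := pselect (S' !=set0); last first.
  by rewrite esum1 ?lee_fin ?(ltW N'0)// => x S'x; exfalso; apply: S'0; exists x.
pose dl := dist_to (range io) w.
have S'dl x : S' x -> c * rad x.1 <= dl /\ dl < 2 * rad x.1.
  move=> [Sx Hx]; split.
    apply: lb_le_inf; first by case: range_io0 => y Fy; exists (mdist w y), y.
    by move=> _ [_ [t _ <-] <-]; exact: (hP x Sx).2.
  have [[_ [t /in_vball xt]] _] := Sm x Sx.
  have /in_vball xw := (hP x Sx).1 _ Hx.
  apply: le_lt_trans (dist_to_le w (A := range io) (y := io t) _) _; first by exists t.
  by apply: le_lt_trans (metric_triangle w x.2 _) _; rewrite metric_sym; lra.
have dl0 : 0 < dl by apply: lt_le_trans (S'dl _ S'x1).1; rewrite mulr_gt0// rad_gt0.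
have [j /andP[j1 j2]] := exists_rad dl0.
have levels x : S' x -> j - m%:Z <= x.1 /\ x.1 <= j + 1.
  move=> /S'dl[h1 h2]; split.
    have : rad x.1 < rad (j - m%:Z - 1) :> R.
      rewrite -addrA -opprD -PoszD addn1 rad_sub exprS -(ltr_pM2l c0).
      apply: le_lt_trans h1 _; apply: lt_le_trans j2 _.
      rewrite mulrA ler_pM2r ?rad_gt0//.
      have : 2 <= c * 2 ^+ m by rewrite mulrC -ler_pdivrMr.
      rewrite mulrCA; lra.
    by move/rad_lt_imp; rewrite ltrBlDr ltzD1.
  have : rad (j + 1) < 2 * rad x.1 :> R.
    by apply: le_lt_trans h2; apply: le_trans j1; apply: le_rad; rewrite lerDl.
  by rewrite -(rad_sub x.1 1) => /rad_lt_imp; rewrite ltrBlDr ltzD1.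
apply: (@le_trans _ _ (N' - 1)%:E); last by rewrite lee_fin lerBlDr lerDl.
rewrite addrK EFinM.
apply: (@le_trans _ _ (\esum_(x in S') ((2 `^ (m%:R + 1))%:E *
    (2 `^ (- (x.1 - (j - m%:Z))%:~R * 1))%:E))%E).
  apply: le_esum => x S'x; rewrite -EFinM lee_fin mulr1 -powRD_pos//.
  rewrite -[leLHS](powRr0 2) ler_powR ?ler1n// -[m%:R]/(m%:~R) -[1]/(1%:~R) -!mulrNz -!intrD.
  rewrite -[0]/(0%:~R) ler_int; have := (levels x S'x).2.
  by rewrite -subr_ge0 => /le_trans; apply; rewrite le_eqVlt; apply/orP; left; apply/eqP; ring.
rewrite esumZl ?lee_fin ?powR_ge0//.
apply: lee_wpmul2l; first by rewrite lee_fin powR_ge0.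
apply: esum_level_decay => //; first exact: ltW.
  by move=> x /levels[].
move=> k _; rewrite mulr0 powRr0 mulr1.
have := vertices_packing XZ Q0 mmZ rbZ w (lexx (rad k)).
rewrite divff ?gt_eqF ?rad_gt0// powR1 mulr1; apply: le_trans.
apply: subset_le_esum => // x [[Sx Hx] /= xk]; split; first by have [[]] := Sm x Sx.
split => //; have /in_vball := (hP x Sx).1 _ Hx.
by rewrite metric_sym xk.
Qed.

End embedded_pair.

Lemma sum_le_esum {R : realType} (I : choiceType) (S : set I) (a : I -> \bar R)
    (f : nat -> I) (m : nat) :
  (forall i, S i -> 0 <= a i)%E -> injective f ->
  (forall i, (i < m)%N -> S (f i)) ->
  (\sum_(i < m) a (f i) <= \esum_(i in S) a i)%E.
Proof.
move=> a0 fI Sf; apply: ereal_sup_ubound => /=.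
exists (f @` `I_m).
  split; first exact/finite_image/finite_II.
  by move=> _ [i im <-]; exact: Sf.
by rewrite fsbig_image ?(fsbig_ord _ _ (fun i => a (f i)))// => i j _ _; exact: fI.
Qed.

Lemma measure_cover_le {R : realType} d (T : measurableType d)
    (m : {measure set T -> \bar R}) (I : choiceType) (S : set I) (F : I -> set T)
    (A : set T) : countable S -> measurable A ->
  (forall i, S i -> measurable (F i)) ->
  (forall x, A x -> exists2 i, S i & F i x) ->
  (m A <= \esum_(i in S) m (F i))%E.
Proof.
move=> cS mA mF cov.
have := @integral_cst_indic R d T m A 1%E mA lee01; rewrite mul1e => <-.
rewrite [leRHS](_ : _ = \esum_(i in S) \int[m]_x (1 * (\1_(F i) x)%:E))%E; last first.
  by apply: eq_esum => i Si; rewrite integral_cst_indic ?mul1e//; exact: mF.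
rewrite -(integral_esum m cS); last 2 first.
- move=> i Si; apply: emeasurable_funM; first exact: measurable_cst.
  by apply/measurable_EFinP/measurable_indic; exact: mF.
- by move=> i x _; rewrite mule_ge0// lee_fin.
apply: le_integral_nonmeasurable => x; first by rewrite mule_ge0// lee_fin.
have [Ax|Ax] := pselect (A x); last first.
  by rewrite indic_notin// mule0; apply: esum_ge0 => i _; rewrite mule_ge0// lee_fin.
have [i Si Fi] := cov x Ax.
apply: (@le_trans _ _ (1 * (\1_(F i) x)%:E)%E); first by rewrite !indic_in.
by apply: (ge_esum_term (a := fun i => 1 * (\1_(F i) x)%:E)%E) => // k _; rewrite mule_ge0// lee_fin.
Qed.

Lemma nonneg_mulrn_bounded {R : realType} (c : R) (T : \bar R) :
  0 < c -> (T < +oo)%E -> ~ (forall m : nat, ((c *+ m)%:E <= T)%E).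
Proof.
move=> c0; case: T => [t _ h|//|_ h]; last by have := h 0%N.
have := h (Num.trunc (t / c)).+1; rewrite lee_fin leNgt => /negP; apply.
by rewrite -mulr_natr mulrC -ltr_pdivrMr// truncnS_gt.
Qed.

(** * Dimension and negligibility of a porous subset *)

Section embedded_dimension.
Context {R : realType} {Z N : pmetricType R}.
Context (mu : {outer_measure set Z -> \bar R}) (nu : {outer_measure set N -> \bar R}).
Context (XZ : @hyperbolic_filling R Z) (XN : @hyperbolic_filling R N).
Context (Q lam CZ CN : R) (io : N -> Z).
Hypothesis io_isometry : forall x y, mdist (io x) (io y) = mdist x y.
Hypothesis (Q0 : 0 < Q) (lam0 : 0 < lam).
Hypothesis (mmZ : metric_measure_space mu) (mmN : metric_measure_space nu).
Hypothesis (rbZ : regular_bounds mu Q CZ) (rbN : regular_bounds nu lam CN).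
Let TZ := caratheodory_type mu.
Let TN := caratheodory_type nu.

Let CZ0 : 0 < CZ. Proof. by apply: lt_le_trans rbZ.1. Qed.
Let CN0 : 0 < CN. Proof. by apply: lt_le_trans rbN.1. Qed.
Let mball := measurable_ball_cara mmZ.

Lemma nu_preimage_vball x : meeting XZ io x ->
  (nu (io @^-1` vball x) <= (CN * 2 `^ lam * 2 `^ (- x.1%:~R * lam))%:E)%E.
Proof.
move=> [Vx [y /in_vball xy]]; have r0 := @rad_gt0 R x.1.
apply: (@le_trans _ _ (nu (ball y (2 * rad x.1)))).
  apply: le_mu => t /in_vball xt; apply/in_ball; rewrite -io_isometry.
  apply: le_lt_trans (metric_triangle _ x.2 _) _.
  by rewrite (metric_sym _ x.2) mulr_natl mulr2n ltrD.
apply: le_trans (rbN.2 y _ _).1 _; first by rewrite mulr_gt0.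
by rewrite lee_fin powRM// ?(ltW r0)// rad_powR mulrA.
Qed.

(** If lam >= Q, every level k >= n0 contributes at least a fixed c > 0 to the sum in [holes_sum]
    for the indicator of a ball: its vertices cover a fixed ball of the subset, each accounts for
    measure at most about 2^(-k lam), and this is bounded by a multiple of its weight 2^(-k Q).
    Infinitely many levels contradict the finite integral. *)
Lemma porous_dimension_lt (n0 : int) : porous (range io) ->
  essential N (rad n0 : R) -> lam < Q.
Proof.
move=> poF ess; rewrite ltNge; apply/negP => Qlam.
have [K K0 holes] := holes_sum XZ Q0 lam0 mmZ rbZ poF.
have n00 := @rad_gt0 R n0.
pose S : set (int * Z) := meeting XZ io `&` [set x | n0 <= x.1 /\
  mdist (io point) x.2 < 3 * rad n0].
have ball0 : ball (io point) (4 * rad n0) `<=` [set: Z] by [].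
have := holes (fun w => (\1_(ball (io point) (4 * rad n0)) w)%:E) (fun=> 1%E) S.
set I := (\int[_]_w _)%E => /(_ _ _ _ _)/wrap[].
- by move=> w; rewrite lee_fin.
- by [].
- move=> x [mx [nx _]]; split => //; apply: essential_le (essential_io io_isometry ess).
  exact: le_rad.
- move=> x w [_ [nx xz]] /in_vball xw; rewrite indic_in//; apply/in_ball.
  have := @le_rad R _ _ nx => rx.
  by apply: le_lt_trans (metric_triangle _ x.2 _) _; move: xz xw rx; lra.
have If : (K%:E * I < +oo)%E.
  rewrite lte_mul_pinfty ?lee_fin//.
  rewrite /I -[X in (X < _)%E](@eq_integral _ _ _ (cara mu) setT _
    (fun w => (1 * (\1_(ball (io point) (4 * rad n0)) w)%:E)%E)); last first.
    by move=> w _; rewrite mul1e.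
  by rewrite integral_cst_indic// mul1e; exact: ball_measure_fin.
move=> le1; pose c := CN^-1 * rad n0 `^ lam / (CN * 2 `^ lam * 2 `^ (- n0%:~R * (lam - Q))).
have c0 : 0 < c by rewrite !mulr_gt0 ?invr_gt0 ?mulr_gt0 ?powR_gt0.
apply: (nonneg_mulrn_bounded c0 If) => m; apply: le_trans le1.
rewrite (esum_fiber (fun x => x.1)); last first.
  by move=> x _; rewrite mule_ge0// lee_fin powR_ge0.
apply: (@le_trans _ _ (\sum_(i < m) c%:E)%E).
  by rewrite sumEFin sumr_const card_ord.
apply: le_trans (sum_le_esum (f := fun i : nat => n0 + i%:Z) (m := m) _ _ _); last 3 first.
- by move=> k _; apply: esum_ge0 => x _; rewrite mule_ge0// lee_fin powR_ge0.
- by move=> i k /addrI[].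
- by [].
apply: lee_sum => i _; set k := n0 + _.
have n0k : n0 <= k by rewrite lerDl.
rewrite -(@lee_pmul2l _ (CN * 2 `^ lam * 2 `^ (- n0%:~R * (lam - Q)))%:E) ?lte_fin ?mulr_gt0 ?powR_gt0//.
rewrite -EFinM mulrC divfK ?gt_eqF ?mulr_gt0 ?powR_gt0//.
apply: le_trans ((rbN.2 point _ n00).2 ess) _.
rewrite -esumZl ?lee_fin ?mulr_ge0 ?powR_ge0 ?(ltW CN0)//.
apply: (@le_trans _ _ (\esum_(x in S `&` [set x | x.1 = k]) nu (io @^-1` vball x))).
  apply: (@measure_cover_le _ _ _ (cara nu)).
  - apply: sub_countable (countable_vertices XZ Q0 mmZ rbZ).
    by apply: subset_card_le => x [[[]]].
  - exact: measurable_ball_cara.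
  - by move=> x _; rewrite vballE; exact: measurable_preimage_ball.
  move=> y /in_ball py.
  have [z kz yz] := net_dense XZ k (io y); have rk := @rad_gt0 R k.
  have zy : vball (k, z) (io y) by apply/in_vball; rewrite metric_sym/=; lra.
  exists (k, z) => //; split => //; split; first by split => //; exists y.
  split => //=; have := @le_rad R _ _ n0k => rk0.
  apply: le_lt_trans (metric_triangle _ (io y) _) _.
  by rewrite io_isometry; lra.
apply: le_esum => x [[mx _] /= xk]; apply: le_trans (nu_preimage_vball mx) _.
rewrite mule1 -EFinM lee_fin -!mulrA xk; do 2 (apply: ler_wpM2l; first by rewrite ?powR_ge0 ?ltW).
rewrite -powRD_pos// ler_powR ?ler1n//.
have : (0 : R) <= (k%:~R - n0%:~R) * (lam - Q) by rewrite mulr_ge0 ?subr_ge0 ?ler_int.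
by lra.
Qed.

Hypothesis lamQ : lam < Q.

(** A bounded part is covered by about 2^(k lam) balls of measure about 2^(-k Q), and 2^(-k (Q -
    lam)) tends to 0. *)
Lemma range_negligible : closed (range io) -> (cara mu).-negligible (range io).
Proof.
move=> cF.
pose A (i : nat) := range io `&` ball (io point) i.+1%:R.
apply: (@negligibleS _ _ _ (cara mu) (\bigcup_i A i)).
  move=> x Fx; exists (Num.trunc (mdist (io point) x)) => //; split => //.
  by apply/in_ball; rewrite truncnS_gt.
apply: negligible_bigcup => i.
have mA : measurable (A i : set TZ).
  by apply: measurableI; [exact: closed_caratheodory | exact: mball].
exists (A i); split => //; apply/eqP; rewrite eq_le outer_measure_ge0 andbT.
have [PN PN0 PNE] : exists2 PN : R, 0 < PN & packing_const lam CN = PN.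
  by exists (packing_const lam CN) => //; exact: packing_const_gt0 lam0 rbN.
set r : R := i.+1%:R; have r0 : 0 < r by rewrite ltr0n.
have [B B0 BE] : exists2 B : R, 0 < B & B = PN * (2 * (2 * r)) `^ lam * CZ.
  by eexists; last reflexivity; rewrite !mulr_gt0 ?powR_gt0 ?mulr_gt0.
have bound (k : nat) : rad k%:Z <= r -> (mu (A i) <= (B * rad k%:Z `^ (Q - lam))%:E)%E.
  move=> kr; have rk := @rad_gt0 R k%:Z.
  pose S := vertices XN `&` [set v | v.1 = k%:Z /\ mdist (io point) (io v.2) < 2 * r].
  apply: (@le_trans _ _ (\esum_(v in S) mu (ball (io v.2) (rad k%:Z)))).
    apply: (@measure_cover_le _ _ _ (cara mu)) => //.
    - apply: sub_countable (countable_vertices XN lam0 mmN rbN).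
      by apply: subset_card_le => x [].
    - move=> x [[y _ <-] /in_ball py].
      have [z kz yz] := net_dense XN k%:Z y.
      exists (k%:Z, z) => /=; last first.
        by apply/in_ball; rewrite io_isometry metric_sym; lra.
      split => //; split => //=; apply: le_lt_trans (metric_triangle _ (io y) _) _.
      by rewrite (io_isometry y); lra.
  apply: (@le_trans _ _ ((PN * (2 * (2 * r) / rad k%:Z) `^ lam)%:E *
      (CZ * rad k%:Z `^ Q)%:E)%E).
    apply: esum_le_count.
    - by rewrite lee_fin mulr_ge0 ?powR_ge0 ?ltW.
    - by rewrite -PNE; apply: (verticesN_packing XN io_isometry lam0 mmN rbN); lra.
    - by move=> v _; rewrite outer_measure_ge0; exact: (rbZ.2 _ _ rk).1.
  rewrite -EFinM lee_fin BE powR_div ?rad_ge0 ?mulr_ge0 ?(ltW r0)// powRD_pos//.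
  by rewrite le_eqVlt; apply/orP; left; apply/eqP; ring.
have ld : 0 < Q - lam by rewrite subr_gt0.
apply/lee_addgt0Pr => e e0; rewrite add0e.
pose t := Num.min r ((e / B) `^ (Q - lam)^-1).
have t0 : 0 < t by rewrite lt_min r0 powR_gt0// divr_gt0.
have [j /andP[jt _]] := exists_rad t0.
have kt : rad `|j|%N%:Z <= t by apply: le_trans jt; apply: le_rad; rewrite lez_abs.
apply: le_trans (bound `|j|%N _) _; first by apply: le_trans kt _; rewrite ge_min lexx.
rewrite lee_fin -ler_pdivlMl// mulrC.
apply: (@le_trans _ _ (((e / B) `^ (Q - lam)^-1) `^ (Q - lam))).
  apply: ge0_ler_powR; rewrite ?nnegrE ?(ltW ld) ?rad_ge0 ?powR_ge0//.
  by apply: le_trans kt _; rewrite ge_min lexx orbT.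
by rewrite -powRrM mulVf ?gt_eqF// powRr1// divr_ge0 ?ltW.
Qed.

(** The inner sum is a discrete form of the weight d(w)^(-ep), where d is the distance to the
    subset, with the levels coarser than n - k0 cut off. Level k contributes about 2^(k (ep + lam -
    Q)) to the integral, which is summable since ep < Q - lam. *)
Lemma weight_integral (ep : R) (k0 : nat) : 0 < ep -> ep < Q - lam ->
  exists2 K : R, 0 <= K & forall (z : Z) (n : int),
  (\int[cara mu]_w ((\1_(ball z (4 * rad n)) w)%:E *
     \esum_(v in vertices XN `&` [set v | (n - k0%:Z <= v.1)%R])
       ((2 `^ (v.1%:~R * ep))%:E * (\1_(ball (io v.2) (3 * rad v.1)) w)%:E))
   <= (K * 2 `^ (n%:~R * (ep - Q)))%:E)%E.
Proof.
move=> ep0 epQ; have [PN PN0 PNE] : exists2 PN : R, 0 < PN & PN = packing_const lam CN * 16 `^ lam.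
  by eexists; last reflexivity; rewrite mulr_gt0 ?powR_gt0// (packing_const_gt0 lam0 rbN).
have geo0 : 0 <= (1 - 2 `^ (- (Q - ep - lam)) : R)^-1.
  rewrite invr_ge0 subr_ge0 -[leRHS](powRr0 2) ler_powR ?ler1n// oppr_le0.
  by apply: ltW; lra.
have [K1 K10 K1E] : exists2 K1 : R, 0 < K1 & K1 = CZ * 3 `^ Q.
  by eexists; last reflexivity; rewrite mulr_gt0 ?powR_gt0.
exists (K1 * 2 `^ (- k0%:R * (ep - Q)) * (PN * (1 - 2 `^ (- (Q - ep - lam)))^-1)).
  by rewrite !mulr_ge0 ?powR_ge0 ?(ltW K10) ?(ltW PN0).
move=> z n; set m : int := n - k0%:Z; set B := ball z _.
have rn := @rad_gt0 R n.
have nm : rad n <= rad m :> R by apply: le_rad; rewrite gerBl.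
pose S := vertices XN `&` [set v | m <= v.1 /\ mdist z (io v.2) < 4 * rad n + 3 * rad v.1].
pose f (v : int * N) (w : Z) : \bar R := ((2 `^ (v.1%:~R * ep))%:E * (\1_(ball (io v.2) (3 * rad v.1)) w)%:E)%E.
have f0 v w : (0 <= f v w)%E by rewrite mule_ge0 ?lee_fin ?powR_ge0.
have mf v : measurable_fun [set: TZ] (f v).
  apply: emeasurable_funM; first exact: measurable_cst.
  by apply/measurable_EFinP; apply: measurable_indic; exact: mball.
have cS : countable S.
  apply: sub_countable (countable_vertices XN lam0 mmN rbN).
  by apply: subset_card_le => x [].
apply: (@le_trans _ _ (\int[cara mu]_w (\esum_(v in S) f v w))%E).
  apply: le_integral_nonmeasurable => w.
    by rewrite mule_ge0 ?lee_fin//; apply: esum_ge0 => v _; exact: f0.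
  have [/in_ball Bw|Bw] := pselect (B w); last first.
    by rewrite (indic_notin Bw) mul0e; apply: esum_ge0 => v _.
  rewrite indic_in ?mul1e; last exact/in_ball.
  rewrite esum_mkcond [leRHS]esum_mkcond; apply: le_esum => v _.
  case: ifPn => [/set_mem [Vv mv]|_]; last by case: ifP.
  have [/in_ball vw|vw] := pselect (ball (io v.2) (3 * rad v.1) w).
    rewrite mem_set//; split => //; split => //.
    apply: le_lt_trans (metric_triangle _ w _) _; rewrite (metric_sym w); exact: ltrD.
  by rewrite (indic_notin vw) mule0; case: ifP.
rewrite (integral_esum (cara mu) cS); last 2 first.
- by move=> v _; exact: mf.
- by move=> v w _.
apply: (@le_trans _ _ (\esum_(v in S) ((K1 * 2 `^ (m%:~R * (ep - Q)))%:E *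
   (2 `^ (- (v.1 - m)%:~R * (Q - ep)))%:E))%E).
  apply: le_esum => v _; rewrite /f (integral_cst_indic _ (mball _ _)) ?lee_fin ?powR_ge0//.
  have rv : 0 < 3 * rad v.1 :> R by rewrite mulr_gt0 ?rad_gt0.
  apply: le_trans (lee_wpmul2l _ (rbZ.2 (io v.2) _ rv).1) _; first by rewrite lee_fin powR_ge0.
  rewrite -!EFinM lee_fin powRM ?rad_ge0// rad_powR K1E mulrCA.
  have E : 2 `^ (v.1%:~R * ep) * 2 `^ (- v.1%:~R * Q) =
      2 `^ (m%:~R * (ep - Q)) * 2 `^ (- (v.1 - m)%:~R * (Q - ep)) :> R.
    by rewrite -!powRD_pos// intrB; congr (_ `^ _); ring.
  by rewrite -[leRHS]mulrA -E le_eqVlt; apply/orP; left; apply/eqP; ring.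
rewrite esumZl ?lee_fin ?mulr_ge0 ?powR_ge0 ?(ltW K10)//.
apply: (@le_trans _ _ ((K1 * 2 `^ (m%:~R * (ep - Q)))%:E *
   (PN * (1 - 2 `^ (- (Q - ep - lam)))^-1)%:E)%E); last first.
  rewrite -EFinM lee_fin /m intrB -[k0%:Z%:~R]/(k0%:R) (_ : (_ - _) * _ = - k0%:R * (ep - Q) + n%:~R * (ep - Q)); last by ring.
  by rewrite powRD_pos// le_eqVlt; apply/orP; left; apply/eqP; ring.
apply: lee_wpmul2l; first by rewrite lee_fin mulr_ge0 ?powR_ge0 ?ltW.
apply: esum_level_decay => //; [by lra | exact: ltW | by move=> v [_ []] |].
move=> k mk; have rk := @rad_gt0 R k; have km := @le_rad R _ _ mk.
apply: (@le_trans _ _ (packing_const lam CN * (2 * (8 * rad m) / rad k) `^ lam)%:E).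
  apply: le_trans (verticesN_packing XN io_isometry lam0 mmN rbN z _); last by lra.
  apply: subset_le_esum => // v [[Vv [_ vz]] /= vk]; split => //; split => //.
  by apply: lt_le_trans vz _; rewrite vk; lra.
rewrite lee_fin PNE (_ : 2 * (8 * rad m) = 16 * rad m); last by ring.
rewrite powR_div ?mulr_ge0 ?rad_ge0// powRM ?rad_ge0// !rad_powR -!mulrA -powRD_pos//.
by rewrite intrB [X in _ <= _ * (_ * 2 `^ X)](_ : _ = - m%:~R * lam + - k%:~R * - lam)//; ring.
Qed.

End embedded_dimension.

(** * Telescoping along vertices converging to the subset *)

Section telescoping.
Context {R : realType} {Z N : pmetricType R}.
Context (XZ : @hyperbolic_filling R Z) (io : N -> Z) (sel : int -> N -> Z).
Hypothesis sel_vertex : forall n t, vertices XZ (n, sel n t).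
Hypothesis sel_near : forall n t, mdist (io t) (sel n t) < rad n / 2.

(** Telescoping sees a function only through such a bound. Real and imaginary parts share the
    oscillation of the complex function as [D], and the zero function admits every nonnegative
    [D]. *)
Definition dominates (u : int * Z -> R) (D : int * Z -> \bar R) : Prop :=
  (forall v, 0 <= D v)%E /\
  forall v w, vertices XZ v -> vertices XZ w -> v.1 <= w.1 <= v.1 + 1 ->
    vball v `&` vball w !=set0 -> ((`|u w - u v|)%:E <= D v)%E.

Lemma sel_vball n t : vball (n, sel n t) (io t).
Proof.
apply/in_vball; rewrite metric_sym; apply: lt_trans (sel_near n t) _.
by have := @rad_gt0 R n; lra.
Qed.

(** All vertices over t enter, not only the selected chain; so the sum bounds every chain and can be
    integrated in t vertex by vertex. *)
Definition osc_sum (D : int * Z -> \bar R) (n : int) (t : N) : \bar R :=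
  (\esum_(x in meeting XZ io `&` [set x | (n <= x.1)%R])
    (D x * (\1_(vball x) (io t))%:E))%E.

Lemma osc_sum_ge0 D n t : (forall v, 0 <= D v)%E -> (0 <= osc_sum D n t)%E.
Proof. by move=> D0; apply: esum_ge0 => x _; rewrite mule_ge0// lee_fin. Qed.

Variables (u : int * Z -> R) (D : int * Z -> \bar R).
Hypothesis uD : dominates u D.
Let D0 : (forall v, 0 <= D v)%E. Proof. exact: uD.1. Qed.

Let sv n t : int * Z := (n, sel n t).

Lemma telescope v t (m : nat) : vertices XZ v -> vball v (io t) ->
  ((`|u (sv (v.1 + m%:Z)%R t) - u v|)%:E <=
   D v + \sum_(i < m) D (sv (v.1 + i%:Z)%R t))%E.
Proof.
move=> Vv vt; elim: m => [|m IH].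
  rewrite big_ord0 adde0; apply: uD.2 => //=; first exact: sel_vertex.
    by rewrite addr0 lexx lerDl.
  by exists (io t); split => //; exact: sel_vball.
set w' := (X in u X); set w := (sv (v.1 + m%:Z)%R t) in IH *.
rewrite big_ord_recr/= addeA.
apply: (@le_trans _ _ ((`|u w - u v|)%:E + (`|u w' - u w|)%:E)%E).
  by rewrite -EFinD lee_fin [leRHS]addrC; exact: ler_distD.
apply: leeD IH _; apply: uD.2; rewrite /w' /w /sv/=; try exact: sel_vertex.
  by rewrite intS [1 + _]addrC addrA lexx lerDl.
by exists (io t); split; exact: sel_vball.
Qed.

Lemma meeting_sel n t : meeting XZ io (n, sel n t).
Proof. by split; [exact: sel_vertex | exists t; exact: sel_vball]. Qed.

Lemma sum_sel_le n (m : nat) t :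
  (\sum_(i < m) D (sv (n + i%:Z)%R t) <= osc_sum D n t)%E.
Proof.
have -> : (\sum_(i < m) D (sv (n + i%:Z)%R t) =
    \sum_(i < m) (fun x => D x * (\1_(vball x) (io t))%:E)
       ((fun i : nat => (sv (n + i%:Z)%R t)) i))%E.
  by apply: eq_bigr => i _; rewrite indic_in ?mule1//; exact: sel_vball.
apply: (@sum_le_esum _ _ _ (fun x => D x * (\1_(vball x) (io t))%:E)%E
  (fun i : nat => sv (n + i%:Z)%R t) m) => /=.
- by move=> x _; rewrite mule_ge0// lee_fin.
- by move=> i j [] /addrI[].
- by move=> i _; split; [exact: meeting_sel | rewrite /= lerDl].
Qed.

(** The jump from [v] to the selected chain and the chain itself are bounded by the same sum, whence
    the factor 2. *)
Lemma telescope_osc_sum v t (k : int) : vertices XZ v -> vball v (io t) ->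
  v.1 <= k -> ((`|u (sv k t) - u v|)%:E <= 2%:E * osc_sum D v.1 t)%E.
Proof.
move=> Vv vt vk; have [m kE] : exists m : nat, k = v.1 + m%:Z.
  by exists `|k - v.1|%N; rewrite gez0_abs ?subr_ge0// [RHS]addrC subrK.
rewrite kE; apply: le_trans (telescope m Vv vt) _.
rewrite (_ : 2 = 1 + 1)// EFinD ge0_muleDl// mul1e.
apply: leeD; last exact: sum_sel_le.
have mv : (meeting XZ io `&` [set x | (v.1 <= x.1)%R]) v by split; [split => //; exists t | exact: lexx].
apply: (@le_trans _ _ (D v * (\1_(vball v) (io t))%:E)%E); first by rewrite indic_in// mule1.
apply: (ge_esum_term (a := fun x => D x * (\1_(vball x) (io t))%:E)%E) mv => x _.
by rewrite mule_ge0// lee_fin.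
Qed.

Lemma telescope_cvg t : (osc_sum D 0 t < +oo)%E ->
  cvgn (fun k : nat => u (sv k%:Z t)).
Proof.
move=> fin; pose T (k : nat) := u (sv k%:Z t).
pose d (k : nat) := D (sv k%:Z t).
have dsum m : (\sum_(i < m) d i <= osc_sum D 0 t)%E.
  apply: le_trans (sum_sel_le 0 m t); rewrite le_eqVlt; apply/orP; left.
  by apply/eqP; apply: eq_bigr => i _; rewrite add0r.
have dfin k : d k \is a fin_num.
  rewrite ge0_fin_numE ?D0//; apply: le_lt_trans fin; apply: le_trans (dsum k.+1).
  by rewrite big_ord_recr/= leeDr// sume_ge0// => i _; exact: D0.
have step k : `|T k.+1 - T k| <= fine (d k).
  rewrite -lee_fin fineK//; apply: uD.2; rewrite /=; try exact: sel_vertex.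
    by rewrite -addn1 PoszD lexx lerDl.
  by exists (io t); split; exact: sel_vball.
have cv : cvgn (series (fun k => T k.+1 - T k)).
  apply: normed_cvg; apply: nondecreasing_is_cvgn.
    by apply: nondecreasing_series => i _ _ /=.
  exists (fine (osc_sum D 0 t)) => _ [m _ <-].
  rewrite -lee_fin fineK ?ge0_fin_numE ?osc_sum_ge0//.
  apply: le_trans (dsum m); rewrite /series/= -sumEFin big_mkord.
  by apply: lee_sum => i _; rewrite -[leRHS]fineK// lee_fin step.
have -> : (fun k : nat => u (sv k%:Z t)) =
    (fun k => series (fun k => T k.+1 - T k) k + T 0%N).
  by apply/funext => k; rewrite /series/= telescope_sumr// subrK.
by apply: is_cvgD => //; exact: is_cvg_cst.
Qed.

Lemma telescope_limit v t l : vertices XZ v -> vball v (io t) ->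
  u (sv k%:Z t) @[k --> \oo] --> l ->
  ((`|l - u v|)%:E <= 2%:E * osc_sum D v.1 t)%E.
Proof.
move=> Vv vt cl; apply/lee_addgt0Pr => e e0.
have [k [kv ke]] : exists k : nat, v.1 <= k%:Z /\ `|l - u (sv k%:Z t)| <= e.
  move/cvgrPdist_le : cl => /(_ e e0)[n _ nP].
  exists (maxn n `|v.1|%N); split; last by apply: nP => /=; exact: leq_maxl.
  by apply: (@le_trans _ _ `|v.1|%N%:Z); [rewrite lez_abs | rewrite lez_nat leq_maxr].
apply: (@le_trans _ _ ((`|u (sv k%:Z t) - u v|)%:E + e%:E)%E).
  rewrite -EFinD lee_fin -[l - u v](subrKA (u (sv k%:Z t))) addrC.
  by apply: le_trans (ler_normD _ _) _; rewrite lerD2l.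
by apply: leeD => //; exact: telescope_osc_sum.
Qed.

End telescoping.

(** * Means of oscillation sums over balls of the subset *)

Section oscillation_tails.
Context {R : realType} {Z N : pmetricType R}.
Context (mu : {outer_measure set Z -> \bar R}) (nu : {outer_measure set N -> \bar R}).
Context (XZ : @hyperbolic_filling R Z) (XN : @hyperbolic_filling R N).
Context (Q lam CZ CN : R) (io : N -> Z).
Hypothesis io_isometry : forall x y, mdist (io x) (io y) = mdist x y.
Hypothesis (Q0 : 0 < Q) (lam0 : 0 < lam).
Hypothesis (mmZ : metric_measure_space mu) (mmN : metric_measure_space nu).
Hypothesis (rbZ : regular_bounds mu Q CZ) (rbN : regular_bounds nu lam CN).
Let TZ := caratheodory_type mu.
Let TN := caratheodory_type nu.
Let CN0 : 0 < CN. Proof. by apply: lt_le_trans rbN.1. Qed.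

Definition tail_rel (y : int * N) (x : int * Z) : Prop :=
  y.1 <= x.1 /\ mdist (io y.2) x.2 < rad y.1 + rad x.1.

(** Up to a constant, a bound for the mean of [osc_sum] over the ball of y: the ball of x covers at
    most about the fraction 2^(-(x.1 - y.1) lam) of it. *)
Definition osc_tail (D : int * Z -> \bar R) (y : int * N) : \bar R :=
  (\esum_(x in meeting XZ io `&` tail_rel y) ((2 `^ (- (x.1 - y.1)%:~R * lam))%:E * D x))%E.

Let cS (P : set (int * Z)) : countable (meeting XZ io `&` P).
Proof.
apply: sub_countable (countable_vertices XZ Q0 mmZ rbZ).
by apply: subset_card_le => x [[]].
Qed.

Let mterm (D : int * Z -> \bar R) (x : int * Z) : (forall v, 0 <= D v)%E ->
  measurable_fun [set: TN] (fun t : TN => (D x * (\1_(vball x) (io t))%:E)%E).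
Proof.
move=> D0; apply: emeasurable_funM; first exact: measurable_cst.
apply/measurable_EFinP; apply: (measurable_indic (_ : measurable (io @^-1` vball x : set TN))).
by rewrite vballE; exact: measurable_preimage_ball.
Qed.

Lemma measurable_osc_sum D n : (forall v, 0 <= D v)%E ->
  measurable_fun [set: TN] (osc_sum XZ io D n : TN -> \bar R).
Proof.
move=> D0; apply: (measurable_esum (@cS _)) => [x _|x t _]; first exact: mterm.
by rewrite mule_ge0// lee_fin.
Qed.

Lemma integral_osc_sum D (y : int * N) : (forall v, 0 <= D v)%E ->
  (\int[cara nu]_t (osc_sum XZ io D y.1 t * (\1_(ball y.2 (rad y.1)) t)%:E) <=
   (CN * 2 `^ lam * 2 `^ (- y.1%:~R * lam))%:E * osc_tail D y)%E.
Proof.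
move=> D0; pose S := meeting XZ io `&` tail_rel y.
apply: (@le_trans _ _ (\int[cara nu]_t \esum_(x in S) (D x * (\1_(vball x) (io t))%:E))%E).
  apply: le_integral_nonmeasurable => t.
    by rewrite mule_ge0 ?osc_sum_ge0// lee_fin.
  have [yt|yt] := pselect (ball y.2 (rad y.1) t); last first.
    by rewrite (indic_notin yt) mule0; apply: esum_ge0 => x _; rewrite mule_ge0// lee_fin.
  rewrite indic_in// mule1 /osc_sum esum_mkcond [leRHS]esum_mkcond; apply: le_esum => x _.
  case: ifPn => [/set_mem [mx yx]|_]; last first.
    by case: ifP => // _; rewrite mule_ge0// lee_fin.
  have [xt|xt] := pselect (vball x (io t)); last first.
    by rewrite (indic_notin xt) mule0; case: ifP.
  rewrite mem_set//; split => //; split => //.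
  move/in_ball : yt => yt; move/in_vball : xt => xt.
  apply: le_lt_trans (metric_triangle _ (io t) _) _.
  by rewrite io_isometry (metric_sym (io t)); exact: ltrD.
rewrite (integral_esum (cara nu) (@cS _)); last 2 first.
- by move=> x _; exact: mterm.
- by move=> x t _; rewrite mule_ge0// lee_fin.
rewrite -esumZl ?lee_fin ?mulr_ge0 ?powR_ge0 ?(ltW CN0)//; last first.
  by move=> x _; rewrite mule_ge0// lee_fin powR_ge0.
apply: le_esum => x [mx _].
have mxb : measurable (io @^-1` vball x : set TN).
  by rewrite vballE; exact: measurable_preimage_ball.
rewrite (_ : (\int[cara nu]_t _)%E = (D x * nu (io @^-1` vball x))%E); last first.
  exact: (integral_cst_indic (cara nu) mxb).
apply: (@le_trans _ _ (D x * (CN * 2 `^ lam * 2 `^ (- x.1%:~R * lam))%:E)%E).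
  by apply: lee_wpmul2l; [exact: D0 | exact: (nu_preimage_vball io_isometry rbN mx)].
rewrite muleC muleA -EFinM; apply: lee_wpmul2r => //.
rewrite lee_fin -[leRHS]mulrA -powRD_pos//; apply: ler_wpM2l.
  by rewrite mulr_ge0 ?powR_ge0 ?ltW.
by rewrite le_eqVlt; apply/orP; left; apply/eqP; congr (_ `^ _); rewrite intrB; ring.
Qed.

(** In the Schur test the decay of the tail and the growth of the number of vertices both have rate
    [lam]. The tails are taken c levels coarser than y, where their balls also cover the neighbours
    of y. *)
Lemma schur_osc_tail (p ta : R) (c : nat) : 0 < p ->
  0 < lam * p - lam * Num.max 0 (p - 1) + ta ->
  exists2 K : R, 0 <= K & forall D : int * Z -> \bar R, (forall x, 0 <= D x)%E ->
  (\esum_(y in vertices XN) ((2 `^ ((y.1 - c%:Z)%:~R * ta))%:E *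
      osc_tail D ((y.1 - c%:Z)%R, y.2) `^ p) <=
   K%:E * \esum_(x in meeting XZ io) ((2 `^ (x.1%:~R * ta))%:E * D x `^ p))%E.
Proof.
move=> p0 cond.
have M0 := meeting_const_ge0 Q0 lam0 rbZ rbN; have P0 := packing_const_gt0 lam0 rbN.
pose A := meeting_const Q lam CZ CN * 2 `^ lam.
pose B := packing_const lam CN * (2 * (2 * 2 ^+ c)) `^ lam.
have A0 : 0 <= A by exact: mulr_ge0 M0 (powR_ge0 _ _).
have B0 : 0 <= B by exact: mulr_ge0 (ltW P0) (powR_ge0 _ _).
apply: (@schur_levels _ _ _ (meeting XZ io) (vertices XN) (fun x => x.1)
  (fun y => y.1 - c%:Z) (fun y => tail_rel (y.1 - c%:Z, y.2)) lam lam ta p (A + B)) => //.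
- exact: addr_ge0.
- by move=> y x _ _ [].
- move=> y k _ /=; set m := _ - _ => mk.
  apply: (@le_trans _ _ (meeting_const Q lam CZ CN * (2 * rad m / rad k) `^ lam)%:E).
    apply: le_trans (meeting_packing XZ XN io_isometry Q0 lam0 mmZ mmN rbZ rbN (io y.2) _).
      apply: subset_le_esum => // x [mx [[/= _ yx] xk]]; split => //; split => //.
      apply: lt_le_trans yx _; rewrite mulr_natl mulr2n lerD2l; apply: le_rad.
      by rewrite xk.
    have rk := @le_rad R _ _ mk; have := @rad_gt0 R m; lra.
  rewrite lee_fin powR_div ?mulr_ge0 ?rad_ge0// powRM ?rad_ge0// !rad_powR.
  rewrite -mulrA -powRD_pos// (_ : - m%:~R * lam + _ = (k - m)%:~R * lam); last first.
    by rewrite intrB; ring.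
  by rewrite mulrA; apply: ler_wpM2r; rewrite ?powR_ge0// lerDl.
- move=> x k mx /=.
  have [kx|kx] := leP k x.1; last first.
    rewrite esum1 ?lee_fin ?addr_ge0// => y [_ [[/= yx _] yk]].
    by move: kx; rewrite -yk ltNge yx.
  apply: (@le_trans _ _ (packing_const lam CN * (2 * (2 * rad k) / rad (k + c%:Z)) `^ lam)%:E).
    apply: le_trans (verticesN_packing XN io_isometry lam0 mmN rbN x.2 _).
      apply: subset_le_esum => // y [Vy [[/= yx xy] yk]]; split => //; split.
        by rewrite -yk subrK.
      rewrite metric_sym; apply: lt_le_trans xy _.
      by rewrite yk mulr_natl mulr2n lerD2l; exact: le_rad.
    have := @rad_gt0 R k; have : rad (k + c%:Z) <= rad k :> R by apply: le_rad; rewrite lerDl.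
    lra.
  rewrite lee_fin (rad_add k c) (_ : _ / _ = 2 * (2 * 2 ^+ c)); last first.
    by field; rewrite gt_eqF// rad_gt0.
  by rewrite -/B lerDr.
Qed.

End oscillation_tails.

Lemma normc_Re_le {R : rcfType} (z : R[i]) : `|complex.Re z| <= Normc.normc z.
Proof. by case: z => a b /=; rewrite -sqrtr_sqr ler_sqrt ?addr_ge0 ?sqr_ge0// lerDl sqr_ge0. Qed.

Lemma normc_Im_le {R : rcfType} (z : R[i]) : `|complex.Im z| <= Normc.normc z.
Proof. by case: z => a b /=; rewrite -sqrtr_sqr ler_sqrt ?addr_ge0 ?sqr_ge0// lerDr sqr_ge0. Qed.

Lemma normc_le_ReIm {R : rcfType} (z : R[i]) :
  Normc.normc z <= `|complex.Re z| + `|complex.Im z|.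
Proof.
case: z => a b /=; rewrite -ler_sqr ?nnegrE ?sqrtr_ge0 ?addr_ge0//.
rewrite sqr_sqrtr ?addr_ge0 ?sqr_ge0// sqrrD !real_normK ?num_real// lerD2r lerDl.
by rewrite mulrn_wge0// mulr_ge0.
Qed.

Lemma int_level_succ (a b : int) : a <= b -> b <= a + 1 -> b <> a -> b = a + 1.
Proof. by lia. Qed.

(** * Edges over a point and upper bounds for the Besov norm *)

Section edge_geometry.
Context {R : realType} {M : pmetricType R} (mu : {outer_measure set M -> \bar R}).
Context (X : @hyperbolic_filling R M) (Q C : R).
Hypothesis (Q0 : 0 < Q) (mm : metric_measure_space mu) (rb : regular_bounds mu Q C).
Let T := caratheodory_type mu.

Lemma edge_near e x : edges X e -> eball e x ->
  mdist e.1.2 x < 3 * rad (elevel e) /\ mdist e.2.2 x < 3 * rad (elevel e).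
Proof.
move=> Xe ex; have [_ _ lE l12 _] := edge_levels Xe.
have [_ _ _ _ [y []]] := edges_adjacent Xe.
have r21 := @le_rad R _ _ l12; have r0 := @rad_gt0 R e.2.1.
rewrite lE => /in_vball y1 /in_vball y2.
case: ex => /in_vball ex; split; first by lra.
- apply: le_lt_trans (metric_triangle _ y _) _.
  have := metric_triangle y e.1.2 x; rewrite (metric_sym y e.1.2); lra.
- apply: le_lt_trans (metric_triangle _ y _) _.
  have := metric_triangle y e.2.2 x; rewrite (metric_sym y e.2.2); lra.
- by lra.
Qed.

(** An edge of level k over x starts at a vertex of level k within 4 rad k of x and ends at such a
    vertex of level k or k + 1; 8^Q comes from the latter, whose scale is half as large. *)
Definition edges_const : R :=
  packing_const Q C * 4 `^ Q * (packing_const Q C * 4 `^ Q + packing_const Q C * 8 `^ Q).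

Lemma edges_const_ge0 : 0 <= edges_const.
Proof.
have P0 := ltW (packing_const_gt0 Q0 rb).
have h a : 0 <= packing_const Q C * a `^ Q by exact: mulr_ge0 P0 (powR_ge0 _ _).
exact: mulr_ge0 (h 4) (addr_ge0 (h 4) (h 8)).
Qed.

Lemma edges_count (k : int) (x : M) :
  (\esum_(e in edges X `&` [set e | elevel e = k /\ eball e x]) 1 <= edges_const%:E)%E.
Proof.
have rk := @rad_gt0 R k; have P0 := ltW (packing_const_gt0 Q0 rb).
have h a : 0 <= packing_const Q C * a `^ Q by exact: mulr_ge0 P0 (powR_ge0 _ _).
pose A j := vertices X `&` [set v | v.1 = j /\ mdist x v.2 < 4 * rad k].
pose B := A k `|` A (k + 1).
have cA : (\esum_(v in A k) 1 <= (packing_const Q C * 4 `^ Q)%:E)%E.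
  have := @vertices_packing _ _ _ X _ _ Q0 mm rb k x (4 * rad k).
  by rewrite mulfK ?gt_eqF//; apply; lra.
have cB : (\esum_(v in A (k + 1)%R) 1 <= (packing_const Q C * 8 `^ Q)%:E)%E.
  have kE : rad k = 2 * rad (k + 1) :> R by rewrite (rad_add k 1).
  have := @vertices_packing _ _ _ X _ _ Q0 mm rb (k + 1) x (4 * rad k).
  rewrite [4 * rad k / _](_ : _ = 8); last by rewrite kE; field; rewrite gt_eqF ?rad_gt0.
  by apply; have := @rad_gt0 R (k + 1); lra.
apply: (@le_trans _ _ (\esum_(e in A k `*` B) 1)%E).
  apply: subset_le_esum => // e [Xe [ek ex]].
  have [V1 V2 lE l12 l21] := edge_levels Xe.
  have [e1 e2] := edge_near Xe ex; rewrite ek in e1 e2.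
  split; first by split => //=; split; [rewrite -lE | rewrite metric_sym; lra].
  have e2' : mdist x e.2.2 < 4 * rad k by rewrite metric_sym; lra.
  have [e2k|/eqP e2k] := eqVneq e.2.1 k; [left|right]; split => //; split => //=.
  by rewrite -lE ek in l12 l21; exact: int_level_succ.
rewrite -(@esum_esum _ _ _ (A k) (fun=> B) (fun _ _ => 1%E))//.
apply: (@le_trans _ _ ((packing_const Q C * 4 `^ Q)%:E *
    (packing_const Q C * 4 `^ Q + packing_const Q C * 8 `^ Q)%:E)%E); last by rewrite -EFinM.
apply: esum_le_count => //; first by rewrite lee_fin addr_ge0.
move=> v _; rewrite esum_ge0//= EFinD; apply: le_trans (leeD cA cB).
rewrite /B [leLHS]esum_mkcond [X in (_ <= X + _)%E]esum_mkcond.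
rewrite [X in (_ <= _ + X)%E]esum_mkcond -esumD//; last 2 first.
- by move=> w _; case: ifP.
- by move=> w _; case: ifP.
apply: le_esum => w _; rewrite in_setU.
by case: (w \in A k) => /=; case: (w \in _) => //=; rewrite ?adde0 ?add0e// leeDl.
Qed.

(** Converse to [osc_besov]: a point has at most [edges_const] edges of level k over it, and each is
    charged to its starting vertex, within 3 rad k of the point. The volume of the ball of radius 3
    rad k shifts the exponent by Q. *)
Lemma besov_norm_le (s p : R) : 0 < p -> exists2 K : R, 0 <= K &
  forall (g : M -> R[i]) (b : int * M -> \bar R), (forall v, 0 <= b v)%E ->
  (forall e, edges X e -> ((edge_diff mu g e)%:E <= b e.1)%E) ->
  (besov_norm mu X s p%:E p%:E g `^ p <=
   K%:E * \esum_(v in vertices X) ((2 `^ (v.1%:~R * (s * p - Q)))%:E * b v `^ p))%E.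
Proof.
move=> p0; have E0 := edges_const_ge0.
have C0 : 0 < C by apply: lt_le_trans rb.1.
have [A A0 AE] : exists2 A : R, 0 <= A & A = edges_const `^ p * (C * 3 `^ Q).
  by eexists; last reflexivity; rewrite !mulr_ge0 ?powR_ge0 ?ltW.
exists A => // g b b0 gb; rewrite besov_norm_poweR//.
rewrite -esumZl ?lee_fin//; last first.
  by move=> v _; rewrite mule_ge0 ?lee_fin ?powR_ge0 ?poweR_ge0.
rewrite (esum_fiber (S := vertices X) (fun v => v.1)); last first.
  by move=> v _; rewrite !mule_ge0 ?lee_fin ?powR_ge0 ?poweR_ge0.
apply: le_esum => k _; pose V := vertices X `&` [set v | v.1 = k].
have cV : countable V.
  apply: sub_countable (countable_vertices X Q0 mm rb).
  by apply: subset_card_le => x [].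
have r0 : 0 < 3 * rad k :> R by rewrite mulr_gt0 ?rad_gt0.
pose f v (x : M) : \bar R := (b v `^ p * (\1_(ball v.2 (3 * rad k)) x)%:E)%E.
have f0 v x : (0 <= f v x)%E by rewrite mule_ge0 ?poweR_ge0 ?lee_fin.
have mf v : measurable_fun [set: T] (f v).
  apply: emeasurable_funM; first exact: measurable_cst.
  by apply/measurable_EFinP; apply: measurable_indic; exact: measurable_ball_cara.
apply: (@le_trans _ _ ((2 `^ (k%:~R * (s * p)))%:E *
  ((edges_const `^ p)%:E * \esum_(v in V) \int[cara mu]_x f v x))%E).
  apply: lee_wpmul2l; first by rewrite lee_fin powR_ge0.
  rewrite -(integral_esum (cara mu) cV); last 2 first.
  - by move=> v _; exact: mf.
  - by move=> v x _; exact: f0.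
  rewrite -ge0_integralZl ?lee_fin ?powR_ge0//; last 2 first.
  - apply: (measurable_esum cV) => [v _|v x _]; [exact: mf|exact: f0].
  - by move=> x _; apply: esum_ge0 => v _; exact: f0.
  apply: le_integral_nonmeasurable => x; first exact: poweR_ge0.
  pose S := \esum_(v in V) f v x; have S0 : (0 <= S)%E by apply: esum_ge0.
  apply: (@le_trans _ _ ((edges_const%:E * S `^ p^-1) `^ p)%E); last first.
    by rewrite poweRM ?poweR_ge0 ?lee_fin// poweRK// poweR_EFin.
  apply: le_poweR; [exact: ltW | |].
    by apply: esum_ge0 => e _; rewrite lee_fin mulr_ge0 ?edge_diff_ge0.
  pose Sx := edges X `&` [set e | elevel e = k /\ eball e x].
  apply: (@le_trans _ _ (\esum_(e in Sx) (edge_diff mu g e)%:E)%E).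
    rewrite esum_mkcond [leRHS]esum_mkcond; apply: le_esum => e _.
    case: ifPn => [/set_mem [Xe ek]|_]; last by case: ifP; rewrite lee_fin ?edge_diff_ge0.
    have [ex|ex] := pselect (eball e x); last first.
      by rewrite indic_notin// mulr0; case: ifP; rewrite lee_fin ?edge_diff_ge0.
    by rewrite mem_set ?indic_in ?mulr1.
  apply: esum_le_count; [exact: poweR_ge0 | exact: edges_count |].
  move=> e [Xe [ek ex]]; rewrite lee_fin edge_diff_ge0/=.
  apply: le_trans (gb e Xe) _; rewrite -[leLHS](poweRVK p0)//.
  apply: le_poweR; [by rewrite invr_ge0 ltW | exact: poweR_ge0 |].
  have [e1 _] := edge_near Xe ex; have [V1 _ lE _ _] := edge_levels Xe.
  apply: (@le_trans _ _ (f e.1 x)).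
    by rewrite /f indic_in ?mule1//; apply/in_ball; rewrite -ek.
  by apply: (ge_esum_term (a := fun v => f v x)) => //; split => //=; rewrite -lE.
rewrite -!esumZl ?lee_fin ?powR_ge0//; last 2 first.
- by move=> v _; rewrite mule_ge0 ?lee_fin ?powR_ge0//; apply: integral_ge0 => x _; exact: f0.
- by move=> v _; apply: integral_ge0 => x _; exact: f0.
apply: le_esum => v [Vv vk]; rewrite /f (integral_cst_indic _ (measurable_ball_cara mm _ _)) ?poweR_ge0//.
have := (rb.2 v.2 _ r0).1; rewrite powRM ?rad_ge0// rad_powR => bound.
apply: (@le_trans _ _ ((2 `^ (k%:~R * (s * p)))%:E * ((edges_const `^ p)%:E * (b v `^ p *
    (C * (3 `^ Q * 2 `^ (- k%:~R * Q)))%:E)))%E).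
  apply: lee_wpmul2l; first by rewrite lee_fin powR_ge0.
  apply: lee_wpmul2l; first by rewrite lee_fin powR_ge0.
  by apply: lee_wpmul2l; first exact: poweR_ge0.
rewrite vk [(b v `^ p * _)%E]muleC !muleA -!EFinM AE; apply: lee_wpmul2r; first exact: poweR_ge0.
have E : 2 `^ (k%:~R * (s * p)) * 2 `^ (- k%:~R * Q) = 2 `^ (k%:~R * (s * p - Q)) :> R.
  by rewrite -powRD_pos//; congr (_ `^ _); ring.
by rewrite lee_fin -E le_eqVlt; apply/orP; left; apply/eqP; ring.
Qed.

End edge_geometry.

(** * Oscillations at the subset against the Triebel-Lizorkin norm *)

Section triebel_lower_bound.
Context {R : realType} {Z N : pmetricType R} (mu : {outer_measure set Z -> \bar R}).
Context (XZ : @hyperbolic_filling R Z) (Q lam CZ : R) (io : N -> Z).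
Hypothesis (Q0 : 0 < Q) (lam0 : 0 < lam).
Hypothesis (mmZ : metric_measure_space mu) (rbZ : regular_bounds mu Q CZ).
Hypothesis poF : porous (range io).

Lemma osc_triebel_lizorkin (s p : R) (q : \bar R) : 0 < p -> (0 < q)%E ->
  exists2 K : R, 0 <= K & forall f : Z -> R[i],
  (\esum_(x in meeting XZ io) ((2 `^ (x.1%:~R * (s * p - Q)))%:E *
      osc XZ (discretize mu f) x `^ p) <=
   K%:E * triebel_lizorkin_norm mu XZ s p q f `^ p)%E.
Proof.
move=> p0 q0; have [K K0 holes] := holes_sum XZ Q0 lam0 mmZ rbZ poF.
exists K => // f; rewrite triebel_lizorkin_norm_poweR//.
pose o x := osc XZ (discretize mu f) x.
have o0 x : (0 <= o x)%E by exact: osc_ge0.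
pose S := meeting XZ io `&` [set x | essential Z (rad x.1 : R)].
set Phi := (X in (\int[_]_x X x)%E).
apply: le_trans (holes Phi (fun x => ((2 `^ (x.1%:~R * s))%:E * o x) `^ p)%E S _ _ _ _).
- rewrite esum_mkcond [leRHS]esum_mkcond; apply: le_esum => x _.
  case: ifPn => [/set_mem mx|_]; last first.
    by case: ifP => // _; rewrite mule_ge0 ?lee_fin ?powR_ge0 ?poweR_ge0.
  have [ex|ex] := pselect (essential Z (rad x.1 : R)); last first.
    rewrite inessential_osc// poweR0r ?gt_eqF// mule0.
    by case: ifP => // _; rewrite mule_ge0 ?lee_fin ?powR_ge0 ?poweR_ge0.
  rewrite mem_set// poweRM ?lee_fin ?powR_ge0//.
  rewrite poweR_EFin muleA -EFinM -powRrM -powRD_pos// le_eqVlt; apply/orP; left; apply/eqP.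
  by congr ((_ `^ _)%:E * _)%E; ring.
- by move=> w; exact: poweR_ge0.
- by move=> x; exact: poweR_ge0.
- by move=> x [].
move=> x w _ xw; apply: le_poweR; [exact: ltW | |].
  by apply: mule_ge0; [rewrite lee_fin powR_ge0 | exact: o0].
rewrite muleC -lee_pdivlMr ?powR_gt0//.
apply: osc_le => [|e Xe le ex]; first by rewrite mule_ge0 ?lq_norm_ge0// lee_fin invr_ge0 powR_ge0.
rewrite lee_pdivlMr ?powR_gt0//.
set t := (X in lq_norm q _ X).
have te : ((Normc.normc (graph_diff (discretize mu f) e))%:E * (2 `^ (x.1%:~R * s))%:E = t e)%E.
  rewrite /t -EFinM indic_in; last by case: ex => E; [left|right]; rewrite E.
  by rewrite mulr1 le mulrC.
rewrite te; apply: (le_lq_norm_term (a := t)) => // e' _.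
by rewrite lee_fin !mulr_ge0 ?powR_ge0 ?edge_diff_ge0.
Qed.

End triebel_lower_bound.

(** Reduces local statements on an arbitrary ball to estimates at one vertex of nonpositive
    level. *)
Lemma exists_big_vertex {R : realType} {M : pmetricType R}
    (X : @hyperbolic_filling R M) (z : M) (r : R) :
  exists v, [/\ vertices X v, v.1 <= 0, r <= rad v.1 / 4 & mdist z v.2 < rad v.1 / 2].
Proof.
pose r' := 4 * Num.max r 1; have m1 : 1 <= Num.max r 1 by rewrite le_max lexx orbT.
have mr : r <= Num.max r 1 by rewrite le_max lexx.
have r'0 : 0 < r' by rewrite /r'; lra.
have [j /andP[_ jr]] := exists_rad r'0.
have nE : rad (j - 1) = 2 * rad j :> R by rewrite (rad_sub j 1).
have [x nx zx] := net_dense X (j - 1) z.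
exists (j - 1, x); split => //=; last by rewrite nE; move: jr; rewrite /r'; lra.
apply: ltW; apply: (@rad_lt_imp R); rewrite nE {1}/rad oppr0 powRr0.
by apply: le_lt_trans jr; rewrite /r'; lra.
Qed.

Section averages_bounds.
Context {R : realType} {M : pmetricType R} (mu : {outer_measure set M -> \bar R}).
Hypothesis mm : metric_measure_space mu.
Let T := caratheodory_type mu.

Lemma locint_oscillation (h : M -> R) : measurable_fun [set: T] (h : T -> R) ->
  (forall z r, exists c : R,
     (\int[cara mu]_y (`|h y - c| * \1_(ball z r) y)%:E < +oo)%E) ->
  locint mu h.
Proof.
move=> mh osc; split => // z r; have mB := measurable_ball_cara mm z r.
have [c fin] := osc z r.
have mhc : measurable_fun [set: T] (fun y : T => h y - c) by exact: measurable_funB.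
have i1 : (cara mu).-integrable (ball z r) (fun y => (h y - c)%:E).
  apply/integrableP; split; first by apply/measurable_EFinP; exact: measurable_funS mhc.
  by rewrite (integral_mulr_indic (cara mu) (fun y => `|(h y - c)%:E|%E) mB).
have i2 := (locint_cst mm c).2 z r.
apply: eq_integrable (integrableD mB i1 i2) => //= y _.
by rewrite -EFinD subrK.
Qed.

Lemma fine_ball_inv_le (Q C : R) (x : M) (r : R) : regular_bounds mu Q C -> 0 < r ->
  essential M r -> (fine (mu (ball x r)))^-1 <= C * r `^ (- Q).
Proof.
move=> rb r0 ess; have C0 : 0 < C by apply: lt_le_trans rb.1.
have := (rb.2 x r r0).2 ess; rewrite (ball_fineE mm) lee_fin => h.
have h0 : 0 < C^-1 * r `^ Q by rewrite mulr_gt0 ?invr_gt0 ?powR_gt0.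
apply: (@le_trans _ _ (C^-1 * r `^ Q)^-1); first by rewrite lef_pV2 ?posrE ?fine_ball_gt0.
by rewrite invfM invrK powRN.
Qed.

End averages_bounds.

(** * The restriction operator *)

Section restriction.
Context {R : realType} {Z N : pmetricType R}.
Context (mu : {outer_measure set Z -> \bar R}) (nu : {outer_measure set N -> \bar R}).
Context (XZ : @hyperbolic_filling R Z) (XN : @hyperbolic_filling R N).
Context (Q lam CZ CN : R) (io : N -> Z).
Hypothesis io_isometry : forall x y, mdist (io x) (io y) = mdist x y.
Hypothesis (Q0 : 0 < Q) (lam0 : 0 < lam).
Hypothesis (mmZ : metric_measure_space mu) (mmN : metric_measure_space nu).
Hypothesis (rbZ : regular_bounds mu Q CZ) (rbN : regular_bounds nu lam CN).
Let TZ := caratheodory_type mu.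
Let TN := caratheodory_type nu.
Let CN0 : 0 < CN. Proof. by apply: lt_le_trans rbN.1. Qed.
Variable sel : int -> N -> Z.
Hypothesis sel_vertex : forall n t, vertices XZ (n, sel n t).
Hypothesis sel_near : forall n t, mdist (io t) (sel n t) < rad n / 2.
Hypothesis sel_meas : forall n (g : Z -> R),
  measurable_fun [set: TN] (fun t : TN => g (sel n t)).

Definition bavg (g : Z -> R) (v : int * Z) : R := ravg mu (ball v.2 (rad v.1)) g.

(** An upper limit exists for every function and is measurable in t; [fine] sends infinite values to
    0. It is the limit wherever the averages converge. *)
Definition restr (g : Z -> R) (t : N) : R :=
  fine (limn_esup (fun k : nat => (bavg g (k%:Z, sel k%:Z t))%:E)).

Lemma measurable_restr g : measurable_fun [set: TN] (restr g : TN -> R).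
Proof.
apply: measurableT_comp => //; apply: measurable_fun_limn_esup => k.
by apply/measurable_EFinP; exact: (sel_meas k%:Z (fun x => bavg g (k%:Z, x))).
Qed.

Lemma restr_cvg g t l : bavg g (k%:Z, sel k%:Z t) @[k --> \oo] --> l -> restr g t = l.
Proof.
move=> gl; rewrite /restr.
have /cvg_limn_einf_sup[_ ->] // :
  (fun k : nat => (bavg g (k%:Z, sel k%:Z t))%:E) @ \oo --> l%:E.
by apply: cvg_EFin gl; near=> k.
Unshelve. all: by end_near. Qed.

Lemma continuous_restr g : locint mu g -> continuous g -> forall t, restr g t = g (io t).
Proof.
move=> gi cg t; apply: restr_cvg; apply/cvgrPdist_le => e e0.
have /nbhs_ballP[d /= d0 dP] : nbhs (io t) [set x | `|g (io t) - g x| <= e].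
  by have /cvgrPdist_le/(_ e e0) := cg (io t).
have d20 : 0 < d / 2 by rewrite divr_gt0.
have [j /andP[jd _]] := exists_rad d20.
exists `|j|%N => // k /= jk; rewrite distrC -lee_fin.
have kd : rad k%:Z <= d / 2.
  apply: le_trans jd; apply: le_rad; apply: (@le_trans _ _ `|j|%N%:Z) => //.
  by rewrite lez_abs.
have rk := @rad_gt0 R k%:Z.
apply: le_trans (dist_ravg_le mmZ (sel k%:Z t) (g (io t)) rk gi) _.
have mB := measurable_ball_cara mmZ (sel k%:Z t) (rad k%:Z).
rewrite -[leRHS]mule1 -(fine_ball_mulV mmZ (sel k%:Z t) rk) muleCA.
apply: lee_wpmul2l; first by rewrite lee_fin invr_ge0 ltW// fine_ball_gt0.
rewrite -(integral_cst_indic (cara mu) mB); last by rewrite lee_fin ltW.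
apply: le_integral_nonmeasurable => y; first by rewrite lee_fin mulr_ge0.
rewrite -EFinM lee_fin.
have [By|By] := pselect (ball (sel k%:Z t) (rad k%:Z) y); last by rewrite (indic_notin By) !mulr0.
apply: ler_wpM2r => //; rewrite distrC; apply: dP; apply/in_ball.
move/in_ball : By => By; apply: le_lt_trans (metric_triangle _ (sel k%:Z t) _) _.
by have := sel_near k%:Z t; lra.
Qed.

Section dominated.
Variables (g : Z -> R) (D : int * Z -> \bar R).
Hypothesis gi : locint mu g.
Hypothesis gD : dominates XZ (bavg g) D.
Hypothesis tail_fin : forall y, vertices XN y ->
  (osc_tail XZ lam io D ((y.1 - 3)%R, y.2) < +oo)%E.
Let D0 : (forall v, 0 <= D v)%E. Proof. exact: gD.1. Qed.
Let integral_osc := integral_osc_sum XZ io_isometry Q0 mmZ mmN rbZ rbN.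

Lemma le_osc_sum n m t : n <= m -> (osc_sum XZ io D m t <= osc_sum XZ io D n t)%E.
Proof.
move=> nm; apply: subset_le_esum => [x _|x [mx /= xm]].
  by rewrite mule_ge0// lee_fin.
by split => //=; exact: le_trans xm.
Qed.

(** Every ball lies in the ball of a coarse vertex, over which the sum is integrable by
    [integral_osc_sum] and the finite tail. *)
Lemma osc_sum_ae : {ae cara nu, forall t, (osc_sum XZ io D 0 t < +oo)%E}.
Proof.
pose A (i : nat) := [set t : N | ~ (ball point i.+1%:R t -> (osc_sum XZ io D 0 t < +oo)%E)].
apply: (@negligibleS _ _ _ (cara nu) (\bigcup_i A i)).
  move=> t /= nt; exists (Num.trunc (mdist (point : N) t)) => //= h; apply: nt; apply: h.
  by apply/in_ball; rewrite truncnS_gt.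
apply: negligible_bigcup => i.
have [y [Vy y0 yr py]] := exists_big_vertex XN point i.+1%:R.
have ry := @rad_gt0 R y.1.
pose f (t : TN) := (osc_sum XZ io D (y.1 - 3) t * (\1_(ball y.2 (rad (y.1 - 3))) t)%:E)%E.
have mf : measurable_fun [set: TN] f.
  apply: emeasurable_funM; first exact: (measurable_osc_sum XZ io_isometry Q0 mmZ mmN rbZ).
  by apply/measurable_EFinP; apply: measurable_indic; exact: measurable_ball_cara.
have f0 t : (0 <= f t)%E by rewrite mule_ge0 ?osc_sum_ge0// lee_fin.
have fi : (cara nu).-integrable setT f.
  apply/integrableP; split => //; under eq_integral do rewrite gee0_abs//.
  apply: le_lt_trans (integral_osc ((y.1 - 3)%R, y.2) D0) _.
  by rewrite lte_mul_pinfty ?tail_fin// lee_fin !mulr_ge0 ?powR_ge0 ?ltW.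
apply: negligibleS (integrable_ae measurableT fi) => t /= nt ft; apply: nt => /in_ball pt.
have r3 : rad y.1 <= rad (y.1 - 3) :> R by apply: le_rad; rewrite gerBl.
have Bt : ball y.2 (rad (y.1 - 3)) t.
  apply/in_ball; apply: le_lt_trans (metric_triangle _ point _) _.
  by rewrite metric_sym; lra.
have := ft I; rewrite /f (indic_in Bt) mule1 ge0_fin_numE ?osc_sum_ge0//.
by apply: le_lt_trans; apply: le_osc_sum; rewrite lerBlDr (le_trans y0).
Qed.

Lemma restr_dist t v : (osc_sum XZ io D 0 t < +oo)%E -> vertices XZ v ->
  vball v (io t) -> ((`|restr g t - bavg g v|)%:E <= 2%:E * osc_sum XZ io D v.1 t)%E.
Proof.
move=> fin Vv vt.
have /cvg_ex[l gl] := telescope_cvg sel_vertex sel_near gD fin.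
by rewrite (restr_cvg gl); exact: (telescope_limit sel_vertex sel_near gD Vv vt gl).
Qed.

(** Three levels coarser, the ball has radius 8 rad y.1 and its centre is within 4 rad y.1 of the
    image of y. So it contains the image of the ball of radius 4 rad y.1 about y, and with it the
    balls of both endpoints of an edge starting at y. *)
Let x0 (y : int * N) : int * Z := (y.1 - 3, sel (y.1 - 3) y.2).

Lemma restr_oscillation y z r : vertices XN y -> ball z r `<=` ball y.2 (4 * rad y.1) ->
  (\int[cara nu]_t (`|restr g t - bavg g (x0 y)| * \1_(ball z r) t)%:E <=
   (2 * (CN * 2 `^ lam * 2 `^ (- (y.1 - 3)%:~R * lam)))%:E *
     osc_tail XZ lam io D ((y.1 - 3)%R, y.2))%E.
Proof.
move=> Vy zy; have ry := @rad_gt0 R y.1.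
have r3 : rad (y.1 - 3) = 8 * rad y.1 :> R by rewrite (rad_sub y.1 3); congr (_ * _); ring.
rewrite (EFinM 2) -muleA.
apply: le_trans (lee_wpmul2l _ (integral_osc ((y.1 - 3)%R, y.2) D0)); last by rewrite lee_fin.
have mI : measurable_fun [set: TN]
    (fun t : TN => osc_sum XZ io D (y.1 - 3) t * (\1_(ball y.2 (rad (y.1 - 3))) t)%:E)%E.
  apply: emeasurable_funM; first exact: (measurable_osc_sum XZ io_isometry Q0 mmZ mmN rbZ).
  by apply/measurable_EFinP; apply: measurable_indic; exact: measurable_ball_cara.
have I0 t : (0 <= osc_sum XZ io D (y.1 - 3) t * (\1_(ball y.2 (rad (y.1 - 3))) t)%:E)%E.
  by rewrite mule_ge0 ?osc_sum_ge0// lee_fin.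
rewrite -ge0_integralZl//=; apply: ae_le_integral_nonmeasurable.
- by move=> t; rewrite lee_fin mulr_ge0.
- by move=> t; rewrite mule_ge0.
- by apply: emeasurable_funM => //; exact: measurable_cst.
case: osc_sum_ae => A [mA A0 sA]; exists A; split => // t /= nt; apply: sA => /= fin; apply: nt.
have [/zy/in_ball yt|zt] := pselect (ball z r t); last first.
  by rewrite (indic_notin zt) mulr0 mule_ge0.
have Bt : ball y.2 (rad (y.1 - 3)) t by apply/in_ball; rewrite r3; lra.
rewrite (indic_in Bt) mule1.
apply: (@le_trans _ _ (`|restr g t - bavg g (x0 y)|)%:E).
  by rewrite lee_fin ler_piMr// indicE; case: (_ \in _).
apply: (restr_dist (v := x0 y)) => //; first exact: sel_vertex.
apply/in_vball => /=; apply: le_lt_trans (metric_triangle _ (io y.2) _) _.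
rewrite io_isometry r3 metric_sym; have := sel_near (y.1 - 3) y.2; rewrite r3.
by move: yt; lra.
Qed.

Lemma locint_restr : locint nu (restr g).
Proof.
apply: (locint_oscillation mmN) => [|z r]; first exact: measurable_restr.
have [y [Vy y0 yr zy]] := exists_big_vertex XN z r.
have ry := @rad_gt0 R y.1.
exists (bavg g (x0 y)); apply: le_lt_trans (restr_oscillation Vy _) _.
  move=> t /in_ball zt; apply/in_ball; apply: le_lt_trans (metric_triangle _ z _) _.
  by rewrite metric_sym; lra.
by rewrite lte_mul_pinfty ?tail_fin// lee_fin !mulr_ge0 ?powR_ge0 ?ltW.
Qed.

(** The exponent 4 lam collects the three levels down to the coarse vertex and the one level by
    which an edge may rise. *)
Definition restr_const : R := 2 * (CN * 2 `^ lam) * CN * 2 `^ (4 * lam).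

(** With w running over both endpoints of an edge, the two averages are compared with the same
    coarse one. *)
Lemma bavg_restr_dist y w : vertices XN y -> essential N (rad y.1 : R) ->
  y.1 <= w.1 -> w.1 <= y.1 + 1 -> mdist y.2 w.2 < 3 * rad y.1 ->
  ((`|ravg nu (ball w.2 (rad w.1)) (restr g) - bavg g (x0 y)|)%:E <=
    restr_const%:E * osc_tail XZ lam io D ((y.1 - 3)%R, y.2))%E.
Proof.
move=> Vy ess yw wy yw2; have rw := @rad_gt0 R w.1; have rwy := @le_rad R _ _ yw.
apply: le_trans (dist_ravg_le mmN w.2 _ rw locint_restr) _.
have tl0 : (0 <= osc_tail XZ lam io D ((y.1 - 3)%R, y.2))%E.
  by apply: esum_ge0 => x _; rewrite mule_ge0// lee_fin powR_ge0.
have zy : ball w.2 (rad w.1) `<=` ball y.2 (4 * rad y.1).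
  move=> t /in_ball wt; apply/in_ball; apply: le_lt_trans (metric_triangle _ w.2 _) _.
  by lra.
apply: le_trans (lee_wpmul2l _ (restr_oscillation Vy zy)) _.
  by rewrite lee_fin invr_ge0 ltW// fine_ball_gt0.
rewrite muleA -EFinM; apply: lee_wpmul2r => //; rewrite lee_fin.
have inv := fine_ball_inv_le mmN w.2 rbN rw (essential_le rwy ess).
apply: (@le_trans _ _ (CN * rad w.1 `^ (- lam) * (2 * (CN * 2 `^ lam * 2 `^ (- (y.1 - 3)%:~R * lam))))).
  by apply: ler_wpM2r inv; rewrite !mulr_ge0 ?powR_ge0 ?ltW.
have h : rad w.1 `^ (- lam) * 2 `^ (- (y.1 - 3)%:~R * lam) <= 2 `^ (4 * lam) :> R.
  rewrite rad_powR -powRD_pos// ler_powR ?ler1n// intrB.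
  have : (w.1%:~R : R) <= (y.1 + 1)%:~R by rewrite ler_int.
  rewrite intrD => h; rewrite -subr_ge0.
  rewrite (_ : _ - _ = (y.1%:~R + 1 - w.1%:~R) * lam); last by ring.
  by rewrite mulr_ge0 ?subr_ge0 ?(ltW lam0).
rewrite /restr_const (_ : CN * _ * (2 * _) = 2 * (CN * 2 `^ lam) * CN *
  (rad w.1 `^ (- lam) * 2 `^ (- (y.1 - 3)%:~R * lam))); last by ring.
by apply: ler_wpM2l h; rewrite !mulr_ge0 ?powR_ge0 ?ltW.
Qed.

End dominated.

End restriction.

Section power_finiteness.
Context {R : realType}.
Local Open Scope ereal_scope.

Lemma poweR_lty_inv (x : \bar R) (p : R) : (0 < p)%R -> x `^ p < +oo -> x < +oo.
Proof. by move=> p0; case: x => [r _|h|_]; rewrite ?ltry//; rewrite poweRyr ?gt_eqF in h. Qed.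

Lemma le_poweR_scale (x y : \bar R) (K p : R) : (0 < p)%R -> (0 <= K)%R ->
  0 <= x -> 0 <= y -> x `^ p <= K%:E * y `^ p -> x <= (K `^ p^-1)%:E * y.
Proof.
move=> p0 K0 x0 y0 h; rewrite -(poweRVK p0 x0) -[X in _ * X](poweRVK p0 y0).
rewrite -poweR_EFin -poweRM ?lee_fin ?poweR_ge0//.
by apply: le_poweR; rewrite ?invr_ge0 ?(ltW p0) ?poweR_ge0.
Qed.

End power_finiteness.

Lemma lty_esum_term {R : realType} (I : choiceType) (S : set I) (c : I -> R) (x : I -> \bar R)
    (p : R) i : 0 < p -> (forall j, 0 < c j) -> (forall j, 0 <= x j)%E ->
  (\esum_(j in S) ((c j)%:E * x j `^ p) < +oo)%E -> S i -> (x i < +oo)%E.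
Proof.
move=> p0 c0 x0 fin Si; apply: (poweR_lty_inv p0).
have term0 j : (0 <= (c j)%:E * x j `^ p)%E by rewrite mule_ge0 ?lee_fin ?poweR_ge0// ltW.
have := le_lt_trans (ge_esum_term (a := fun j => ((c j)%:E * x j `^ p)%E) (fun j _ => term0 j) Si) fin.
by case: (x i `^ p)%E => [r _||]; rewrite ?ltry// gt0_muley// lte_fin.
Qed.

Lemma dist_le_double {R : realType} (a b x r : R) :
  `|a - x| <= r -> `|b - x| <= r -> `|b - a| <= 2 * r.
Proof.
by move=> ax bx; apply: le_trans (ler_distD x _ _) _; rewrite (distrC x); lra.
Qed.

Lemma ae_imp {R : realType} d (T : measurableType d) (m : {measure set T -> \bar R})
    (P P' : T -> Prop) : (forall x, P x -> P' x) ->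
  {ae m, forall x, P x} -> {ae m, forall x, P' x}.
Proof.
move=> PP' [A [mA A0 sA]]; exists A; split => // x /= nx; apply: sA => /= Px.
exact/nx/PP'.
Qed.

Lemma ae_and {R : realType} d (T : measurableType d) (m : {measure set T -> \bar R})
    (P P' : T -> Prop) : {ae m, forall x, P x} -> {ae m, forall x, P' x} ->
  {ae m, forall x, P x /\ P' x}.
Proof.
move=> h h'; apply: negligibleS (negligibleU h h') => x /= nx.
by have [Px|] := pselect (P x); [right => Px'; apply: nx | left].
Qed.

Section real_parts.
Context {R : realType} {M : pmetricType R} (mu : {outer_measure set M -> \bar R}).
Context (X : @hyperbolic_filling R M).

Lemma dominates_Re f : dominates X (bavg mu (fun y => complex.Re (f y)))
  (osc X (discretize mu f)).
Proof.
split=> [v|v w Vv Vw vw m]; first exact: osc_ge0.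
apply: le_trans (adjacent_le_osc _ Vv Vw vw m); rewrite lee_fin.
rewrite (_ : _ - _ = complex.Re (discretize mu f w - discretize mu f v)).
  exact: normc_Re_le.
by rewrite /discretize !averageE !vballE.
Qed.

Lemma dominates_Im f : dominates X (bavg mu (fun y => complex.Im (f y)))
  (osc X (discretize mu f)).
Proof.
split=> [v|v w Vv Vw vw m]; first exact: osc_ge0.
apply: le_trans (adjacent_le_osc _ Vv Vw vw m); rewrite lee_fin.
rewrite (_ : _ - _ = complex.Im (discretize mu f w - discretize mu f v)).
  exact: normc_Im_le.
by rewrite /discretize !averageE !vballE.
Qed.

Lemma edge_diff_le_bavg f e (c d : R) (r : R) :
  `|bavg mu (fun y => complex.Re (f y)) e.1 - c| <= r ->
  `|bavg mu (fun y => complex.Re (f y)) e.2 - c| <= r ->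
  `|bavg mu (fun y => complex.Im (f y)) e.1 - d| <= r ->
  `|bavg mu (fun y => complex.Im (f y)) e.2 - d| <= r ->
  edge_diff mu f e <= 4 * r.
Proof.
move=> h1 h2 h3 h4; apply: le_trans (normc_le_ReIm _) _.
rewrite /graph_diff /discretize !averageE !vballE/= -/(bavg mu _ e.2) -/(bavg mu _ e.1).
rewrite -/(bavg mu _ e.2) -/(bavg mu _ e.1).
apply: le_trans (lerD (dist_le_double h1 h2) (dist_le_double h3 h4)) _.
by rewrite -mulrDl -natrD.
Qed.

End real_parts.

(** * Boundedness of the restriction *)

Section restriction_operator.
Context {R : realType} {Z N : pmetricType R}.
Context (mu : {outer_measure set Z -> \bar R}) (nu : {outer_measure set N -> \bar R}).
Context (XZ : @hyperbolic_filling R Z) (XN : @hyperbolic_filling R N).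
Context (Q lam CZ CN : R) (io : N -> Z).
Hypothesis io_isometry : forall x y, mdist (io x) (io y) = mdist x y.
Hypothesis (Q0 : 0 < Q) (lam0 : 0 < lam).
Hypothesis (mmZ : metric_measure_space mu) (mmN : metric_measure_space nu).
Hypothesis (rbZ : regular_bounds mu Q CZ) (rbN : regular_bounds nu lam CN).
Let TZ := caratheodory_type mu.
Let TN := caratheodory_type nu.
Let CN0 : 0 < CN. Proof. by apply: lt_le_trans rbN.1. Qed.
Variable sel : int -> N -> Z.
Hypothesis sel_vertex : forall n t, vertices XZ (n, sel n t).
Hypothesis sel_near : forall n t, mdist (io t) (sel n t) < rad n / 2.
Hypothesis sel_meas : forall n (g : Z -> R),
  measurable_fun [set: TN] (fun t : TN => g (sel n t)).
Hypothesis poF : porous (range io).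
Variables (s p : R) (q : \bar R).
Hypothesis (p0 : 0 < p) (q0 : (0 < q)%E).
Hypothesis cond : 0 < lam * p - lam * Num.max 0 (p - 1) + (s * p - Q).

Let FZ := triebel_lizorkin mu XZ s p q.
Let normFZ := triebel_lizorkin_norm mu XZ s p q.
Let sigma := s - (Q - lam) / p.
Let RE (f : Z -> R[i]) := fun y => complex.Re (f y).
Let IM (f : Z -> R[i]) := fun y => complex.Im (f y).
Let tail (f : Z -> R[i]) (y : int * N) : \bar R :=
  osc_tail XZ lam io (osc XZ (discretize mu f)) (y.1 - 3, y.2).
Let osc0 f v : (0 <= osc XZ (discretize mu f) v)%E. Proof. exact: osc_ge0. Qed.
Let tail0 f y : (0 <= tail f y)%E.
Proof. by apply: esum_ge0 => x _; rewrite mule_ge0 ?lee_fin ?powR_ge0. Qed.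

Definition crestr (f : Z -> R[i]) (t : N) : R[i] :=
  Complex (restr mu sel (fun y => complex.Re (f y)) t)
          (restr mu sel (fun y => complex.Im (f y)) t).

Lemma crestr_tail_sum : exists2 K : R, 0 <= K & forall f,
  (\esum_(y in vertices XN) ((2 `^ ((y.1 - 3)%:~R * (s * p - Q)))%:E * tail f y `^ p) <=
   K%:E * normFZ f `^ p)%E.
Proof.
have [K1 K10 H1] := schur_osc_tail XZ XN io_isometry Q0 lam0 mmZ mmN rbZ rbN 3 p0 cond.
have [K2 K20 H2] := osc_triebel_lizorkin XZ Q0 lam0 mmZ rbZ poF s p0 q0.
exists (K1 * K2); first exact: mulr_ge0.
move=> f; apply: le_trans (H1 _ (osc0 f)) _.
by rewrite EFinM -muleA; apply: lee_wpmul2l; rewrite ?lee_fin.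
Qed.

Lemma tail_lty f y : FZ f -> vertices XN y -> (tail f y < +oo)%E.
Proof.
move=> [_ fin]; have [K K0 H] := crestr_tail_sum.
have lt : (K%:E * normFZ f `^ p < +oo)%E by rewrite lte_mul_pinfty ?lee_fin ?poweR_lty.
by apply: (lty_esum_term p0 _ _ (le_lt_trans (H f) lt)) => ?; rewrite ?powR_gt0.
Qed.

Let cvgs (g : Z -> R) (t : N) (l : R) : Prop :=
  bavg mu g (k%:Z, sel k%:Z t) @[k --> \oo] --> l.

Lemma crestr_ae f : FZ f ->
  {ae cara nu, forall t, (osc_sum XZ io (osc XZ (discretize mu f)) 0 t < +oo)%E}.
Proof.
move=> Ff; have tf y : vertices XN y -> (tail f y < +oo)%E by move=> ?; exact: tail_lty.
exact: (osc_sum_ae io_isometry Q0 mmZ mmN rbZ rbN (dominates_Re mu XZ f) tf).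
Qed.

Lemma crestr_cvg f t : (osc_sum XZ io (osc XZ (discretize mu f)) 0 t < +oo)%E ->
  (exists l, cvgs (RE f) t l) /\ (exists l, cvgs (IM f) t l).
Proof.
move=> fin; split; apply/cvg_ex.
  have := telescope_cvg sel_vertex sel_near (dominates_Re mu XZ f) fin; exact.
have := telescope_cvg sel_vertex sel_near (dominates_Im mu XZ f) fin; exact.
Qed.

Let cvgs_lin a b g h t l m : locint mu g -> locint mu h -> cvgs g t l -> cvgs h t m ->
  cvgs (fun y => a * g y + b * h y) t (a * l + b * m).
Proof.
move=> gi hi gl hm; rewrite /cvgs/bavg/=.
under eq_cvg do rewrite (ravg_lin mmZ _ _ a b gi hi).
by apply: cvgD; apply: cvgM => //; exact: cvg_cst.
Qed.

Let cvgs_ae g h t l : locint mu g -> locint mu h ->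
  {ae cara mu, forall y, g y = h y} -> cvgs g t l -> cvgs h t l.
Proof.
move=> gi hi gh; rewrite /cvgs/bavg/=.
by under eq_cvg do rewrite (ravg_ae mmZ _ _ gi hi gh).
Qed.

Let cvgs_ext g h t l : (forall y, g y = h y) -> cvgs g t l -> cvgs h t l.
Proof. by move=> gh; rewrite (_ : g = h)//; apply/funext. Qed.

Let cvgs_cst c t : cvgs (fun=> c) t c.
Proof.
rewrite /cvgs/bavg/=; under eq_cvg do rewrite (ravg_cst mmZ) ?rad_gt0//.
exact: cvg_cst.
Qed.

Lemma crestr_L1loc f : FZ f -> L1loc nu (crestr f).
Proof.
move=> Ff; have [fr fim] := L1loc_locint Ff.1.
have tf y : vertices XN y -> (tail f y < +oo)%E by move=> ?; exact: tail_lty.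
apply: locint_L1loc.
  exact: (locint_restr io_isometry Q0 mmZ mmN rbZ rbN sel_vertex sel_near sel_meas
    (dominates_Re mu XZ f) tf).
exact: (locint_restr io_isometry Q0 mmZ mmN rbZ rbN sel_vertex sel_near sel_meas
    (dominates_Im mu XZ f) tf).
Qed.

Lemma crestr_edge_diff f e : FZ f -> edges XN e ->
  ((edge_diff nu (crestr f) e)%:E <= (4 * restr_const lam CN)%:E * tail f e.1)%E.
Proof.
move=> Ff Xe; have [V1 V2 lE l12 l21] := edge_levels Xe.
have k0 : 0 <= restr_const lam CN.
  by rewrite /restr_const !mulr_ge0 ?powR_ge0 ?(ltW CN0).
have [ess|iness] := pselect (essential N (rad e.1.1 : R)); last first.
  rewrite (inessential_edge_diff nu (crestr f) Xe); last by rewrite lE.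
  by rewrite mule_ge0// lee_fin mulr_ge0.
have tf y : vertices XN y -> (tail f y < +oo)%E by move=> ?; exact: tail_lty.
have [t tE] : exists t : R, tail f e.1 = t%:E.
  exists (fine (tail f e.1)); rewrite fineK// ge0_fin_numE//; exact: tf.
rewrite tE -EFinM lee_fin -mulrA.
have e12 : mdist e.1.2 e.2.2 < 3 * rad e.1.1.
  by rewrite -lE; apply: (edge_near Xe _).1; right; exact: vball_center.
have e11 : mdist e.1.2 e.1.2 < 3 * rad e.1.1 by rewrite mdistxx mulr_gt0 ?rad_gt0.
have e1s : e.1.1 <= e.1.1 + 1 by rewrite lerDl.
have B g := @bavg_restr_dist _ _ _ mu nu XZ XN Q lam CZ CN io io_isometry Q0 lam0 mmZ mmN
  rbZ rbN sel sel_vertex sel_near sel_meas g (osc XZ (discretize mu f)).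
have hr := B (RE f) (dominates_Re mu XZ f) tf e.1 _ V1 ess.
have hi := B (IM f) (dominates_Im mu XZ f) tf e.1 _ V1 ess.
rewrite -/(tail f e.1) tE in hr; rewrite -/(tail f e.1) tE in hi.
apply: (@edge_diff_le_bavg _ _ nu (crestr f) e
  (bavg mu (RE f) (e.1.1 - 3, sel (e.1.1 - 3) e.1.2)) (bavg mu (IM f) (e.1.1 - 3, sel (e.1.1 - 3) e.1.2))).
- by have := hr e.1 (lexx _) e1s e11; rewrite -EFinM lee_fin.
- by have := hr e.2 l12 l21 e12; rewrite -EFinM lee_fin.
- by have := hi e.1 (lexx _) e1s e11; rewrite -EFinM lee_fin.
- by have := hi e.2 l12 l21 e12; rewrite -EFinM lee_fin.
Qed.

(** Since sigma p - lam = s p - Q, the Besov weight on the subset is the weight of the tails;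
    undoing the shift by three levels costs 2^(3 (s p - Q)), part of the constant [c]. *)
Lemma crestr_bounded : exists2 K : R, 0 <= K & forall f, FZ f ->
  (besov_norm nu XN sigma p%:E p%:E (crestr f) <= K%:E * normFZ f)%E.
Proof.
have [K1 K10 H1] := besov_norm_le XN lam0 mmN rbN sigma p0.
have [K2 K20 H2] := crestr_tail_sum.
have k0 : 0 <= 4 * restr_const lam CN.
  by rewrite /restr_const !mulr_ge0 ?powR_ge0 ?(ltW CN0).
set k := 4 * _ in k0; set c : R := k `^ p * 2 `^ (3 * (s * p - Q)).
have c0 : 0 <= c by rewrite mulr_ge0 ?powR_ge0.
exists ((K1 * (c * K2)) `^ p^-1); first exact: powR_ge0.
move=> f Ff; apply: le_poweR_scale => //; first exact: mulr_ge0 K10 (mulr_ge0 c0 K20).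
- exact: lq_norm_ge0.
- exact: Lnorm_ge0.
apply: le_trans (H1 (crestr f) (fun y => k%:E * tail f y)%E _ _) _.
- by move=> y; rewrite mule_ge0.
- by move=> e Xe; exact: crestr_edge_diff.
rewrite (EFinM K1) -muleA; apply: lee_wpmul2l; first by rewrite lee_fin.
rewrite (EFinM c) -muleA; apply: le_trans (lee_wpmul2l _ (H2 f)); last by rewrite lee_fin.
rewrite -esumZl ?lee_fin//; last by move=> y _; rewrite mule_ge0 ?lee_fin ?powR_ge0 ?poweR_ge0.
apply: le_esum => y _; rewrite poweRM ?lee_fin// poweR_EFin muleA -EFinM muleA -EFinM.
apply: lee_wpmul2r; first exact: poweR_ge0.
have E : (y.1%:~R * (sigma * p - lam) : R) = 3 * (s * p - Q) + (y.1 - 3)%:~R * (s * p - Q).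
  by rewrite intrB /sigma; field; rewrite gt_eqF.
by rewrite lee_fin E powRD_pos// le_eqVlt; apply/orP; left; apply/eqP; rewrite /c; ring.
Qed.

Theorem crestr_operator : bounded_linear_operator mu nu FZ normFZ
  (besov nu XN sigma p%:E p%:E) (besov_norm nu XN sigma p%:E p%:E) crestr.
Proof.
have [K K0 HK] := crestr_bounded.
split.
- move=> f Ff; split; first exact: crestr_L1loc.
  apply: le_lt_trans (HK f Ff) _; rewrite lte_mul_pinfty ?lee_fin//.
  exact: Ff.2.
- move=> f g [Lf _] [Lg _] fg; have [fr fim] := L1loc_locint Lf; have [gr gim] := L1loc_locint Lg.
  apply: aeW => t; rewrite /crestr /restr.
  congr (Complex (fine (limn_esup _)) (fine (limn_esup _))); apply/funext => k;
    congr EFin; apply: (ravg_ae mmZ) => //; by apply: ae_imp fg => y ->.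
- move=> f g Ff Fg [c fg]; have [fr fim] := L1loc_locint Ff.1; have [gr gim] := L1loc_locint Fg.1.
  exists c; apply: ae_imp (crestr_ae Fg) => t /crestr_cvg[[l gl] [m gm]].
  have h1 : restr mu sel (RE f) t = 1 * l + complex.Re c * 1.
    apply: restr_cvg; change (cvgs (RE f) t (1 * l + complex.Re c * 1)).
    refine (cvgs_ae (locint_lin mmZ 1 (complex.Re c) gr (locint_cst mmZ 1)) fr _
      (@cvgs_lin 1 (complex.Re c) (RE g) (fun=> 1) t l 1 gr (locint_cst mmZ 1) gl (@cvgs_cst 1 t))).
    apply: ae_imp fg => y /(canRL (subrK _)) ->.
    by rewrite mul1r mulr1 addrC; case: (g y); case: (c).
  have h2 : restr mu sel (IM f) t = 1 * m + complex.Im c * 1.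
    apply: restr_cvg; change (cvgs (IM f) t (1 * m + complex.Im c * 1)).
    refine (cvgs_ae (locint_lin mmZ 1 (complex.Im c) gim (locint_cst mmZ 1)) fim _
      (@cvgs_lin 1 (complex.Im c) (IM g) (fun=> 1) t m 1 gim (locint_cst mmZ 1) gm (@cvgs_cst 1 t))).
    apply: ae_imp fg => y /(canRL (subrK _)) ->.
    by rewrite mul1r mulr1 addrC; case: (g y); case: (c).
  rewrite /crestr -/(RE f) -/(RE g) -/(IM f) -/(IM g) h1 h2 (restr_cvg gl) (restr_cvg gm).
  by rewrite !mul1r !mulr1; case: (c) => x y; simpc; congr Complex => /=; ring.
(* Upper limits are not additive; linearity holds at the points where the averages of both functions
   converge. *)
- move=> a f g Ff Fg; have [fr fim] := L1loc_locint Ff.1; have [gr gim] := L1loc_locint Fg.1.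
  apply: ae_imp (ae_and (crestr_ae Ff) (crestr_ae Fg)).
  move=> t [/crestr_cvg[[l1 f1] [m1 f2]] /crestr_cvg[[l2 g1] [m2 g2]]].
  have h1 : restr mu sel (RE (fun x => a * f x + g x)) t =
      1 * (complex.Re a * l1 + - complex.Im a * m1) + 1 * l2.
    apply: restr_cvg; refine (cvgs_ext _ (@cvgs_lin 1 1 _ (RE g) t _ l2 (locint_lin mmZ (complex.Re a) (- complex.Im a) fr fim) gr
      (@cvgs_lin (complex.Re a) (- complex.Im a) (RE f) (IM f) t l1 m1 fr fim f1 f2) g1)).
    by move=> y; rewrite !mul1r /RE; case: (g y); case: (f y); case: (a) => ? ? ? ? ? ?; simpc => /=; ring.
  have h2 : restr mu sel (IM (fun x => a * f x + g x)) t =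
      1 * (complex.Re a * m1 + complex.Im a * l1) + 1 * m2.
    apply: restr_cvg; refine (cvgs_ext _ (@cvgs_lin 1 1 _ (IM g) t _ m2 (locint_lin mmZ (complex.Re a) (complex.Im a) fim fr) gim
      (@cvgs_lin (complex.Re a) (complex.Im a) (IM f) (RE f) t m1 l1 fim fr f2 f1) g2)).
    by move=> y; rewrite !mul1r /IM; case: (g y); case: (f y); case: (a) => ? ? ? ? ? ?; simpc => /=; ring.
  rewrite /crestr -/(RE _) -/(RE f) -/(RE g) -/(IM f) -/(IM g).
  rewrite -/(IM (fun x => a * f x + g x)) h1 h2 (restr_cvg f1) (restr_cvg f2) (restr_cvg g1) (restr_cvg g2).
  by rewrite !mul1r; case: (a) => x y; simpc; congr Complex => /=; ring.
- by exists K.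
Qed.

Lemma crestr_continuous f : L1loc mu f -> continuous (f : Z -> R[i]^o) ->
  forall t, crestr f t = f (io t).
Proof.
move=> Lf cf t; have [fr fim] := L1loc_locint Lf.
have cpart (h : R[i] -> R) : (forall z, `|h z| <= Normc.normc z) ->
    (forall z w, h (z - w) = h z - h w) -> continuous (fun y => h (f y)).
  move=> hn hB x; apply/cvgrPdist_le => e e0.
  have /cvgrPdist_le/(_ (Complex e 0)) := cf x.
  have e0' : 0 < Complex e 0 by rewrite ltcE/= eqxx.
  move=> /(_ e0'); apply: filterS => y /=; rewrite -hB.
  rewrite lecE => /andP[_ /=]; apply: le_trans; exact: hn.
rewrite /crestr (continuous_restr mmZ sel_near fr) ?(continuous_restr mmZ sel_near fim).
- by case: (f (io t)).
- by apply: cpart; [exact: normc_Im_le | case=> ? ? [? ?]].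
- by apply: cpart; [exact: normc_Re_le | case=> ? ? [? ?]].
Qed.

End restriction_operator.

Lemma cvge0_le {R : realType} (u : nat -> \bar R) : (forall k, 0 <= u k)%E ->
  (forall e : R, 0 < e -> exists K : nat, forall k : nat, (K <= k)%N -> (u k <= e%:E)%E) ->
  u @ \oo --> (0 : \bar R).
Proof.
move=> u0 ue; have fin e (k : nat) : (u k <= e%:E)%E -> u k \is a fin_num.
  by move=> h; rewrite ge0_fin_numE//; apply: le_lt_trans h _; exact: ltry.
apply/fine_cvgP; split.
  by have [K KP] := ue 1 ltr01; exists K => // k /= /KP; exact: fin.
apply/cvgrPdist_le => e e0; have [K KP] := ue e e0; exists K => // k /= Kk.
have h := KP k Kk; rewrite sub0r normrN ger0_norm ?fine_ge0//.
by rewrite -lee_fin fineK// (fin e).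
Qed.

(** * Pointwise behaviour of Besov functions *)

Section trace_side.
Context {R : realType} {N : pmetricType R} (nu : {outer_measure set N -> \bar R}).
Context (XN : @hyperbolic_filling R N) (lam CN : R).
Hypothesis (lam0 : 0 < lam) (mmN : metric_measure_space nu).
Hypothesis rbN : regular_bounds nu lam CN.
Let TN := caratheodory_type nu.
Variable sel : int -> N -> N.
Hypothesis sel_vertex : forall n t, vertices XN (n, sel n t).
Hypothesis sel_near : forall n t, mdist t (sel n t) < rad n / 2.
Hypothesis sel_meas : forall n (g : N -> R),
  measurable_fun [set: TN] (fun t : TN => g (sel n t)).
Variables (g : N -> R) (D : int * N -> \bar R).
Hypothesis gi : locint nu g.
Hypothesis gD : dominates XN (bavg nu g) D.
Hypothesis tail_fin : forall y, vertices XN y ->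
  (osc_tail XN lam id D ((y.1 - 3)%R, y.2) < +oo)%E.
Let D0 : (forall v, 0 <= D v)%E. Proof. exact: gD.1. Qed.
Let id_iso : forall x y : N, mdist (id x) (id y) = mdist x y. Proof. by []. Qed.
Let osc_fin := osc_sum_ae id_iso lam0 mmN mmN rbN rbN gD tail_fin.

(** The estimates for a subset are reused with the space embedded in itself, where every vertex
    meets the subset. *)
Lemma meeting_id : meeting XN (@id N) = vertices XN.
Proof.
apply/seteqP; split => [v []//|v Vv]; split => //.
by exists v.2; exact: vball_center.
Qed.

Lemma osc_le_tail v : vertices XN v -> (D v <= osc_tail XN lam id D v)%E.
Proof.
move=> Vv; have mv : (meeting XN id `&` tail_rel id v) v.
  split; first by rewrite meeting_id.
  by split; rewrite ?lexx ?mdistxx ?addr_gt0 ?rad_gt0.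
have -> : D v = ((2 `^ (- (v.1 - v.1)%:~R * lam))%:E * D v)%E.
  by rewrite subrr oppr0 mul0r powRr0 mul1e.
apply: (ge_esum_term (a := fun x => (2 `^ (- (x.1 - v.1)%:~R * lam))%:E * D x)%E) mv.
by move=> x _; rewrite mule_ge0 ?lee_fin ?powR_ge0.
Qed.

(** Telescoping gives convergence almost everywhere to some h, and [L1_differentiation] gives
    convergence to [g] in the mean on each ball. By Fatou the integral of |h - g| over the ball is
    0, so the limits agree almost everywhere. *)
Lemma bavg_cvg_ae :
  {ae cara nu, forall t, bavg nu g (k%:Z, sel k%:Z t) @[k --> \oo] --> g t}.
Proof.
pose T (k : nat) (t : N) := bavg nu g (k%:Z, sel k%:Z t).
pose h (t : N) := restr nu sel g t.
have Th : {ae cara nu, forall t, T ^~ t @ \oo --> h t}.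
  apply: ae_imp osc_fin => t fin.
  have /cvg_ex[l gl] := telescope_cvg sel_vertex sel_near gD fin.
  by rewrite /h (restr_cvg gl).
have mh : measurable_fun [set: TN] (h : TN -> R) by exact: measurable_restr.
suff gh : {ae cara nu, forall t, h t = g t}.
  by apply: ae_imp (ae_and Th gh) => t [+ <-].
pose A (i : nat) := [set t : N | ~ (ball point i.+1%:R t -> h t = g t)].
apply: (@negligibleS _ _ _ (cara nu) (\bigcup_i A i)).
  move=> t /= nt; exists (Num.trunc (mdist (point : N) t)) => //= ht; apply: nt; apply: ht.
  by apply/in_ball; rewrite truncnS_gt.
apply: negligible_bigcup => i; pose B : set N := ball point i.+1%:R.
have mB : measurable (B : set TN) by exact: measurable_ball_cara.
have mT k : measurable_fun [set: TN] (T k : TN -> R).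
  exact: (sel_meas k%:Z (fun x => bavg nu g (k%:Z, x))).
pose f (k : nat) (t : TN) := (`|T k t - g t| * \1_B t)%:E.
have mf k : measurable_fun [set: TN] (f k).
  apply/measurable_EFinP; apply: measurable_funM => //.
  by apply: measurableT_comp => //; apply: measurable_funB => //; exact: gi.1.
have f0 k t : (0 <= f k t)%E by rewrite lee_fin mulr_ge0.
have If : (fun k => \int[cara nu]_t f k t)%E @ \oo --> (0 : \bar R).
  apply: cvge0_le => [k|e e0]; first by apply: integral_ge0.
  exact: (L1_differentiation lam0 mmN rbN sel_vertex sel_near sel_meas gi point i.+1%:R e0).
pose d (t : TN) := (`|h t - g t| * \1_B t)%:E.
have md : measurable_fun [set: TN] d.
  apply/measurable_EFinP; apply: measurable_funM => //.
  by apply: measurableT_comp => //; apply: measurable_funB => //; exact: gi.1.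
have d0 t : (0 <= d t)%E by rewrite lee_fin mulr_ge0.
have Id : (\int[cara nu]_t `|d t| = 0)%E.
  under eq_integral do rewrite gee0_abs//.
  apply/eqP; rewrite eq_le integral_ge0// andbT.
  have [<- _] := cvg_limn_einf_sup If.
  apply: le_trans (fatou (cara nu) measurableT (fun k => mf k) (fun k t _ => f0 k t)).
  apply: ae_le_integral_nonmeasurable => //.
  - move=> t; rewrite limn_einf_lim; apply: lime_ge; first exact: is_cvg_einfs.
    by apply: nearW => n; apply: le_ereal_inf_tmp => _ [m _ <-].
  - rewrite /limn_einf; apply: measurableT_comp => //.
    by apply: measurable_fun_limn_esup => k; exact: measurableT_comp.
  apply: ae_imp Th => t Tt.
  suff /cvg_limn_einf_sup[-> _] : f ^~ t @ \oo --> d t by [].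
  apply: cvg_EFin; first by near=> k.
  apply: cvgM; last exact: cvg_cst.
  apply: cvg_norm; apply: cvgB => //; exact: cvg_cst.
have /ae_eq_integral_abs := Id => /(_ measurableT md) dz.
apply: negligibleS dz => t /= nt dt; apply: nt => Bt.
have := dt I; rewrite /d (indic_in Bt) mulr1 => -[] /eqP.
by rewrite normr_eq0 subr_eq0 => /eqP.
Unshelve. all: by end_near. Qed.

(** A Poincare-type inequality: almost every value of [g] is the limit of its averages, so its
    distance to the average at [v] telescopes over finer vertices, and [integral_osc_sum] integrates
    the resulting bound. *)
Lemma vball_oscillation v : vertices XN v ->
  (Iabs nu (ball v.2 (rad v.1)) (fun t => (g t - bavg nu g v)%R) <=
   (2 * (CN * 2 `^ lam) * 2 `^ (- v.1%:~R * lam))%:E * osc_tail XN lam id D v)%E.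
Proof.
move=> Vv; rewrite -mulrA EFinM -muleA.
apply: le_trans (lee_wpmul2l _ (integral_osc_sum XN id_iso lam0 mmN mmN rbN rbN v D0)); last by rewrite lee_fin.
have I0 t : (0 <= osc_sum XN id D v.1 t * (\1_(ball v.2 (rad v.1)) t)%:E)%E.
  by rewrite mule_ge0 ?osc_sum_ge0// lee_fin.
have mI : measurable_fun [set: TN]
    (fun t : TN => osc_sum XN id D v.1 t * (\1_(ball v.2 (rad v.1)) t)%:E)%E.
  apply: emeasurable_funM; first exact: (measurable_osc_sum XN id_iso lam0 mmN mmN rbN).
  by apply/measurable_EFinP; apply: measurable_indic; exact: measurable_ball_cara.
rewrite -ge0_integralZl//=; apply: ae_le_integral_nonmeasurable.
- by move=> t; rewrite lee_fin mulr_ge0.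
- by move=> t; rewrite mule_ge0.
- by apply: emeasurable_funM => //; exact: measurable_cst.
apply: ae_imp bavg_cvg_ae => t gt.
have [vt|vt] := pselect (ball v.2 (rad v.1) t); last first.
  by rewrite (indic_notin vt) mulr0 !mule0.
rewrite (indic_in vt) mulr1 mule1.
apply: (telescope_limit sel_vertex sel_near gD Vv _ gt).
by rewrite vballE.
Qed.

End trace_side.

Lemma clamp_lipschitz {R : realType} (a b a' b' e : R) :
  `|a - a'| <= e -> `|b - b'| <= e ->
  `|Num.max 0 (Num.min a b) - Num.max 0 (Num.min a' b')| <= e.
Proof.
move=> h h'; have {h h'} : `|Num.min a b - Num.min a' b'| <= e.
  move: h h'; rewrite !ler_norml => /andP[h1 h2] /andP[h3 h4].
  rewrite !minEle; apply/andP.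
  by case: (leP a b) => ?; case: (leP a' b') => ?; split; lra.
move: (Num.min a b) (Num.min a' b') => x x'; rewrite !ler_norml => /andP[h1 h2].
rewrite !maxEle; apply/andP.
by case: (leP 0 x) => ?; case: (leP 0 x') => ?; split; lra.
Qed.

(** * The extension operator *)

Section extension_kernel.
Context {R : realType} {Z N : pmetricType R} (nu : {outer_measure set N -> \bar R}).
Context (XN : @hyperbolic_filling R N) (lam CN : R) (io : N -> Z).
Hypothesis io_isometry : forall x y, mdist (io x) (io y) = mdist x y.
Hypothesis (lam0 : 0 < lam) (mmN : metric_measure_space nu).
Hypothesis rbN : regular_bounds nu lam CN.
Let TN := caratheodory_type nu.
Let CN0 : 0 < CN. Proof. by apply: lt_le_trans rbN.1. Qed.
Let F0 := range_io0 io.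

Definition io_dist (x : Z) : R := dist_to (range io) x.

Lemma io_dist_ge0 x : 0 <= io_dist x. Proof. exact: dist_to_ge0. Qed.

Lemma io_dist_near x : 0 < io_dist x -> exists t, mdist x (io t) < 3 / 2 * io_dist x.
Proof.
move=> d0; have [|_ [t _ <-] h] := @dist_to_lt _ _ _ F0 x (3 / 2 * io_dist x).
  by rewrite -/(io_dist x); lra.
by exists t.
Qed.

Lemma io_dist_le x t : io_dist x <= mdist x (io t).
Proof. by apply: dist_to_le => //; exists t. Qed.

(* A Lipschitz cutoff at scale d = io_dist x: d times the indicator of the ball
   of radius 3 d about x, tapering off to 0 at radius 4 d. *)
Definition kern (x : Z) (t : N) : R :=
  Num.max 0 (Num.min (io_dist x) (4 * io_dist x - mdist x (io t))).

Lemma kern_ge0 x t : 0 <= kern x t. Proof. by rewrite le_max lexx. Qed.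

Lemma kern_le x t : kern x t <= io_dist x.
Proof. by rewrite ge_max io_dist_ge0 ge_min lexx. Qed.

Lemma kern_supp x t : 4 * io_dist x <= mdist x (io t) -> kern x t = 0.
Proof.
move=> h; apply/eqP; rewrite eq_le kern_ge0 andbT ge_max lexx ge_min subr_le0 h orbT.
by [].
Qed.

Lemma kern_max x t : mdist x (io t) <= 3 * io_dist x -> kern x t = io_dist x.
Proof.
move=> h; rewrite /kern min_l; first by rewrite max_r// io_dist_ge0.
by have := io_dist_ge0 x; lra.
Qed.

Lemma mdist_lipschitz (x y z : Z) : `|mdist x z - mdist y z| <= mdist x y.
Proof.
have := metric_triangle x y z; have := metric_triangle y x z.
by rewrite (metric_sym y x) ler_norml => *; apply/andP; split; lra.
Qed.

Lemma kern_lipschitz x x' t : `|kern x t - kern x' t| <= 5 * mdist x x'.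
Proof.
have d := mdist_ge0 x x'; have h := dist_to_lipschitz F0 x x'.
rewrite -/(io_dist x) -/(io_dist x') ler_norml in h; case/andP: h => h1 h2.
have h := mdist_lipschitz x x' (io t); rewrite ler_norml in h; case/andP: h => h3 h4.
by apply: clamp_lipschitz; rewrite ler_norml; apply/andP; split; lra.
Qed.

Lemma measurable_kern x : measurable_fun [set: TN] (kern x : TN -> R).
Proof.
apply: (measurable_continuous mmN); apply: (@lipschitz_continuous _ _ _ 1) => t t'.
rewrite mul1r; apply: clamp_lipschitz; first by rewrite subrr normr0 mdist_ge0.
have h := mdist_lipschitz (io t) (io t') x; rewrite io_isometry !(metric_sym _ x) ler_norml in h.
by case/andP: h => h1 h2; rewrite ler_norml; apply/andP; split; lra.
Qed.

Lemma bounded_kernel (k : N -> R) (A : R) (z : N) (r : R) (h : N -> R) :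
  measurable_fun [set: TN] (k : TN -> R) -> (forall t, `|k t| <= A) ->
  (forall t, ~ ball z r t -> k t = 0) -> locint nu h ->
  (cara nu).-integrable setT (fun t => (k t * h t)%:E) /\
  ((`|\int[cara nu]_(t in setT) (k t * h t)|)%:E <= A%:E * Iabs nu (ball z r) h)%E.
Proof.
move=> mk kA k0 hi; have A0 : 0 <= A by apply: le_trans (kA point).
have mkh : measurable_fun [set: TN] (fun t : TN => (k t * h t)%:E).
  by apply/measurable_EFinP; apply: measurable_funM => //; exact: hi.1.
have mI : measurable_fun [set: TN] (fun t : TN => (`|h t| * \1_(ball z r) t)%:E).
  apply/measurable_EFinP; apply: measurable_funM; first exact: measurableT_comp hi.1.
  by apply: measurable_indic; exact: measurable_ball_cara.
have le : (\int[cara nu]_t `|(k t * h t)%:E| <= A%:E * Iabs nu (ball z r) h)%E.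
  rewrite -ge0_integralZl//.
  apply: le_integral_nonmeasurable => t; first exact: abse_ge0.
  rewrite -EFinM abse_EFin lee_fin normrM.
  have [zt|zt] := pselect (ball z r t); first by rewrite indic_in// mulr1 ler_wpM2r.
  by rewrite (k0 t zt) normr0 mul0r indic_notin// !mulr0.
have kh : (cara nu).-integrable setT (fun t => (k t * h t)%:E).
  apply/integrableP; split => //; apply: le_lt_trans le _.
  by rewrite lte_mul_pinfty ?lee_fin// (Iabs_locint_lty mmN).
split => //; have fin := integrable_fin_num measurableT kh.
rewrite /Rintegral -abse_EFin fineK//.
by apply: le_trans (le_abse_integral (cara nu) measurableT mkh) _.
Qed.

Definition ext_num (g : N -> R) (x : Z) : R := \int[cara nu]_(t in setT) (kern x t * g t).

(** On the subset the kernel vanishes identically, and the value is 0 / 0 = 0. *)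
Definition ext (g : N -> R) (x : Z) : R := ext_num g x / ext_num (fun=> 1) x.

Let supp x : exists r, forall t, ~ ball point r t -> kern x t = 0.
Proof.
exists (4 * io_dist x + mdist x (io point)) => t /in_ball/negP; rewrite -leNgt => h.
apply: kern_supp; have := metric_triangle (io point) x (io t).
by rewrite io_isometry (metric_sym (io point)); lra.
Qed.

Let normk x t : `|kern x t| <= io_dist x. Proof. by rewrite ger0_norm ?kern_ge0 ?kern_le. Qed.

Lemma integrable_kern g x : locint nu g ->
  (cara nu).-integrable setT (fun t => (kern x t * g t)%:E).
Proof.
move=> gi; have [r sr] := supp x.
exact: (bounded_kernel (measurable_kern x) (normk x) sr gi).1.
Qed.

Lemma ext_num_lin a b g h x : locint nu g -> locint nu h ->
  ext_num (fun t => a * g t + b * h t) x = a * ext_num g x + b * ext_num h x.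
Proof.
move=> gi hi; rewrite /ext_num -!RintegralZl//; last 2 first.
- exact: integrable_kern.
- exact: integrable_kern.
rewrite -RintegralD//; last 2 first.
- exact: (integrableZl measurableT a (integrable_kern x gi)).
- exact: (integrableZl measurableT b (integrable_kern x hi)).
by apply: eq_Rintegral => t _; ring.
Qed.

Lemma ext_num_sub g c x : locint nu g ->
  ext_num (fun t => g t - c) x = ext_num g x - c * ext_num (fun=> 1) x.
Proof.
move=> gi; rewrite (_ : (fun t => g t - c) = fun t => 1 * g t + (- c) * 1); last first.
  by apply/funext => t; rewrite mul1r mulr1.
by rewrite (ext_num_lin _ _ _ gi (locint_cst mmN 1)) mul1r mulNr.
Qed.

Lemma ext_weight_ge x t0 r : 0 < r -> mdist x (io t0) + r <= 3 * io_dist x ->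
  io_dist x * fine (nu (ball t0 r)) <= ext_num (fun=> 1) x.
Proof.
move=> r0 h; have mB := measurable_ball_cara mmN t0 r.
have fin := integrable_fin_num measurableT (integrable_kern x (locint_cst mmN 1)).
rewrite -lee_fin /ext_num /Rintegral fineK// EFinM -(ball_fineE mmN).
rewrite -(integral_cst_indic (cara nu) mB) ?lee_fin ?io_dist_ge0//.
apply: le_integral_nonmeasurable => t; first by rewrite mule_ge0 ?lee_fin ?io_dist_ge0.
rewrite -EFinM lee_fin mulr1.
have [/in_ball tt|tt] := pselect (ball t0 r t); last by rewrite indic_notin// mulr0 kern_ge0.
rewrite indic_in ?mulr1; last exact/in_ball.
rewrite kern_max//; apply: le_trans (metric_triangle _ (io t0) _) _.
by rewrite io_isometry; move: h tt; lra.
Qed.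

Lemma ext_weight_gt0 x : 0 < io_dist x -> 0 < ext_num (fun=> 1) x.
Proof.
move=> d0; have [t0 xt0] := io_dist_near d0.
apply: lt_le_trans (ext_weight_ge (t0 := t0) d0 _); last by lra.
by rewrite mulr_gt0// fine_ball_gt0.
Qed.

Lemma ext_sub_le g c x z r : locint nu g -> 0 < io_dist x ->
  (forall t, mdist x (io t) < 4 * io_dist x -> ball z r t) ->
  ((`|ext g x - c|)%:E <= (io_dist x / ext_num (fun=> 1) x)%:E *
     Iabs nu (ball z r) (fun t => (g t - c)%R))%E.
Proof.
move=> gi d0 xz; have W0 := ext_weight_gt0 d0.
have -> : ext g x - c = (ext_num (fun=> 1) x)^-1 * ext_num (fun t => g t - c) x.
  by rewrite ext_num_sub// /ext; field; rewrite gt_eqF.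
rewrite normrM gtr0_norm ?invr_gt0// EFinM mulrC (EFinM _ (io_dist x)) -muleA.
apply: lee_wpmul2l; first by rewrite lee_fin invr_ge0 ltW.
have ks t : ~ ball z r t -> kern x t = 0.
  move=> nt; apply: kern_supp; rewrite leNgt; apply/negP => h; exact/nt/xz.
exact: (bounded_kernel (measurable_kern x) (normk x) ks (locint_subc mmN c gi)).2.
Qed.

(** The kernel at x' integrates g - ext g x' to 0. Hence the difference is the integral of (kern x -
    kern x')(g - ext g x'), divided by the total weight at x, and the kernel is 5-Lipschitz in its
    first argument. *)
Lemma ext_dist_le g x x' z r : locint nu g -> 0 < io_dist x -> 0 < io_dist x' ->
  (forall t, mdist x (io t) < 4 * io_dist x -> ball z r t) ->
  (forall t, mdist x' (io t) < 4 * io_dist x' -> ball z r t) ->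
  ((`|ext g x - ext g x'|)%:E <= (5 * mdist x x' / ext_num (fun=> 1) x)%:E *
     Iabs nu (ball z r) (fun t => (g t - ext g x')%R))%E.
Proof.
move=> gi d0 d0' xz xz'; have W0 := ext_weight_gt0 d0; have W0' := ext_weight_gt0 d0'.
pose h t := g t - ext g x'; have hi : locint nu h by exact: locint_subc.
have E : ext_num h x' = 0.
  by rewrite ext_num_sub// /ext; field; rewrite gt_eqF.
have -> : ext g x - ext g x' = (ext_num (fun=> 1) x)^-1 *
    \int[cara nu]_(t in setT) ((kern x t - kern x' t) * h t).
  rewrite [X in _ * X](_ : _ =
      \int[cara nu]_(t in setT) (kern x t * h t - kern x' t * h t)); last first.
    by apply: eq_Rintegral => t _; rewrite mulrBl.
  rewrite RintegralB//; [|exact: integrable_kern|exact: integrable_kern].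
  rewrite -/(ext_num h x) -/(ext_num h x') E subr0 /h ext_num_sub// {1}/ext.
  by field; rewrite gt_eqF.
set c : R := 5 * mdist x x'; rewrite [c / _]mulrC (EFinM _ c).
rewrite normrM gtr0_norm ?invr_gt0// EFinM -muleA.
apply: lee_wpmul2l; first by rewrite lee_fin invr_ge0 ltW.
apply: (bounded_kernel _ _ _ hi).2.
- by apply: measurable_funB; exact: measurable_kern.
- by move=> t; exact: kern_lipschitz.
- move=> t nt; rewrite !kern_supp ?subrr// leNgt; apply/negP => ht; apply: nt.
    exact: xz'.
  exact: xz.
Qed.

Section oscillation_bounds.
Variables (g : N -> R) (a : int * N -> \bar R) (A : R).
Hypothesis gi : locint nu g.
Hypothesis (A0 : 0 <= A) (a0 : forall v, (0 <= a v)%E).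
Hypothesis ga : forall v, vertices XN v ->
  (Iabs nu (ball v.2 (rad v.1)) (fun t => (g t - bavg nu g v)%R) <=
    (A * 2 `^ (- v.1%:~R * lam))%:E * a v)%E.

(** The ball of [v] contains the support of the kernel at x and is not much larger, so that [ext] is
    a mean over a substantial part of that ball. *)
Definition adapted (x : Z) (v : int * N) : Prop :=
  [/\ 0 < io_dist x, rad v.1 <= 128 * io_dist x &
      mdist x (io v.2) + 4 * io_dist x <= rad v.1].

Let adapted_supp x v : adapted x v -> forall t, mdist x (io t) < 4 * io_dist x ->
  ball v.2 (rad v.1) t.
Proof.
move=> [_ _ h] t xt; apply/in_ball; rewrite -io_isometry.
by apply: le_lt_trans (metric_triangle _ x _) _; rewrite metric_sym; lra.
Qed.

(** As rad v.1 / 128 is at most the distance d of x, the ball of this radius about a nearly closest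
    point t0 lies within 3/2 d + d <= 3 d of x, where the kernel is maximal. Its volume bounds the
    total weight from below. *)
Let weight_essential x v : adapted x v -> essential N (rad v.1 / 128 : R) ->
  io_dist x / ext_num (fun=> 1) x <= CN * 128 `^ lam * 2 `^ (v.1%:~R * lam).
Proof.
move=> [d0 vd xv] ess; have rv := @rad_gt0 R v.1; have W0 := ext_weight_gt0 d0.
have r0 : 0 < rad v.1 / 128 :> R by rewrite divr_gt0.
have [t0 xt0] := io_dist_near d0.
have := ext_weight_ge (x := x) (t0 := t0) r0; rewrite -[in X in (X -> _)]/(_ + _ <= _).
move=> /(_ _)/wrap[]; first by lra.
move=> h; have f0 := fine_ball_gt0 mmN t0 r0.
apply: (@le_trans _ _ (fine (nu (ball t0 (rad v.1 / 128))))^-1).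
  by rewrite ler_pdivrMr// mulrC ler_pdivlMr.
apply: le_trans (fine_ball_inv_le mmN t0 rbN r0 ess) _.
rewrite -mulrA; apply: ler_wpM2l; first exact: ltW.
rewrite powR_div ?rad_ge0// opprK mulrC rad_powR; apply: ler_wpM2l; first exact: powR_ge0.
by rewrite mulrNN.
Qed.

(** The whole subset then has diameter at most a quarter of the distance of x, the kernel is
    constant on it, and both sides are the mean over the whole subset. *)
Let inessential_ext x v : adapted x v -> ~ essential N (rad v.1 / 128 : R) ->
  ext g x = bavg nu g v.
Proof.
move=> [d0 vd xv] iness; have W0 := ext_weight_gt0 d0.
have [t0 xt0] := io_dist_near d0; have rv := @rad_gt0 R v.1.
have kE t : kern x t = io_dist x.
  apply: kern_max; apply: le_trans (metric_triangle _ (io t0) _) _.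
  have := inessential_mdist t0 t iness; rewrite io_isometry; lra.
have BT : ball v.2 (rad v.1) = setT by apply: (inessential_ball v.2 iness); lra.
have intg : (cara nu).-integrable setT (EFin \o g) by have := gi.2 v.2 (rad v.1); rewrite BT.
have int1 : (cara nu).-integrable setT (EFin \o (fun=> 1 : R)).
  by have := (locint_cst mmN 1).2 v.2 (rad v.1); rewrite BT.
have nE h : (cara nu).-integrable setT (EFin \o h) ->
    ext_num h x = io_dist x * \int[cara nu]_(t in setT) h t.
  by move=> hi; rewrite /ext_num -RintegralZl//; apply: eq_Rintegral => t _; rewrite kE.
rewrite /ext !nE// /bavg /ravg BT Rintegral_cst// mul1r.
have fN : fine (nu setT) != 0 by rewrite -BT gt_eqF// fine_ball_gt0.
by rewrite -[cara nu setT]/(nu setT); field; rewrite fN gt_eqF.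
Qed.

Definition ext_const : R := CN * 128 `^ lam * A.

Lemma ext_const_ge0 : 0 <= ext_const.
Proof. exact: mulr_ge0 (mulr_ge0 (ltW CN0) (powR_ge0 _ _)) A0. Qed.

Lemma ext_adapted x v : vertices XN v -> adapted x v ->
  ((`|ext g x - bavg nu g v|)%:E <= ext_const%:E * a v)%E.
Proof.
move=> Vv xv; have [ess|iness] := pselect (essential N (rad v.1 / 128 : R)); last first.
  by rewrite (inessential_ext xv iness) subrr normr0 mule_ge0 ?lee_fin ?ext_const_ge0.
have [d0 _ _] := xv.
apply: le_trans (ext_sub_le (bavg nu g v) gi d0 (adapted_supp xv)) _.
apply: (@le_trans _ _ ((CN * 128 `^ lam * 2 `^ (v.1%:~R * lam))%:E *
    ((A * 2 `^ (- v.1%:~R * lam))%:E * a v))%E).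
  apply: lee_pmul; [|exact: Iabs_ge0| |exact: ga].
    by rewrite lee_fin divr_ge0 ?ltW// ext_weight_gt0.
  by rewrite lee_fin weight_essential.
rewrite muleA -EFinM; apply: lee_wpmul2r => //; rewrite lee_fin /ext_const.
rewrite [leLHS](_ : _ = CN * 128 `^ lam * A * (2 `^ (v.1%:~R * lam) * 2 `^ (- v.1%:~R * lam))); last by ring.
by rewrite -powRD_pos// mulNr subrr powRr0 mulr1.
Qed.

(** 640 is 5 times 128: the Lipschitz constant of the kernel, and the factor by which rad v.1 may
    exceed the distance. The last bracket bounds the oscillation of g about [ext g x']: that about
    its average, plus the distance of the average to [ext g x']. *)
Definition ext_lip_const : R := 640 * (CN * 128 `^ lam) * (A + ext_const * CN).

Lemma ext_lip_const_ge0 : 0 <= ext_lip_const.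
Proof.
have E0 := ext_const_ge0.
exact: mulr_ge0 (mulr_ge0 (ler0n _ 640) (mulr_ge0 (ltW CN0) (powR_ge0 _ _)))
  (addr_ge0 A0 (mulr_ge0 E0 (ltW CN0))).
Qed.

Lemma ext_lipschitz x x' v : vertices XN v -> adapted x v -> adapted x' v ->
  ((`|ext g x - ext g x'|)%:E <= (ext_lip_const * (mdist x x' / rad v.1))%:E * a v)%E.
Proof.
move=> Vv xv xv'; have rv := @rad_gt0 R v.1; have dxx := mdist_ge0 x x'.
have E0 := ext_const_ge0; have L0 := ext_lip_const_ge0.
have r0 : 0 <= ext_lip_const * (mdist x x' / rad v.1).
  by rewrite mulr_ge0 ?divr_ge0 ?(ltW rv).
have [ess|iness] := pselect (essential N (rad v.1 / 128 : R)); last first.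
  by rewrite (inessential_ext xv iness) (inessential_ext xv' iness) subrr normr0 mule_ge0 ?lee_fin.
have [d0 vd _] := xv; have [d0' _ _] := xv'.
have W0 := ext_weight_gt0 d0.
apply: le_trans (ext_dist_le gi d0 d0' (adapted_supp xv) (adapted_supp xv')) _.
have mB := measurable_ball_cara mmN v.2 (rad v.1).
pose B := ball v.2 (rad v.1).
have step : (Iabs nu B (fun t => (g t - ext g x')%R) <=
    ((A + ext_const * CN) * 2 `^ (- v.1%:~R * lam))%:E * a v)%E.
  apply: (@le_trans _ _ (Iabs nu B (fun t => (g t - bavg nu g v)%R) +
      Iabs nu B (fun=> (bavg nu g v - ext g x')%R))%E).
    apply: (Iabs_cat mmN).
    - exact: (locint_subc mmN _ gi).1.
    - exact: measurable_cst.
    - by move=> t; exact: ler_distD.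
  rewrite mulrDl EFinD ge0_muleDl ?lee_fin ?mulr_ge0 ?powR_ge0 ?(ltW CN0)//.
  apply: leeD; first exact: ga.
  apply: (@le_trans _ _ ((ext_const%:E * a v) * (CN * 2 `^ (- v.1%:~R * lam))%:E)%E).
    rewrite (_ : Iabs _ _ _ = (`|bavg nu g v - ext g x'|%:E * nu B)%E); last first.
      rewrite -(integral_cst_indic (cara nu) mB) ?lee_fin//.
    apply: lee_pmul => //.
      by rewrite distrC; exact: ext_adapted.
    by have := (rbN.2 v.2 _ rv).1; rewrite rad_powR.
  rewrite muleC muleA -EFinM; apply: lee_wpmul2r => //.
  by rewrite lee_fin le_eqVlt; apply/orP; left; apply/eqP; ring.
have w : 5 * mdist x x' / ext_num (fun=> 1) x <=
    640 * (mdist x x' / rad v.1) * (CN * 128 `^ lam * 2 `^ (v.1%:~R * lam)).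
  have c0 : 0 <= 640 * (mdist x x' / rad v.1).
    exact: mulr_ge0 (ler0n _ _) (divr_ge0 dxx (ltW rv)).
  have e : 5 * mdist x x' / ext_num (fun=> 1) x <=
      640 * (mdist x x' / rad v.1) * (io_dist x / ext_num (fun=> 1) x).
    rewrite -subr_ge0 (_ : _ - _ = 5 * mdist x x' * (ext_num (fun=> 1) x)^-1 *
      (rad v.1)^-1 * (128 * io_dist x - rad v.1)); last by field; rewrite !gt_eqF.
    apply: mulr_ge0; last by rewrite subr_ge0.
    apply: mulr_ge0; last by rewrite invr_ge0 ltW.
    by apply: mulr_ge0; [exact: mulr_ge0 | rewrite invr_ge0 ltW].
  exact: le_trans e (ler_wpM2l c0 (weight_essential xv ess)).
apply: (@le_trans _ _ ((640 * (mdist x x' / rad v.1) * (CN * 128 `^ lam * 2 `^ (v.1%:~R * lam)))%:E *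
   (((A + ext_const * CN) * 2 `^ (- v.1%:~R * lam))%:E * a v))%E).
  apply: lee_pmul => //; first by rewrite lee_fin divr_ge0 ?mulr_ge0 ?(ltW W0).
  exact: Iabs_ge0.
rewrite muleA -EFinM; apply: lee_wpmul2r => //; rewrite lee_fin /ext_lip_const.
have E : 2 `^ (v.1%:~R * lam) * 2 `^ (- v.1%:~R * lam) = 1 :> R.
  by rewrite -powRD_pos// mulNr subrr powRr0.
rewrite [leLHS](_ : _ = 640 * (CN * 128 `^ lam) * (A + ext_const * CN) * (mdist x x' / rad v.1) *
  (2 `^ (v.1%:~R * lam) * 2 `^ (- v.1%:~R * lam))); last by ring.
by rewrite E mulr1.
Qed.

End oscillation_bounds.

End extension_kernel.

Lemma ravg_dist_const {R : realType} {M : pmetricType R}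
    (mu : {outer_measure set M -> \bar R}) (h : M -> R) (c : R) (e : \bar R) (x : M) (r : R) :
  metric_measure_space mu -> 0 < r -> locint mu h -> (0 <= e)%E ->
  (forall y, ball x r y -> ((`|h y - c|)%:E <= e)%E) ->
  ((`|ravg mu (ball x r) h - c|)%:E <= e)%E.
Proof.
move=> mm r0 hi e0 he; apply: le_trans (dist_ravg_le mm x c r0 hi) _.
have mB := measurable_ball_cara mm x r.
rewrite -[leRHS]mule1 -(fine_ball_mulV mm x r0) muleCA.
apply: lee_wpmul2l; first by rewrite lee_fin invr_ge0 ltW// fine_ball_gt0.
rewrite -(integral_cst_indic (cara mu) mB)//.
apply: le_integral_nonmeasurable => y; first by rewrite lee_fin mulr_ge0.
have [By|By] := pselect (ball x r y).
  by rewrite indic_in// mulr1 mule1; exact: he.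
by rewrite indic_notin// mulr0 mule0.
Qed.

(** * Pointwise estimates and local integrability of the extension *)

Section extension_estimates.
Context {R : realType} {Z N : pmetricType R}.
Context (mu : {outer_measure set Z -> \bar R}) (nu : {outer_measure set N -> \bar R}).
Context (XZ : @hyperbolic_filling R Z) (XN : @hyperbolic_filling R N).
Context (Q lam CZ CN : R) (io : N -> Z).
Hypothesis io_isometry : forall x y, mdist (io x) (io y) = mdist x y.
Hypothesis (Q0 : 0 < Q) (lam0 : 0 < lam) (lamQ : lam < Q).
Hypothesis (mmZ : metric_measure_space mu) (mmN : metric_measure_space nu).
Hypothesis (rbZ : regular_bounds mu Q CZ) (rbN : regular_bounds nu lam CN).
Hypothesis cF : closed (range io).
Let TZ := caratheodory_type mu.
Let TN := caratheodory_type nu.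
Let CZ0 : 0 < CZ. Proof. by apply: lt_le_trans rbZ.1. Qed.
Let CN0 : 0 < CN. Proof. by apply: lt_le_trans rbN.1. Qed.
Let F0 := range_io0 io.
Variable sel : int -> N -> N.
Hypothesis sel_vertex : forall n t, vertices XN (n, sel n t).
Hypothesis sel_near : forall n t, mdist t (sel n t) < rad n / 2.

Lemma io_dist_gt0 x : ~ range io x -> 0 < io_dist io x.
Proof. exact: dist_to_gt0. Qed.

Lemma io_dist_triangle x y : io_dist io x <= io_dist io y + mdist x y.
Proof. exact: dist_to_triangle. Qed.

Lemma exists_adapted x : 0 < io_dist io x -> exists j v,
  [/\ rad j <= io_dist io x < 2 * rad j, vertices XN v, v.1 = j - 6,
      mdist x (io v.2) < 3 / 2 * io_dist io x + rad v.1 / 2 &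
      forall y, mdist x y <= io_dist io x / 4 -> adapted io y v].
Proof.
move=> d0; have [j /andP[j1 j2]] := exists_rad d0.
have [t xt] := io_dist_near d0.
have rk : rad (j - 6) = 64 * rad j :> R by rewrite (rad_sub j 6); congr (_ * _); ring.
have near := sel_near (j - 6) t.
have xv : mdist x (io (sel (j - 6) t)) < 3 / 2 * io_dist io x + rad (j - 6) / 2.
  apply: le_lt_trans (metric_triangle _ (io t) _) _.
  by rewrite io_isometry ltrD.
exists j, (j - 6, sel (j - 6) t); split => //; first by rewrite j1.
move=> y xy; have h1 := io_dist_triangle x y; have h2 := io_dist_triangle y x.
have h3 := metric_triangle y x (io (sel (j - 6) t)).
rewrite (metric_sym y x) in h2 h3; rewrite rk in xv.
by split => /=; rewrite ?rk; lra.
Qed.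

Definition near_rel (x : int * Z) (v : int * N) : Prop :=
  x.1 - 14 <= v.1 /\ mdist x.2 (io v.2) < rad x.1 + rad v.1.

(** Up to a constant, a bound for the mean over the ball of x of the sum of the [a v] whose balls
    contain the point; a ball of level v.1 has measure about 2^(-v.1 Q) in the space. So the decay
    has rate Q, while the number of vertices grows at rate lam. *)
Definition near_sum (a : int * N -> \bar R) (x : int * Z) : \bar R :=
  (\esum_(v in vertices XN `&` near_rel x) ((2 `^ (- (v.1 - (x.1 - 14))%:~R * Q))%:E * a v))%E.

Lemma near_sum_ge0 a x : (forall v, 0 <= a v)%E -> (0 <= near_sum a x)%E.
Proof. by move=> a0; apply: esum_ge0 => v _; rewrite mule_ge0// lee_fin powR_ge0. Qed.

Lemma schur_near_sum (p ta : R) : 0 < p -> 0 < Q * p - lam * Num.max 0 (p - 1) + ta ->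
  exists2 K : R, 0 <= K & forall a : int * N -> \bar R, (forall v, 0 <= a v)%E ->
  (\esum_(x in vertices XZ) ((2 `^ ((x.1 - 14)%:~R * ta))%:E * near_sum a x `^ p) <=
   K%:E * \esum_(v in vertices XN) ((2 `^ (v.1%:~R * ta))%:E * a v `^ p))%E.
Proof.
move=> p0 cond; have PZ := packing_const_gt0 Q0 rbZ; have PN := packing_const_gt0 lam0 rbN.
have [A A0 AE] : exists2 A : R, 0 <= A & A = packing_const lam CN * 4 `^ lam.
  by eexists; last reflexivity; exact: mulr_ge0 (ltW PN) (powR_ge0 _ _).
have [B B0 BE] : exists2 B : R, 0 <= B & B = packing_const Q CZ * (1 + 2 ^+ 14) `^ Q.
  by eexists; last reflexivity; exact: mulr_ge0 (ltW PZ) (powR_ge0 _ _).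
apply: (@schur_levels _ _ _ (vertices XN) (vertices XZ) (fun v => v.1)
  (fun x => x.1 - 14) near_rel lam Q ta p (A + B)) => //.
- exact: addr_ge0.
- by move=> x v _ _ [].
- move=> x k _ /=; set m := _ - _ => mk.
  have mx : rad x.1 <= rad m :> R by apply: le_rad; rewrite /m gerBl.
  have rk := @le_rad R _ _ mk; have rm := @rad_gt0 R m.
  apply: (@le_trans _ _ (packing_const lam CN * (2 * (2 * rad m) / rad k) `^ lam)%:E).
    apply: le_trans (verticesN_packing XN io_isometry lam0 mmN rbN x.2 _); last by lra.
    apply: subset_le_esum => // v [Vv [[_ xv] vk]]; split => //; split => //.
    by apply: lt_le_trans xv _; rewrite vk; lra.
  rewrite lee_fin (_ : 2 * (2 * rad m) = 4 * rad m); last by ring.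
  rewrite powR_div ?mulr_ge0 ?rad_ge0// powRM ?rad_ge0// !rad_powR.
  rewrite -mulrA -powRD_pos// (_ : - m%:~R * lam + _ = (k - m)%:~R * lam); last first.
    by rewrite intrB; ring.
  by rewrite mulrA -AE; apply: ler_wpM2r; rewrite ?powR_ge0// lerDl.
- move=> v k Vv /=; have [kv|kv] := leP k v.1; last first.
    rewrite esum1 ?lee_fin ?addr_ge0// => x [_ [[xv _] xk]].
    by move: kv; rewrite -xk ltNge xv.
  have rv := @le_rad R _ _ kv; have rk := @rad_gt0 R (k + 14).
  have kE : rad k = 2 ^+ 14 * rad (k + 14) :> R by rewrite (rad_add k 14).
  apply: (@le_trans _ _ (packing_const Q CZ *
      ((1 + 2 ^+ 14) * rad (k + 14) / rad (k + 14)) `^ Q)%:E).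
    apply: le_trans (vertices_packing XZ Q0 mmZ rbZ (io v.2) _).
      apply: subset_le_esum => // x [Vx [[_ xv] xk]]; split => //; split.
        by rewrite -xk subrK.
      rewrite metric_sym; apply: lt_le_trans xv _.
      rewrite mulrDl mul1r -kE -[k in (k + 14)%R]xk subrK.
      by rewrite lerD2l.
    by rewrite ler_peMl ?ltW// ltrDl exprn_gt0.
  by rewrite lee_fin mulfK ?gt_eqF// -BE lerDr.
Qed.

Section real_function.
Variables (g : N -> R) (D : int * N -> \bar R) (A : R).
Hypothesis gi : locint nu g.
Hypothesis gD : dominates XN (bavg nu g) D.
Let a := osc_tail XN lam id D.
Hypothesis A0 : 0 <= A.
Hypothesis ga : forall v, vertices XN v ->
  (Iabs nu (ball v.2 (rad v.1)) (fun t => (g t - bavg nu g v)%R) <=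
    (A * 2 `^ (- v.1%:~R * lam))%:E * a v)%E.
Let D0 : (forall v, 0 <= D v)%E. Proof. exact: gD.1. Qed.
Let a0 v : (0 <= a v)%E.
Proof. by apply: esum_ge0 => x _; rewrite mule_ge0 ?lee_fin ?powR_ge0. Qed.
Let E := ext_const lam CN A.
Let E0 : 0 <= E. Proof. exact: (ext_const_ge0 rbN A0). Qed.
Let L := ext_lip_const lam CN A.
Let L0 : 0 <= L. Proof. exact: (ext_lip_const_ge0 rbN A0). Qed.

Definition near_point_sum (n : int) (w : Z) : \bar R :=
  (\esum_(v in vertices XN `&` [set v | (n <= v.1)%R])
    (osc_tail XN lam id D v * (\1_(ball (io v.2) (rad v.1)) w)%:E))%E.

Let S0 n w : (0 <= near_point_sum n w)%E.
Proof. by apply: esum_ge0 => v _; rewrite mule_ge0 ?lee_fin//; exact: a0. Qed.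

Let S_term n w v : vertices XN v -> n <= v.1 -> mdist w (io v.2) < rad v.1 ->
  (a v <= near_point_sum n w)%E.
Proof.
move=> Vv nv wv; have Sv : (vertices XN `&` [set v | n <= v.1]) v by [].
apply: (@le_trans _ _ (a v * (\1_(ball (io v.2) (rad v.1)) w)%:E)%E).
  by rewrite indic_in ?mule1//; apply/in_ball; rewrite metric_sym.
apply: (ge_esum_term (a := fun v => a v * (\1_(ball (io v.2) (rad v.1)) w)%:E)%E) Sv.
by move=> ? _; rewrite mule_ge0 ?lee_fin//; exact: a0.
Qed.

(** A chain over a point t of the subset close to w descends from v0 to a vertex adapted to w. The
    comparison at the adapted vertex costs E, the jump to the chain and the chain itself one each,
    whence E + 2. The balls of all these vertices contain w, so the sum at w bounds every term. *)
Lemma ext_near_pointwise w v0 : 0 < io_dist io w -> vertices XN v0 ->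
  128 * io_dist io w <= rad v0.1 -> mdist w (io v0.2) <= 3 / 4 * rad v0.1 ->
  ((`|ext nu io g w - bavg nu g v0|)%:E <= (E + 2)%:E * near_point_sum v0.1 w)%E.
Proof.
move=> d0 V0 dv wv; have r0 := @rad_gt0 R v0.1.
have [j /andP[j1 j2]] := exists_rad d0.
have [t wt] := io_dist_near d0.
have rk : rad (j - 6) = 64 * rad j :> R by rewrite (rad_sub j 6); congr (_ * _); ring.
have v0k : v0.1 <= j - 6 by apply/ltW/(@rad_lt_imp R); rewrite rk; lra.
have [m kE] : exists m : nat, j - 6 = v0.1 + m%:Z.
  by exists `|(j - 6)%R - v0.1|%N; rewrite gez0_abs ?subr_ge0// [RHS]addrC subrK.
set vk := (v0.1 + m%:Z, sel (v0.1 + m%:Z) t).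
have selw i : i <= j - 6 -> mdist w (io (sel i t)) < rad i.
  move=> ik; have := @le_rad R _ _ ik; rewrite rk => ri.
  apply: le_lt_trans (metric_triangle _ (io t) _) _; rewrite io_isometry.
  by have := sel_near i t; lra.
have ad : adapted io w vk.
  have near := sel_near (v0.1 + m%:Z) t; rewrite -kE rk in near.
  split => //=; rewrite -kE rk; first by lra.
  have := metric_triangle w (io t) (io (sel (j - 6) t)); rewrite io_isometry; lra.
have e1 := ext_adapted io_isometry mmN rbN gi A0 a0 ga (sel_vertex (v0.1 + m%:Z) t) ad.
have vt : vball v0 t.
  apply/in_vball; rewrite -io_isometry; apply: le_lt_trans (metric_triangle _ w _) _.
  by rewrite metric_sym; lra.
have e2 := @telescope _ _ _ XN id sel sel_vertex sel_near _ _ gD v0 t m V0 vt.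
apply: (@le_trans _ _ ((`|ext nu io g w - bavg nu g vk|)%:E + (`|bavg nu g vk - bavg nu g v0|)%:E)%E).
  by rewrite -EFinD lee_fin; exact: ler_distD.
have -> : ((E + 2)%:E * near_point_sum v0.1 w =
    E%:E * near_point_sum v0.1 w + (near_point_sum v0.1 w + near_point_sum v0.1 w))%E.
  have -> : E + 2 = E + (1 + 1) by [].
  rewrite !EFinD.
  by rewrite ge0_muleDl ?lee_fin// ge0_muleDl ?lee_fin// mul1e.
apply: leeD.
  apply: le_trans e1 _; apply: lee_wpmul2l; first by rewrite lee_fin.
  by apply: S_term; [exact: sel_vertex | rewrite lerDl | rewrite /= -kE; exact: selw].
apply: le_trans e2 _; apply: leeD.
  apply: le_trans (osc_le_tail lam gD V0) _.
  by apply: S_term => //; lra.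
apply: (@le_trans _ _ (\sum_(i < m) (fun v => a v * (\1_(ball (io v.2) (rad v.1)) w)%:E)
    ((fun i : nat => ((v0.1 + i%:Z)%R, sel (v0.1 + i%:Z)%R t)) i))%E).
  apply: lee_sum => i _; rewrite /= indic_in ?mule1.
    exact: (osc_le_tail lam gD (sel_vertex _ _)).
  apply/in_ball; rewrite metric_sym; apply: selw.
  by rewrite kE lerD2l lez_nat ltnW.
apply: (@sum_le_esum _ _ _ (fun v => a v * (\1_(ball (io v.2) (rad v.1)) w)%:E)%E
  (fun i : nat => ((v0.1 + i%:Z)%R, sel (v0.1 + i%:Z)%R t))).
- by move=> v _; rewrite mule_ge0 ?lee_fin//; exact: a0.
- by move=> i k [] /addrI[].
- by move=> i _; split; [exact: sel_vertex | rewrite /= lerDl].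
Qed.

Let mterm v : measurable_fun [set: TZ]
  (fun w : TZ => (a v * (\1_(ball (io v.2) (rad v.1)) w)%:E)%E).
Proof.
apply: emeasurable_funM; first exact: measurable_cst.
by apply/measurable_EFinP; apply: measurable_indic; exact: measurable_ball_cara.
Qed.

Let cV (P : set (int * N)) : countable (vertices XN `&` P).
Proof.
apply: sub_countable (countable_vertices XN lam0 mmN rbN).
by apply: subset_card_le => v [].
Qed.

Lemma near_sum_integral (x : int * Z) n : x.1 - 14 <= n ->
  (\int[cara mu]_w (near_point_sum n w * (\1_(ball x.2 (rad x.1)) w)%:E) <=
   (CZ * 2 `^ (- (x.1 - 14)%:~R * Q))%:E * near_sum a x)%E.
Proof.
move=> xn; pose S := vertices XN `&` near_rel x.
pose f v (w : Z) := (a v * (\1_(ball (io v.2) (rad v.1)) w)%:E)%E.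
have f0 v w : (0 <= f v w)%E by rewrite mule_ge0 ?lee_fin//; exact: a0.
apply: (@le_trans _ _ (\int[cara mu]_w \esum_(v in S) f v w)%E).
  apply: le_integral_nonmeasurable => w; first by rewrite mule_ge0 ?lee_fin//; exact: S0.
  have [/in_ball xw|xw] := pselect (ball x.2 (rad x.1) w); last first.
    by rewrite (indic_notin xw) mule0; apply: esum_ge0 => v _.
  rewrite indic_in ?mule1; last exact/in_ball.
  rewrite /near_point_sum esum_mkcond [leRHS]esum_mkcond; apply: le_esum => v _.
  case: ifPn => [/set_mem [Vv nv]|_]; last by case: ifP.
  have [/in_ball vw|vw] := pselect (ball (io v.2) (rad v.1) w).
    rewrite mem_set//; split => //; split; first exact: le_trans xn nv.
    apply: le_lt_trans (metric_triangle _ w _) _; rewrite (metric_sym w); exact: ltrD.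
  by rewrite (indic_notin vw) mule0; case: ifP.
rewrite (integral_esum (cara mu) (cV _)); last 2 first.
- by move=> v _; exact: mterm.
- by move=> v w _; exact: f0.
rewrite -esumZl ?lee_fin ?mulr_ge0 ?powR_ge0 ?(ltW CZ0)//; last first.
  by move=> v _; rewrite mule_ge0 ?lee_fin ?powR_ge0//; exact: a0.
apply: le_esum => v _; rewrite /f integral_cst_indic//; last exact: measurable_ball_cara.
apply: le_trans (lee_wpmul2l (a0 v) (rbZ.2 (io v.2) _ (rad_gt0 v.1)).1) _.
rewrite muleC muleA -EFinM; apply: lee_wpmul2r => //.
rewrite lee_fin rad_powR -mulrA -powRD_pos//; apply: ler_wpM2l; first exact: ltW.
by rewrite le_eqVlt; apply/orP; left; apply/eqP; congr (_ `^ _); rewrite [(v.1 - _)%:~R]intrB; ring.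
Qed.

Lemma ext_near_integral (x : int * Z) (z : Z) (r : R) v0 : vertices XN v0 -> x.1 - 14 <= v0.1 ->
  ball z r `<=` ball x.2 (rad x.1) ->
  (forall w, ball x.2 (rad x.1) w ->
    128 * io_dist io w <= rad v0.1 /\ mdist w (io v0.2) <= 3 / 4 * rad v0.1) ->
  (\int[cara mu]_w (`|ext nu io g w - bavg nu g v0| * \1_(ball z r) w)%:E <=
   ((E + 2) * (CZ * 2 `^ (- (x.1 - 14)%:~R * Q)))%:E * near_sum a x)%E.
Proof.
move=> V0 xv0 zx H; have E20 : 0 <= E + 2 by exact: addr_ge0 E0 (ler0n _ 2).
rewrite (EFinM (E + 2)) -muleA.
apply: le_trans (lee_wpmul2l _ (near_sum_integral xv0)); last by rewrite lee_fin.
have I0 w : (0 <= near_point_sum v0.1 w * (\1_(ball x.2 (rad x.1)) w)%:E)%E.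
  by rewrite mule_ge0 ?lee_fin//; exact: S0.
have mI : measurable_fun [set: TZ]
    (fun w : TZ => near_point_sum v0.1 w * (\1_(ball x.2 (rad x.1)) w)%:E)%E.
  apply: emeasurable_funM.
    apply: (measurable_esum (cV _)) => [v _|v w _]; first exact: mterm.
    by rewrite mule_ge0 ?lee_fin//; exact: a0.
  by apply/measurable_EFinP; apply: measurable_indic; exact: measurable_ball_cara.
rewrite -ge0_integralZl//; apply: ae_le_integral_nonmeasurable.
- by move=> w; rewrite lee_fin mulr_ge0.
- by move=> w; rewrite mule_ge0 ?lee_fin.
- by apply: emeasurable_funM => //; exact: measurable_cst.
apply: negligibleS (range_negligible XN io_isometry lam0 mmZ mmN rbZ rbN lamQ cF) => w /= nw.
apply: contrapT => /io_dist_gt0 d0; apply: nw.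
have [zw|zw] := pselect (ball z r w); last first.
  by rewrite (indic_notin zw) mulr0 mule_ge0 ?lee_fin.
rewrite (indic_in zw) mulr1 indic_in ?mule1; last exact: zx.
by have [h1 h2] := H w (zx w zw); exact: ext_near_pointwise.
Qed.

(** Off the subset the superlevel sets are open, by the Lipschitz estimate at an adapted vertex; on
    the closed subset the extension is 0. *)
Lemma measurable_ext : (forall v, vertices XN v -> (a v < +oo)%E) ->
  measurable_fun [set: TZ] (ext nu io g : TZ -> R).
Proof.
move=> afin; have extF w : range io w -> ext nu io g w = 0.
  move=> Fw; have d0 : io_dist io w = 0 by apply: dist_to_eq0.
  rewrite /ext [X in X / _](_ : _ = 0) ?mul0r// /ext_num.
  rewrite (_ : (fun t => _) = fun=> 0) ?Rintegral_cst// ?mul0r//.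
  apply/funext => t; apply/eqP; rewrite mulf_eq0; apply/orP; left.
  by rewrite eq_le kern_ge0 -{1}d0 kern_le.
apply: (measurability _ (RGenOInfty.measurableE R)) => //.
move=> _ [_ [c ->] <-]; rewrite setTI.
have -> : ext nu io g @^-1` `]c, +oo[%classic =
    (~` range io `&` ext nu io g @^-1` `]c, +oo[%classic) `|`
    (range io `&` [set _ | c < 0]).
  apply/seteqP; split => w /=.
    rewrite in_itv/= andbT => cw; have [Fw|Fw] := pselect (range io w); last by left.
    by right; split => //; rewrite -(extF w Fw).
  by move=> [[]//|[Fw c0]]; rewrite in_itv/= andbT extF.
have mF : measurable (range io : set TZ) by exact: closed_caratheodory.
apply: measurableU; last first.
  have [c0|c0] := ltP c 0.
    by rewrite (_ : [set _ | _] = setT) ?setIT//; apply/seteqP; split.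
  by rewrite (_ : [set _ | _] = set0) ?setI0//; apply/seteqP; split.
apply: open_caratheodory => //; rewrite openE => w [nF /=].
rewrite in_itv/= andbT => cw; apply/nbhs_ballP.
have d0 := io_dist_gt0 nF.
have [j [v [jd Vv vj wv ad]]] := exists_adapted d0.
have rv := @rad_gt0 R v.1; have avf := afin v Vv.
pose av := fine (a v); have av0 : 0 <= av by rewrite fine_ge0.
have avE : a v = av%:E by rewrite fineK// ge0_fin_numE.
pose r := (ext nu io g w - c) / (L / rad v.1 * av + 1).
have den : 0 < L / rad v.1 * av + 1.
  exact: ltr_wpDl (mulr_ge0 (divr_ge0 L0 (ltW rv)) av0) ltr01.
have r0 : 0 < r by rewrite divr_gt0// subr_gt0.
exists (Num.min r (io_dist io w / 4)) => /=; first by rewrite lt_min r0 divr_gt0.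
move=> y /in_ball; rewrite lt_min => /andP[wr wd].
split; first by move=> Fy; have := io_dist_triangle w y; rewrite [io_dist io y]dist_to_eq0//; lra.
rewrite /= in_itv/= andbT.
have adw : adapted io w v by apply: ad; rewrite mdistxx divr_ge0 ?ltW.
have ady : adapted io y v by apply: ad; exact: ltW.
have := ext_lipschitz io_isometry mmN rbN gi A0 a0 ga Vv adw ady.
rewrite avE -EFinM lee_fin -/L => h.
have h' : L * (mdist w y / rad v.1) * av < ext nu io g w - c.
  apply: (@le_lt_trans _ _ (mdist w y * (L / rad v.1 * av + 1))).
    rewrite mulrDr mulr1 (_ : L * _ * av = mdist w y * (L / rad v.1 * av)); last by ring.
    by rewrite lerDl mdist_ge0.
  by rewrite -ltr_pdivlMr.
by move: (le_lt_trans h h'); rewrite ltr_norml => /andP[_]; lra.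
Qed.

Lemma locint_ext_real : (forall v, vertices XN v -> (a v < +oo)%E) ->
  (forall x, vertices XZ x -> (near_sum a x < +oo)%E) -> locint mu (ext nu io g).
Proof.
move=> afin bfin; apply: (locint_oscillation mmZ) => [|z r]; first exact: measurable_ext.
have [x [Vx x0 xr zx]] := exists_big_vertex XZ z (Num.max r (mdist z (io point))).
have rx := @rad_gt0 R x.1.
have m1 : r <= rad x.1 / 4 by apply: le_trans xr; rewrite le_max lexx.
have m2 : mdist z (io point) <= rad x.1 / 4 by apply: le_trans xr; rewrite le_max lexx orbT.
pose v0 := (x.1 - 13, sel (x.1 - 13) point).
have r13 : rad (x.1 - 13) = 8192 * rad x.1 :> R.
  by rewrite (rad_sub x.1 13); congr (_ * _); ring.
exists (bavg nu g v0); apply: le_lt_trans (ext_near_integral (x := x) (v0 := v0) _ _ _ _) _.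
- exact: sel_vertex.
- by rewrite /= lerD2l lerN2.
- move=> w /in_ball zw; apply/in_ball; apply: le_lt_trans (metric_triangle _ z _) _.
  by rewrite metric_sym; lra.
- move=> w /in_ball xw.
  have wp : mdist w (io point) < 2 * rad x.1.
    apply: le_lt_trans (metric_triangle _ x.2 _) _.
    have := metric_triangle x.2 z (io point); rewrite (metric_sym x.2 z) (metric_sym w).
    lra.
  have := io_dist_le io w point => dw.
  have near := sel_near (x.1 - 13) point; rewrite r13 in near.
  rewrite /v0/= r13; split; first by lra.
  have := metric_triangle w (io point) (io (sel (x.1 - 13) point)).
  rewrite io_isometry; lra.
- rewrite lte_mul_pinfty ?bfin// lee_fin.
  exact: mulr_ge0 (addr_ge0 E0 (ler0n _ 2)) (mulr_ge0 (ltW CZ0) (powR_ge0 _ _)).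
Qed.

End real_function.

End extension_estimates.

(** Origin of the 13 levels in [cext_edge_near], 2^13 being 8192: with r = rad n for an edge of
    level n <= j + 4, points of its balls have distance below 32 r + 6 r from the subset, and 128
    times 38 lies between 2^12 and 2^13. *)
Lemma near_scale_arith {R : realType} (r dy dw rj yw wv yv : R) : 0 < r ->
  dw < 2 * rj -> rj <= 16 * r -> dy <= dw + yw -> yw < 6 * r ->
  wv < 3 / 2 * dw + 4096 * r -> yv <= yw + wv ->
  128 * dy <= 8192 * r /\ yv <= 3 / 4 * (8192 * r).
Proof. by move=> *; split; lra. Qed.

Lemma mdist_lt_double {R : realType} {M : pmetricType R} (x y z : M) (r : R) :
  mdist z x < 3 * r -> mdist z y < 3 * r -> mdist x y < 6 * r.
Proof.
move=> zx zy; apply: le_lt_trans (metric_triangle _ z _) _.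
by rewrite (metric_sym x); lra.
Qed.

(** * Edge differences of the extension *)

Section complex_extension.
Context {R : realType} {Z N : pmetricType R}.
Context (mu : {outer_measure set Z -> \bar R}) (nu : {outer_measure set N -> \bar R}).
Context (XZ : @hyperbolic_filling R Z) (XN : @hyperbolic_filling R N).
Context (Q lam CZ CN : R) (io : N -> Z).
Hypothesis io_isometry : forall x y, mdist (io x) (io y) = mdist x y.
Hypothesis (Q0 : 0 < Q) (lam0 : 0 < lam) (lamQ : lam < Q).
Hypothesis (mmZ : metric_measure_space mu) (mmN : metric_measure_space nu).
Hypothesis (rbZ : regular_bounds mu Q CZ) (rbN : regular_bounds nu lam CN).
Hypothesis cF : closed (range io).
Let TZ := caratheodory_type mu.
Let CZ0 : 0 < CZ. Proof. by apply: lt_le_trans rbZ.1. Qed.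
Variable sel : int -> N -> N.
Hypothesis sel_vertex : forall n t, vertices XN (n, sel n t).
Hypothesis sel_near : forall n t, mdist t (sel n t) < rad n / 2.

Definition cext (g : N -> R[i]) (w : Z) : R[i] :=
  Complex (ext nu io (fun y => complex.Re (g y)) w)
          (ext nu io (fun y => complex.Im (g y)) w).

Variables (g : N -> R[i]) (A : R).
Let D := osc XN (discretize nu g).
Let a := osc_tail XN lam id D.
Let b := near_sum XN Q io a.
Hypothesis gL : L1loc nu g.
Hypothesis A0 : 0 <= A.
Hypothesis afin : forall v, vertices XN v -> (a v < +oo)%E.
Hypothesis bfin : forall x, vertices XZ x -> (b x < +oo)%E.
Let RE := fun y => complex.Re (g y).
Let IM := fun y => complex.Im (g y).
Let osc_bound (h : N -> R) := forall v, vertices XN v ->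
  (Iabs nu (ball v.2 (rad v.1)) (fun t => (h t - bavg nu h v)%R) <=
    (A * 2 `^ (- v.1%:~R * lam))%:E * a v)%E.
Hypothesis (gaR : osc_bound RE) (gaI : osc_bound IM).
Let gi : locint nu RE. Proof. exact: (L1loc_locint gL).1. Qed.
Let gj : locint nu IM. Proof. exact: (L1loc_locint gL).2. Qed.
Let dR : dominates XN (bavg nu RE) D. Proof. exact: dominates_Re. Qed.
Let dI : dominates XN (bavg nu IM) D. Proof. exact: dominates_Im. Qed.
Let a0 v : (0 <= a v)%E.
Proof. by apply: esum_ge0 => x _; rewrite mule_ge0 ?lee_fin ?powR_ge0//; exact: osc_ge0. Qed.
Let b0 x : (0 <= b x)%E. Proof. exact: near_sum_ge0. Qed.
Let E := ext_const lam CN A.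
Let E0 : 0 <= E. Proof. exact: (ext_const_ge0 rbN A0). Qed.
Let L := ext_lip_const lam CN A.
Let L0 : 0 <= L. Proof. exact: (ext_lip_const_ge0 rbN A0). Qed.

Let locR : locint mu (ext nu io RE).
Proof.
exact: (locint_ext_real io_isometry lam0 lamQ mmZ mmN rbZ rbN cF sel_vertex
  sel_near gi dR A0 gaR afin bfin).
Qed.

Let locI : locint mu (ext nu io IM).
Proof.
exact: (locint_ext_real io_isometry lam0 lamQ mmZ mmN rbZ rbN cF sel_vertex
  sel_near gj dI A0 gaI afin bfin).
Qed.

Lemma cext_L1loc : L1loc mu (cext g).
Proof. exact: locint_L1loc. Qed.

Let bavg_far (h : N -> R) x w j v : locint nu h -> osc_bound h -> locint mu (ext nu io h) ->
  rad j <= io_dist io w -> vertices XN v -> v.1 = j - 6 ->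
  (forall y, mdist w y <= io_dist io w / 4 -> adapted io y v) ->
  forall n, j + 5 <= n -> (forall y, ball x.2 (rad x.1) y -> mdist w y < 6 * rad n) ->
  `|bavg mu (ext nu io h) x - ext nu io h w| <= L * (6 * rad n / rad v.1) * fine (a v).
Proof.
move=> hi hb lh jw Vv vj ad n jn xw; rewrite -lee_fin.
have rv := @rad_gt0 R v.1; have rn := @rad_gt0 R n.
have jE : rad j = 32 * rad (j + 5) :> R by rewrite (rad_add j 5); congr (_ * _); ring.
have nj := @le_rad R _ _ jn.
have avE : a v = (fine (a v))%:E by rewrite fineK// ge0_fin_numE// afin.
have av0 : 0 <= fine (a v) by rewrite fine_ge0.
apply: ravg_dist_const => //; first exact: rad_gt0.
  rewrite lee_fin; apply: mulr_ge0 => //; apply: mulr_ge0 => //.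
  by apply: divr_ge0; [rewrite mulr_ge0 ?ltW | exact: ltW].
move=> y /xw wy.
have adw : adapted io w v by apply: ad; rewrite mdistxx; lra.
have ady : adapted io y v by apply: ad; lra.
apply: le_trans (ext_lipschitz io_isometry mmN rbN hi A0 a0 hb Vv ady adw) _.
rewrite avE -EFinM lee_fin; apply: ler_wpM2r => //; apply: ler_wpM2l => //.
by rewrite ler_pM2r ?invr_gt0// metric_sym ltW.
Qed.

(** Both balls lie within 6 rad n <= (6 / 32) rad j of w, which is less than a quarter of the
    distance of w, so the vertex adapted to w serves all their points. The Lipschitz estimate gives
    rad n / rad v.1 = 2^(-(n - j)) / 64, and 24 / 64 <= 1 absorbs the remaining factors. *)
Lemma cext_edge_far e w j v : edges XZ e -> eball e w ->
  rad j <= io_dist io w -> vertices XN v -> v.1 = j - 6 ->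
  (forall y, mdist w y <= io_dist io w / 4 -> adapted io y v) ->
  j + 5 <= elevel e ->
  ((edge_diff mu (cext g) e)%:E <= (L * 2 `^ (- (elevel e - j)%:~R))%:E * a v)%E.
Proof.
move=> Xe ew jw Vv vj ad jn; set n := elevel e in jn *.
have sub x : x = e.1 \/ x = e.2 -> forall y, ball x.2 (rad x.1) y -> mdist w y < 6 * rad n.
  move=> xe y xy; have [w1 _] := edge_near Xe ew.
  have [y1 _] : mdist e.1.2 y < 3 * rad n /\ mdist e.2.2 y < 3 * rad n.
    by apply: (edge_near Xe); case: xe xy => -> xy; [left|right]; rewrite vballE.
  exact: (mdist_lt_double w1 y1).
have R1 := bavg_far gi gaR locR jw Vv vj ad jn (sub e.1 (or_introl erefl)).
have R2 := bavg_far gi gaR locR jw Vv vj ad jn (sub e.2 (or_intror erefl)).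
have I1 := bavg_far gj gaI locI jw Vv vj ad jn (sub e.1 (or_introl erefl)).
have I2 := bavg_far gj gaI locI jw Vv vj ad jn (sub e.2 (or_intror erefl)).
have avE : a v = (fine (a v))%:E by rewrite fineK// ge0_fin_numE// afin.
rewrite avE -EFinM lee_fin.
apply: le_trans (@edge_diff_le_bavg _ _ mu (cext g) e _ _ _ R1 R2 I1 I2) _.
rewrite mulrA; apply: ler_wpM2r; first by rewrite fine_ge0.
have rE : rad n / rad v.1 = 2 `^ (- (n - j)%:~R) / 64 :> R.
  rewrite vj (rad_sub j 6) (_ : 2 ^+ 6 = 64); last by ring.
  have -> : 2 `^ (- (n - j)%:~R) = rad n / rad j :> R.
    by rewrite /rad -powRN -powRD_pos//; congr (_ `^ _); rewrite intrB; ring.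
  by field; rewrite gt_eqF// rad_gt0.
rewrite (_ : 4 * _ = L * (24 * (rad n / rad v.1))); last by ring.
apply: ler_wpM2l => //; rewrite rE mulrCA.
by apply: ler_piMr; [exact: powR_ge0 | rewrite ler_pdivrMr// mul1r ler_nat].
Qed.

(** The 4 stands for two real parts at two endpoints, one CZ for the lower and one for the upper
    volume bound, and 2^(14 Q) for the shift of levels in [near_sum]. *)
Definition near_const : R := 4 * (CZ * (ext_const lam CN A + 2) * CZ * 2 `^ (14 * Q)).

Lemma near_const_ge0 : 0 <= near_const.
Proof.
have e2 : 0 <= ext_const lam CN A + 2 by exact: addr_ge0 E0 (ler0n _ 2).
exact: mulr_ge0 (ler0n _ 4) (mulr_ge0 (mulr_ge0 (mulr_ge0 (ltW CZ0) e2) (ltW CZ0)) (powR_ge0 _ _)).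
Qed.

Lemma bavg_ext_near (h : N -> R) x v0 : locint nu h -> dominates XN (bavg nu h) D ->
  osc_bound h -> locint mu (ext nu io h) ->
  vertices XZ x -> essential Z (rad x.1 : R) -> vertices XN v0 -> x.1 - 14 <= v0.1 ->
  (forall w, ball x.2 (rad x.1) w ->
    128 * io_dist io w <= rad v0.1 /\ mdist w (io v0.2) <= 3 / 4 * rad v0.1) ->
  `|bavg mu (ext nu io h) x - bavg nu h v0| <= near_const / 4 * fine (b x).
Proof.
move=> hi hd hb lh Vx ess V0 xv0 H; rewrite -lee_fin; have rx := @rad_gt0 R x.1.
have bE : b x = (fine (b x))%:E by rewrite fineK// ge0_fin_numE// bfin.
rewrite EFinM -bE.
apply: le_trans (dist_ravg_le mmZ x.2 _ rx lh) _.
have near := ext_near_integral io_isometry lam0 lamQ mmZ mmN rbZ rbN cF sel_vertex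
  sel_near hi hd A0 hb V0 xv0 (@subset_refl _ _) H.
apply: le_trans (lee_wpmul2l _ near) _; first by rewrite lee_fin invr_ge0 ltW// fine_ball_gt0.
rewrite muleA -EFinM; apply: lee_wpmul2r; first exact: b0.
rewrite lee_fin; have e2 : 0 <= ext_const lam CN A + 2 by exact: addr_ge0 E0 (ler0n _ 2).
have inv := fine_ball_inv_le mmZ x.2 rbZ rx ess.
apply: (@le_trans _ _ (CZ * rad x.1 `^ (- Q) *
    ((ext_const lam CN A + 2) * (CZ * 2 `^ (- (x.1 - 14)%:~R * Q))))).
  by apply: ler_wpM2r inv; exact: mulr_ge0 e2 (mulr_ge0 (ltW CZ0) (powR_ge0 _ _)).
have P : rad x.1 `^ (- Q) * 2 `^ (- (x.1 - 14)%:~R * Q) = 2 `^ (14 * Q) :> R.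
  by rewrite rad_powR -powRD_pos//; congr (_ `^ _); rewrite intrB; ring.
rewrite /near_const -P le_eqVlt; apply/orP; left; apply/eqP; by field.
Qed.

(** The edge is long compared with the distance of w. Its endpoint averages are compared with the
    average of g at a vertex 13 levels coarser than the edge, selected at a point of the subset
    close to w. An endpoint may be one level finer than the edge, whence the 14 in [near_rel]. *)
Lemma cext_edge_near e w j : edges XZ e -> eball e w -> 0 < io_dist io w ->
  io_dist io w < 2 * rad j -> elevel e <= j + 4 ->
  ((edge_diff mu (cext g) e)%:E <= near_const%:E * (b e.1 + b e.2))%E.
Proof.
move=> Xe ew d0 dj nj; have [V1 V2 lE l12 l21] := edge_levels Xe.
have [ess|iness] := pselect (essential Z (rad (elevel e) : R)); last first.
  by rewrite (inessential_edge_diff mu _ Xe iness) mule_ge0 ?adde_ge0// lee_fin near_const_ge0.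
set n := elevel e in nj ess lE *.
have rn := @rad_gt0 R n.
have jn : rad j <= 16 * rad n :> R.
  have jE : rad j = 16 * rad (j + 4) :> R by rewrite (rad_add j 4); congr (_ * _); ring.
  have nj' : rad (j + 4) <= rad n :> R by exact: le_rad.
  by rewrite jE ler_pM2l.
have [t wt] := io_dist_near d0.
pose v0 := (n - 13, sel (n - 13) t).
have r13 : rad (n - 13) = 8192 * rad n :> R.
  by rewrite (rad_sub n 13); congr (_ * _); ring.
have near := sel_near (n - 13) t.
rewrite r13 (_ : 8192 * rad n / 2 = 4096 * rad n) in near; last by field.
have wv0 : mdist w (io v0.2) < 3 / 2 * io_dist io w + 4096 * rad n.
  apply: le_lt_trans (metric_triangle _ (io t) _) _; rewrite io_isometry /=.
  exact: ltrD.
have H y : eball e y -> 128 * io_dist io y <= rad v0.1 /\ mdist y (io v0.2) <= 3 / 4 * rad v0.1.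
  move=> ey; have [w1 _] := edge_near Xe ew; have [y1 _] := edge_near Xe ey.
  rewrite [rad v0.1]r13; exact: (near_scale_arith rn dj jn (io_dist_triangle io y w)
    (mdist_lt_double y1 w1) wv0 (metric_triangle y w (io v0.2))).
have H1 y : ball e.1.2 (rad e.1.1) y -> _ /\ _ := fun h => H y (or_introl (eq_ind_r (fun X : set Z => X y) h (vballE e.1))).
have H2 y : ball e.2.2 (rad e.2.1) y -> _ /\ _ := fun h => H y (or_intror (eq_ind_r (fun X : set Z => X y) h (vballE e.2))).
have Vv0 : vertices XN v0 by exact: sel_vertex.
have ess1 : essential Z (rad e.1.1 : R) by rewrite -lE.
have ess2 : essential Z (rad e.2.1 : R) by apply: essential_le ess1; exact: le_rad.
have le1 : e.1.1 - 14 <= v0.1 by rewrite -lE /= lerD2l lerN2.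
have le2 : e.2.1 - 14 <= v0.1.
  by rewrite /= lE lerBlDr (le_trans l21)// -addrA lerD2l.
pose c := near_const / 4; have c0 : 0 <= c by rewrite divr_ge0 ?near_const_ge0.
pose B := fine (b e.1) + fine (b e.2).
have bE x : vertices XZ x -> b x = (fine (b x))%:E.
  by move=> Vx; rewrite fineK// ge0_fin_numE// bfin.
have f0 x : 0 <= fine (b x) by rewrite fine_ge0.
have up1 r : r <= c * fine (b e.1) -> r <= c * B.
  by move=> h; apply: le_trans h _; apply: ler_wpM2l => //; rewrite lerDl.
have up2 r : r <= c * fine (b e.2) -> r <= c * B.
  by move=> h; apply: le_trans h _; apply: ler_wpM2l => //; rewrite lerDr.
have R1 := up1 _ (bavg_ext_near gi dR gaR locR V1 ess1 Vv0 le1 H1).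
have R2 := up2 _ (bavg_ext_near gi dR gaR locR V2 ess2 Vv0 le2 H2).
have I1 := up1 _ (bavg_ext_near gj dI gaI locI V1 ess1 Vv0 le1 H1).
have I2 := up2 _ (bavg_ext_near gj dI gaI locI V2 ess2 Vv0 le2 H2).
rewrite (bE _ V1) (bE _ V2) -EFinD -EFinM lee_fin -/B.
apply: le_trans (@edge_diff_le_bavg _ _ mu (cext g) e _ _ _ R1 R2 I1 I2) _.
by rewrite /c mulrA le_eqVlt; apply/orP; left; apply/eqP; congr (_ * _); field.
Qed.

End complex_extension.

Lemma le_lq_norm_support {R : realType} (I : choiceType) (q : \bar R) (S P : set I)
    (a : I -> \bar R) : (0 < q)%E -> (forall i, S i -> (0 <= a i)%E) ->
  (forall i, S i -> ~ P i -> a i = 0%E) -> (lq_norm q S a <= lq_norm q (S `&` P) a)%E.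
Proof.
case: q => [r r0|_|//] a0 aP; last first.
  apply: ge_ereal_sup => _ [->|[i Si <-]]; first by apply: ereal_sup_ubound; left.
  have [Pi|Pi] := pselect (P i); first by apply: ereal_sup_ubound; right; exists i.
  by rewrite aP//; apply: ereal_sup_ubound; left.
rewrite lte_fin in r0; apply: le_poweR; first by rewrite invr_ge0 ltW.
  by apply: esum_ge0 => i _; exact: poweR_ge0.
rewrite esum_mkcond [leRHS]esum_mkcond; apply: le_esum => i _.
case: ifPn => [/set_mem Si|_]; last by case: ifP => // _; exact: poweR_ge0.
have [Pi|Pi] := pselect (P i); first by rewrite mem_set.
by rewrite aP// poweR0r ?gt_eqF//; case: ifP.
Qed.

Lemma poweR_le_inv {R : realType} (x : \bar R) (m p : R) : 0 < p -> (0 <= x)%E -> 0 <= m ->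
  (x `^ p <= m%:E `^ p)%E -> (x <= m%:E)%E.
Proof.
move=> p0 x0 m0 h; rewrite -(poweRVK p0 x0) -[leRHS](poweRVK p0) ?lee_fin//.
by apply: le_poweR; rewrite ?invr_ge0 ?(ltW p0) ?poweR_ge0.
Qed.

Lemma far_exponent {R : realType} (d s ka : R) : 0 <= d -> ka <= 1 - s ->
  - d * (1 - s) <= - `|d| * ka.
Proof. by move=> d0 h; rewrite ger0_norm// !mulNr lerN2 ler_wpM2l. Qed.

(** For 0 <= d <= 4 both d e and d ka are at most 4 e, whence the 8 e; for d < 0 the decay at rate e
    dominates the one at rate ka. *)
Lemma near_exponent {R : realType} (d e ka : R) : d <= 4 -> 0 <= ka -> ka <= e ->
  d * e <= 8 * e + - `|d| * ka.
Proof.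
move=> d4 k0 ke; have e0 : 0 <= e by exact: le_trans ke.
have [d0|d0] := leP 0 d.
  rewrite ger0_norm//; have h1 : d * e <= 4 * e by rewrite ler_wpM2r.
  have h2 : d * ka <= 4 * e by rewrite (le_trans (ler_wpM2l d0 ke)).
  lra.
rewrite ltr0_norm// opprK.
have h : d * e <= d * ka by rewrite ler_wnM2l// ltW.
lra.
Qed.

Lemma int_lt_add5 (n j : int) : n < j + 5 -> n <= j + 4.
Proof. by lia. Qed.

Lemma int_le_add5 (k n j : int) : k <= n + 1 -> n <= j + 4 -> k <= j + 5.
Proof. by lia. Qed.

(** * The Triebel-Lizorkin norm of the extension *)

Section triebel_upper_bound.
Context {R : realType} {Z N : pmetricType R}.
Context (mu : {outer_measure set Z -> \bar R}) (nu : {outer_measure set N -> \bar R}).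
Context (XZ : @hyperbolic_filling R Z) (XN : @hyperbolic_filling R N).
Context (Q lam CZ CN : R) (io : N -> Z).
Hypothesis io_isometry : forall x y, mdist (io x) (io y) = mdist x y.
Hypothesis (Q0 : 0 < Q) (lam0 : 0 < lam) (lamQ : lam < Q).
Hypothesis (mmZ : metric_measure_space mu) (mmN : metric_measure_space nu).
Hypothesis (rbZ : regular_bounds mu Q CZ) (rbN : regular_bounds nu lam CN).
Hypothesis cF : closed (range io).
Let TZ := caratheodory_type mu.
Let CZ0 : 0 < CZ. Proof. by apply: lt_le_trans rbZ.1. Qed.
Let F0 := range_io0 io.
Variable sel : int -> N -> N.
Hypothesis sel_vertex : forall n t, vertices XN (n, sel n t).
Hypothesis sel_near : forall n t, mdist t (sel n t) < rad n / 2.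
Variables (s p : R) (q : \bar R).
Hypothesis (s01 : 0 < s < 1) (p0 : 0 < p) (q0 : (0 < q)%E).

(** Half of the codimension: d^(-ep) is integrable near the subset and leaves a decay ep / p for
    edges of low level. [ka] is the smaller of this rate and the rate 1 - s for edges of high
    level. *)
Let ep := (Q - lam) / 2.
Let ep0 : 0 < ep. Proof. by rewrite divr_gt0// subr_gt0. Qed.
Let epQ : ep < Q - lam. Proof. by rewrite ltr_pdivrMr// ltr_pMr ?subr_gt0// ltr1n. Qed.
Let ka := Num.min (1 - s) (ep / p).
Let ka0 : 0 < ka.
Proof. by rewrite lt_min subr_gt0 (andP s01).2 divr_gt0. Qed.

(** The norm estimate uses the extension only through these two bounds, for edges short and long
    compared with the distance to the subset. *)
Definition edge_bounds (f : Z -> R[i]) (a : int * N -> \bar R) (b : int * Z -> \bar R)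
    (L C : R) : Prop :=
  (forall e w j v, edges XZ e -> eball e w -> rad j <= io_dist io w -> vertices XN v ->
    v.1 = j - 6 -> (forall y, mdist w y <= io_dist io w / 4 -> adapted io y v) ->
    j + 5 <= elevel e ->
    ((edge_diff mu f e)%:E <= (L * 2 `^ (- (elevel e - j)%:~R))%:E * a v)%E) /\
  (forall e w j, edges XZ e -> eball e w -> 0 < io_dist io w ->
    io_dist io w < 2 * rad j -> elevel e <= j + 4 ->
    ((edge_diff mu f e)%:E <= C%:E * (b e.1 + b e.2))%E).

Section majorant.
Variables (a : int * N -> \bar R) (b : int * Z -> \bar R).
Hypothesis (a0 : forall v, (0 <= a v)%E) (b0 : forall x, (0 <= b x)%E).

Let Xt v := ((2 `^ (v.1%:~R * (s * p)))%:E * a v `^ p)%E.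
Let Yt x := ((2 `^ (x.1%:~R * (s * p - ep)))%:E * b x `^ p)%E.
(** A vertex x is charged at points w of dyadic distance level j with x.1 <= j + 5 and within 6 rad
    x.1 of x. So the levels start at x.1 - 5, and [W] cuts off at 4 rad (x.1 - 1) = 8 rad x.1; both
    are written in the form of [weight_integral] for level x.1 - 1. *)
Let wsum (x : int * Z) (w : Z) : \bar R :=
  (\esum_(v in vertices XN `&` [set v | (x.1 - 1 - 4%:Z <= v.1)%R])
    ((2 `^ (v.1%:~R * ep))%:E * (\1_(ball (io v.2) (3 * rad v.1)) w)%:E))%E.
Let W x w := ((\1_(ball x.2 (4 * rad (x.1 - 1))) w)%:E * wsum x w)%E.

(* The second sum charges x at the points w lying at distance about rad j from
   the subset with a weight increasing in j: this is the gain [ep], available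
   because the subset has smaller dimension. *)
Definition majorant (w : Z) : \bar R :=
  (\esum_(v in vertices XN) (Xt v * (\1_(ball (io v.2) (rad v.1)) w)%:E) +
   \esum_(x in vertices XZ) (Yt x * W x w))%E.

Let X0 v : (0 <= Xt v)%E. Proof. by rewrite mule_ge0 ?lee_fin ?powR_ge0 ?poweR_ge0. Qed.
Let Y0 x : (0 <= Yt x)%E. Proof. by rewrite mule_ge0 ?lee_fin ?powR_ge0 ?poweR_ge0. Qed.
Let ws0 x w : (0 <= wsum x w)%E.
Proof. by apply: esum_ge0 => v _; rewrite mule_ge0 ?lee_fin ?powR_ge0. Qed.
Let W0 x w : (0 <= W x w)%E. Proof. by rewrite mule_ge0 ?lee_fin. Qed.

Let mind z r : measurable_fun [set: TZ] (fun w : TZ => (\1_(ball z r) w)%:E : \bar R).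
Proof. by apply/measurable_EFinP; apply: measurable_indic; exact: measurable_ball_cara. Qed.

Let cN (P : set (int * N)) : countable (vertices XN `&` P).
Proof.
apply: sub_countable (countable_vertices XN lam0 mmN rbN).
by apply: subset_card_le => v [].
Qed.

Let mW x : measurable_fun [set: TZ] (W x : TZ -> \bar R).
Proof.
apply: emeasurable_funM; first exact: mind.
apply: (measurable_esum (cN _)) => [v _|v w _]; last by rewrite mule_ge0 ?lee_fin ?powR_ge0.
by apply: emeasurable_funM; [exact: measurable_cst | exact: mind].
Qed.

Let mM1 : measurable_fun [set: TZ] (fun w : TZ =>
  \esum_(v in vertices XN) (Xt v * (\1_(ball (io v.2) (rad v.1)) w)%:E))%E.
Proof.
apply: (measurable_esum (countable_vertices XN lam0 mmN rbN)) => [v _|v w _].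
  by apply: emeasurable_funM; [exact: measurable_cst | exact: mind].
by rewrite mule_ge0 ?lee_fin.
Qed.

Let mM2 : measurable_fun [set: TZ] (fun w : TZ => \esum_(x in vertices XZ) (Yt x * W x w))%E.
Proof.
apply: (measurable_esum (countable_vertices XZ Q0 mmZ rbZ)) => [x _|x w _].
  by apply: emeasurable_funM; [exact: measurable_cst | exact: mW].
exact: mule_ge0.
Qed.

Let M10 w : (0 <= \esum_(v in vertices XN) (Xt v * (\1_(ball (io v.2) (rad v.1)) w)%:E))%E.
Proof. by apply: esum_ge0 => v _; rewrite mule_ge0 ?lee_fin. Qed.
Let M20 w : (0 <= \esum_(x in vertices XZ) (Yt x * W x w))%E.
Proof. by apply: esum_ge0 => x _; exact: mule_ge0. Qed.

Lemma majorant_ge0 w : (0 <= majorant w)%E. Proof. exact: adde_ge0. Qed.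

Lemma measurable_majorant : measurable_fun [set: TZ] (majorant : TZ -> \bar R).
Proof. exact: emeasurable_funD. Qed.

Lemma integral_majorant (K : R) : 0 <= K -> (forall (z : Z) (n : int),
  (\int[cara mu]_w ((\1_(ball z (4 * rad n)) w)%:E *
     \esum_(v in vertices XN `&` [set v | (n - 4%:Z <= v.1)%R])
       ((2 `^ (v.1%:~R * ep))%:E * (\1_(ball (io v.2) (3 * rad v.1)) w)%:E))
   <= (K * 2 `^ (n%:~R * (ep - Q)))%:E)%E) ->
  (\int[cara mu]_w majorant w <= (CZ + K * 2 `^ (Q - ep))%:E *
    (\esum_(v in vertices XN) ((2 `^ (v.1%:~R * (s * p - Q)))%:E * a v `^ p) +
     \esum_(x in vertices XZ) ((2 `^ (x.1%:~R * (s * p - Q)))%:E * b x `^ p)))%E.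
Proof.
move=> K0 HK; rewrite ge0_integralD//.
have e1 : (\int[cara mu]_w (\esum_(v in vertices XN) (Xt v * (\1_(ball (io v.2) (rad v.1)) w)%:E)) <=
   CZ%:E * \esum_(v in vertices XN) ((2 `^ (v.1%:~R * (s * p - Q)))%:E * a v `^ p))%E.
  rewrite (integral_esum (cara mu) (countable_vertices XN lam0 mmN rbN)); last 2 first.
  - by move=> v _; apply: emeasurable_funM; [exact: measurable_cst | exact: mind].
  - by move=> v w _; rewrite mule_ge0 ?lee_fin.
  rewrite -esumZl ?lee_fin ?(ltW CZ0)//; last first.
    by move=> v _; rewrite mule_ge0 ?lee_fin ?powR_ge0 ?poweR_ge0.
  apply: le_esum => v _; rewrite (integral_cst_indic _ (measurable_ball_cara mmZ _ _))//.
  apply: le_trans (lee_wpmul2l (X0 v) (rbZ.2 (io v.2) _ (rad_gt0 v.1)).1) _.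
  rewrite /Xt muleC !muleA -!EFinM; apply: lee_wpmul2r; first exact: poweR_ge0.
  rewrite lee_fin rad_powR -mulrA -powRD_pos// le_eqVlt; apply/orP; left; apply/eqP.
  by congr (_ * 2 `^ _); ring.
have e2 : (\int[cara mu]_w (\esum_(x in vertices XZ) (Yt x * W x w)) <=
   (K * 2 `^ (Q - ep))%:E * \esum_(x in vertices XZ) ((2 `^ (x.1%:~R * (s * p - Q)))%:E * b x `^ p))%E.
  rewrite (integral_esum (cara mu) (countable_vertices XZ Q0 mmZ rbZ)); last 2 first.
  - by move=> x _; apply: emeasurable_funM; [exact: measurable_cst | exact: mW].
  - by move=> x w _; exact: mule_ge0.
  rewrite -esumZl ?lee_fin ?mulr_ge0 ?powR_ge0//; last first.
    by move=> x _; rewrite mule_ge0 ?lee_fin ?powR_ge0 ?poweR_ge0.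
  apply: le_esum => x _; rewrite ge0_integralZl//.
  apply: le_trans (lee_wpmul2l (Y0 x) (HK x.2 (x.1 - 1))) _.
  rewrite /Yt muleC !muleA -!EFinM; apply: lee_wpmul2r; first exact: poweR_ge0.
  rewrite lee_fin -!mulrA -!powRD_pos// le_eqVlt; apply/orP; left; apply/eqP.
  by congr (_ * 2 `^ _); rewrite intrB; ring.
have Sa : (0 <= \esum_(v in vertices XN) ((2 `^ (v.1%:~R * (s * p - Q)))%:E * a v `^ p))%E.
  by apply: esum_ge0 => v _; rewrite mule_ge0 ?lee_fin ?powR_ge0 ?poweR_ge0.
have Sb : (0 <= \esum_(x in vertices XZ) ((2 `^ (x.1%:~R * (s * p - Q)))%:E * b x `^ p))%E.
  by apply: esum_ge0 => v _; rewrite mule_ge0 ?lee_fin ?powR_ge0 ?poweR_ge0.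
have KQ0 : 0 <= K * 2 `^ (Q - ep) by rewrite mulr_ge0 ?powR_ge0.
rewrite ge0_muleDr//; apply: leeD.
  by apply: le_trans e1 _; apply: lee_wpmul2r => //; rewrite lee_fin lerDl.
by apply: le_trans e2 _; apply: lee_wpmul2r => //; rewrite lee_fin lerDr ltW.
Qed.

Lemma majorant_tail w v (m : R) : 0 <= m -> (majorant w <= m%:E `^ p)%E ->
  vertices XN v -> mdist w (io v.2) < rad v.1 ->
  (a v <= (2 `^ (- v.1%:~R * s) * m)%:E)%E.
Proof.
move=> m0 Mm Vv wv.
have h : ((2 `^ (v.1%:~R * s))%:E * a v <= m%:E)%E.
  apply: (poweR_le_inv p0) => //; first by rewrite mule_ge0 ?lee_fin ?powR_ge0.
  apply: le_trans Mm; rewrite poweRM ?lee_fin ?powR_ge0// poweR_EFin -powRrM.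
  rewrite -[leLHS]adde0; apply: leeD => //; apply: (@le_trans _ _ (Xt v * (\1_(ball (io v.2) (rad v.1)) w)%:E)%E).
    by rewrite indic_in ?mule1 /Xt ?mulrA//; apply/in_ball; rewrite metric_sym.
  apply: (ge_esum_term (a := fun v => Xt v * (\1_(ball (io v.2) (rad v.1)) w)%:E)%E) => // v' _.
  by rewrite mule_ge0 ?lee_fin.
rewrite mulNr powRN EFinM.
by rewrite lee_pdivlMl ?powR_gt0.
Qed.

(** One vertex of level j selected near w already makes the weight at w at least 2^(j ep); its p-th
    root gives the extra factor 2^(-(j - x.1) ep / p). *)
Lemma majorant_near w j x (m : R) : 0 <= m -> (majorant w <= m%:E `^ p)%E ->
  0 < io_dist io w -> io_dist io w < 2 * rad j -> vertices XZ x -> x.1 <= j + 5 ->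
  mdist x.2 w < 6 * rad x.1 ->
  (b x <= (2 `^ (- x.1%:~R * s + - (j - x.1)%:~R * (ep / p)) * m)%:E)%E.
Proof.
move=> m0 Mm d0 dj Vx xj xw; have rj := @rad_gt0 R j; have rx := @rad_gt0 R x.1.
have Wj : ((2 `^ (j%:~R * ep))%:E <= W x w)%E.
  rewrite /W indic_in ?mul1e; last first.
    by apply/in_ball; rewrite (rad_sub x.1 1) expr1; apply: lt_trans xw _; lra.
  (* Closer than in [io_dist_near], because 5/4 d + rad j / 2 < 3 rad j is required and d may be
     nearly 2 rad j. *)
  have [|_ [t _ <-] wt] := @dist_to_lt _ _ _ F0 w (5 / 4 * io_dist io w).
    by rewrite -/(io_dist io w); lra.
  have Sj : (vertices XN `&` [set v | x.1 - 1 - 4%:Z <= v.1]) (j, sel j t).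
    by split; [exact: sel_vertex | rewrite /= !lerBlDr -addrA; exact: xj].
  apply: le_trans (ge_esum_term (a := fun v => ((2 `^ (v.1%:~R * ep))%:E *
    (\1_(ball (io v.2) (3 * rad v.1)) w)%:E)%E) _ Sj); last first.
    by move=> v _; rewrite mule_ge0 ?lee_fin ?powR_ge0.
  rewrite /= indic_in ?mule1//; apply/in_ball; rewrite metric_sym.
  apply: le_lt_trans (metric_triangle _ (io t) _) _; rewrite io_isometry.
  by have := sel_near j t; lra.
have h : ((2 `^ (x.1%:~R * s + (j - x.1)%:~R * (ep / p)))%:E * b x <= m%:E)%E.
  apply: (poweR_le_inv p0) => //; first by rewrite mule_ge0 ?lee_fin ?powR_ge0.
  apply: le_trans Mm; rewrite poweRM ?lee_fin ?powR_ge0// poweR_EFin -powRrM.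
  rewrite -[leLHS]add0e; apply: leeD => //.
  apply: (@le_trans _ _ (Yt x * W x w)%E); last first.
    apply: (ge_esum_term (a := fun x => Yt x * W x w)%E) => // x' _; exact: mule_ge0.
  apply: le_trans (lee_wpmul2l (Y0 x) Wj).
  rewrite /Yt muleAC -EFinM -powRD_pos// le_eqVlt; apply/orP; left; apply/eqP.
  by congr ((2 `^ _)%:E * _)%E; rewrite intrB; field; rewrite gt_eqF.
rewrite (_ : - _ * s + _ = - (x.1%:~R * s + (j - x.1)%:~R * (ep / p))); last by ring.
by rewrite powRN EFinM lee_pdivlMl ?powR_gt0.
Qed.

End majorant.

(** It suffices to bound the inner norm at points w off the subset by a multiple of the p-th root m
    of the majorant. Each edge of level n over w contributes at most a multiple of m 2^(-|n - j|
    ka), where j is the dyadic level of the distance of w, so [lq_norm_decay] applies. *)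
Lemma triebel_lizorkin_le (L C : R) : 0 <= L -> 0 <= C -> exists2 K : R, 0 <= K &
  forall f a b, (forall v, 0 <= a v)%E -> (forall x, 0 <= b x)%E -> edge_bounds f a b L C ->
  (triebel_lizorkin_norm mu XZ s p q f `^ p <= K%:E *
    (\esum_(v in vertices XN) ((2 `^ (v.1%:~R * (s * p - Q)))%:E * a v `^ p) +
     \esum_(x in vertices XZ) ((2 `^ (x.1%:~R * (s * p - Q)))%:E * b x `^ p)))%E.
Proof.
move=> L0 C0.
have [Kw Kw0 HKw] := weight_integral XN io_isometry lam0 mmZ mmN rbZ rbN 4 ep0 epQ.
have [Kq Kq0 HKq] := lq_norm_decay q0 ka0 (edges_const_ge0 Q0 rbZ).
(* 6 s comes from the adapted vertex at level j - 6. The 2 counts the endpoints of a long edge; of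
   the 9, one comes from an endpoint one level finer and eight from [near_exponent]. Adding 1 keeps
   the constant positive. *)
have [c c0 cE] : exists2 c : R, 0 < c & c = L * 2 `^ (6 * s) + 2 * C * 2 `^ (9 * (ep / p)) + 1.
  eexists; last reflexivity.
  exact: ltr_wpDl (addr_ge0 (mulr_ge0 L0 (powR_ge0 _ _))
    (mulr_ge0 (mulr_ge0 (ler0n _ 2) C0) (powR_ge0 _ _))) ltr01.
have Kc0 : 0 < (Kq * c) `^ p by rewrite powR_gt0// mulr_gt0.
exists ((Kq * c) `^ p * (CZ + Kw * 2 `^ (Q - ep))).
  exact: mulr_ge0 (ltW Kc0) (addr_ge0 (ltW CZ0) (mulr_ge0 Kw0 (powR_ge0 _ _))).
move=> f a b a0 b0 [far near]; rewrite triebel_lizorkin_norm_poweR//.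
rewrite EFinM -muleA.
apply: le_trans (lee_wpmul2l _ (integral_majorant a b Kw0 HKw)); last by rewrite lee_fin ltW.
have M0 w := majorant_ge0 a b w; have mM := measurable_majorant a b.
rewrite -ge0_integralZl ?lee_fin ?(ltW Kc0)//.
apply: ae_le_integral_nonmeasurable.
- by move=> w; exact: poweR_ge0.
- by move=> w; rewrite mule_ge0 ?lee_fin ?(ltW Kc0).
- by apply: emeasurable_funM => //; exact: measurable_cst.
apply: negligibleS (range_negligible XN io_isometry lam0 mmZ mmN rbZ rbN lamQ cF) => w /= nw.
apply: contrapT => /(io_dist_gt0 cF) d0; apply: nw.
have [Mi|Mf] := eqVneq (majorant a b w) +oo%E.
  by rewrite Mi gt0_muley ?lte_fin// leey.
have [m [m0 mE]] : exists m : R, 0 <= m /\ majorant a b w = (m%:E `^ p)%E.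
  exists (fine (majorant a b w `^ p^-1)); split; first by rewrite fine_ge0 ?poweR_ge0.
  rewrite fineK ?poweRK// ge0_fin_numE ?poweR_ge0//.
  by apply: poweR_lty; rewrite ltey.
have Mm : (majorant a b w <= m%:E `^ p)%E by rewrite mE.
rewrite mE -poweR_EFin -poweRM ?lee_fin ?mulr_ge0 ?(ltW Kq0) ?(ltW c0)//.
apply: le_poweR; [exact: ltW | exact: lq_norm_ge0 |].
apply: le_trans (le_lq_norm_support (P := [set e | eball e w]) _ _ _) _ => //.
- by move=> e _; rewrite lee_fin !mulr_ge0 ?powR_ge0 ?edge_diff_ge0.
- by move=> e _ ew; rewrite indic_notin// mulr0.
have [j [v [/andP[j1 j2] Vv vj wv ad]]] := exists_adapted io_isometry sel_vertex sel_near d0.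
rewrite -EFinM -mulrA; apply: (HKq _ _ (fun e => elevel e) j).
- by rewrite mulr_ge0// ltW.
- move=> k; apply: le_trans (edges_count XZ Q0 mmZ rbZ k w).
  by apply: subset_le_esum => // e [[Xe ew] ek]; split.
move=> e [Xe /= ew]; set n := elevel e.
rewrite lee_fin !mulr_ge0 ?powR_ge0 ?edge_diff_ge0//= lee_fin indic_in// mulr1.
have [V1 V2 lE l12 l21] := edge_levels Xe.
have [jn|nj] := leP (j + 5) n.
  have av := far e w j v Xe ew j1 Vv vj ad jn.
  have wvr : mdist w (io v.2) < rad v.1.
    have -> : rad v.1 = 64 * rad j :> R by rewrite vj (rad_sub j 6); congr (_ * _); ring.
    have vr : rad v.1 = 64 * rad j :> R by rewrite vj (rad_sub j 6); congr (_ * _); ring.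
    by rewrite vr in wv; have := @rad_gt0 R j; lra.
  have am := majorant_tail a0 m0 Mm Vv wvr.
  have ed : edge_diff mu f e <= L * 2 `^ (- (n - j)%:~R) * (2 `^ (- v.1%:~R * s) * m).
    rewrite -lee_fin; apply: le_trans av _; rewrite EFinM.
    by apply: lee_wpmul2l am; rewrite lee_fin mulr_ge0 ?powR_ge0.
  apply: le_trans (ler_wpM2l (powR_ge0 _ _) ed) _.
  have P : 2 `^ (n%:~R * s) * 2 `^ (- (n - j)%:~R) * 2 `^ (- v.1%:~R * s) =
      2 `^ (6 * s) * 2 `^ (- (n - j)%:~R * (1 - s)) :> R.
    by rewrite -!powRD_pos// vj !intrB; congr (_ `^ _); ring.
  rewrite [leLHS](_ : _ = L * m * (2 `^ (n%:~R * s) * 2 `^ (- (n - j)%:~R) * 2 `^ (- v.1%:~R * s))); last by ring.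
  rewrite P.
  have G : 2 `^ (- (n - j)%:~R * (1 - s)) <= 2 `^ (- `|(n - j)%:~R| * ka) :> R.
    rewrite ler_powR ?ler1n//; apply: far_exponent; last by rewrite ge_min lexx.
    by rewrite ler0z subr_ge0; apply: le_trans jn; rewrite lerDl.
  rewrite [leLHS](_ : _ = L * 2 `^ (6 * s) * m * 2 `^ (- (n - j)%:~R * (1 - s))); last by ring.
  apply: ler_pM => //; rewrite ?mulr_ge0 ?powR_ge0//.
  apply: ler_wpM2r => //; rewrite cE -addrA lerDl.
  by rewrite addr_ge0 ?mulr_ge0 ?powR_ge0.
have nj4 : n <= j + 4 by exact: int_lt_add5.
have ed := near e w j Xe ew d0 j2 nj4.
have [w1 w2] := edge_near Xe ew; rewrite -/n in w1 w2 lE.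
have epp : 0 <= ep / p by rewrite divr_ge0 ?ltW.
have bx x : vertices XZ x -> n <= x.1 -> x.1 <= n + 1 -> mdist x.2 w < 3 * rad n ->
    (b x <= (2 `^ (- n%:~R * s + (ep / p + (n - j)%:~R * (ep / p))) * m)%:E)%E.
  move=> Vx nx xn xw.
  have xj : x.1 <= j + 5 by exact: int_le_add5 xn nj4.
  have rx : rad n <= 2 * rad x.1 :> R by rewrite -(rad_sub x.1 1); apply: le_rad; rewrite lerBlDr.
  apply: le_trans (majorant_near b0 m0 Mm d0 j2 Vx xj _) _; first by lra.
  rewrite lee_fin; apply: ler_wpM2r => //; rewrite ler_powR ?ler1n//.
  have h1 : (n%:~R : R) * s <= x.1%:~R * s.
    by rewrite ler_wpM2r ?(ltW (andP s01).1)// ler_int.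
  have h2 : (x.1%:~R : R) * (ep / p) <= (n%:~R + 1) * (ep / p).
    by rewrite ler_wpM2r// -[1]/(1%:~R) -intrD ler_int.
  by rewrite !intrB; lra.
have b1 := bx e.1 V1 _ _ w1; have b2 := bx e.2 V2 _ _ w2.
have {}ed : edge_diff mu f e <=
    C * (2 * (2 `^ (- n%:~R * s + (ep / p + (n - j)%:~R * (ep / p))) * m)).
  rewrite -lee_fin; apply: le_trans ed _; rewrite EFinM; apply: lee_wpmul2l; first by rewrite lee_fin.
  rewrite mulr_natl mulr2n EFinD; apply: leeD.
    by apply: b1; rewrite lE ?lexx// lerDl.
  by apply: b2; rewrite lE.
apply: le_trans (ler_wpM2l (powR_ge0 _ _) ed) _.
have P : 2 `^ (n%:~R * s) * 2 `^ (- n%:~R * s + (ep / p + (n - j)%:~R * (ep / p))) =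
    2 `^ (ep / p) * 2 `^ ((n - j)%:~R * (ep / p)) :> R.
  by rewrite -!powRD_pos//; congr (_ `^ _); ring.
rewrite [leLHS](_ : _ = 2 * C * m * (2 `^ (n%:~R * s) *
  2 `^ (- n%:~R * s + (ep / p + (n - j)%:~R * (ep / p))))); last by ring.
rewrite P.
have G : 2 `^ ((n - j)%:~R * (ep / p)) <= 2 `^ (8 * (ep / p)) * 2 `^ (- `|(n - j)%:~R| * ka) :> R.
  rewrite -powRD_pos// ler_powR ?ler1n//; apply: near_exponent; last by rewrite ge_min lexx orbT.
    by rewrite (_ : 4 = 4%:~R)// ler_int lerBlDr addrC.
  exact: ltW.
apply: (@le_trans _ _ (2 * C * m * (2 `^ (ep / p) * (2 `^ (8 * (ep / p)) * 2 `^ (- `|(n - j)%:~R| * ka))))).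
  apply: ler_wpM2l; first exact: mulr_ge0 (mulr_ge0 (ler0n _ 2) C0) m0.
  by apply: ler_wpM2l; rewrite ?powR_ge0.
have P9 : 2 `^ (ep / p) * 2 `^ (8 * (ep / p)) = 2 `^ (9 * (ep / p)) :> R.
  by rewrite -powRD_pos//; congr (_ `^ _); ring.
rewrite [2 `^ (ep / p) * _]mulrA P9.
rewrite [leLHS](_ : _ = 2 * C * 2 `^ (9 * (ep / p)) * m * 2 `^ (- `|(n - j)%:~R| * ka)); last by ring.
apply: ler_wpM2r; first exact: powR_ge0.
apply: ler_wpM2r => //; rewrite cE -addrA [leRHS]addrCA lerDl.
by rewrite addr_ge0 ?mulr_ge0 ?powR_ge0.
Qed.

End triebel_upper_bound.

Lemma powR2_decay {R : realType} (m sigma e : R) : 0 <= m -> 0 < sigma -> 0 < e ->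
  exists K : nat, forall k : nat, (K <= k)%N -> m * 2 `^ (- k%:Z%:~R * sigma) <= e.
Proof.
move=> m0 s0 e0; have m1 : 0 < m + 1 by exact: ltr_wpDl.
have d0 : 0 < (e / (m + 1)) `^ sigma^-1 by exact: powR_gt0 (divr_gt0 e0 m1).
have [j /andP[jd _]] := exists_rad d0; exists `|j|%N => k jk.
have kd : rad k%:Z <= (e / (m + 1)) `^ sigma^-1.
  by apply: le_trans jd; apply: le_rad; apply: le_trans (lez_abs j) _; exact: jk.
rewrite -rad_powR; apply: (@le_trans _ _ (m * (e / (m + 1)))).
  apply: ler_wpM2l => //; have -> : e / (m + 1) = ((e / (m + 1)) `^ sigma^-1) `^ sigma.
    by rewrite -powRrM mulVf ?gt_eqF// powRr1// divr_ge0 ?ltW.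
  by rewrite ge0_ler_powR ?nnegrE ?rad_ge0 ?(ltW s0) ?powR_ge0.
by rewrite mulrCA ler_piMr ?(ltW e0)// ler_pdivrMr// mul1r lerDl.
Qed.

Lemma near_point_arith {R : realType} (r zw zt wt dw vt wv : R) : 0 < r -> zw < r ->
  zt < r / 2 -> wt <= zw + zt -> dw <= wt -> vt < 8192 * r / 2 -> wv <= wt + vt ->
  128 * dw <= 8192 * r /\ wv <= 3 / 4 * (8192 * r).
Proof. by move=> *; split; lra. Qed.

(** * The extension of Besov functions and its restriction *)

Section extension_operator.
Context {R : realType} {Z N : pmetricType R}.
Context (mu : {outer_measure set Z -> \bar R}) (nu : {outer_measure set N -> \bar R}).
Context (XZ : @hyperbolic_filling R Z) (XN : @hyperbolic_filling R N).
Context (Q lam CZ CN : R) (io : N -> Z).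
Hypothesis io_isometry : forall x y, mdist (io x) (io y) = mdist x y.
Hypothesis (Q0 : 0 < Q) (lam0 : 0 < lam) (lamQ : lam < Q).
Hypothesis (mmZ : metric_measure_space mu) (mmN : metric_measure_space nu).
Hypothesis (rbZ : regular_bounds mu Q CZ) (rbN : regular_bounds nu lam CN).
Hypothesis cF : closed (range io).
Let TN := caratheodory_type nu.
Let CN0 : 0 < CN. Proof. by apply: lt_le_trans rbN.1. Qed.
Variable selZ : int -> N -> Z.
Hypothesis selZ_vertex : forall n t, vertices XZ (n, selZ n t).
Hypothesis selZ_near : forall n t, mdist (io t) (selZ n t) < rad n / 2.
Variable selN : int -> N -> N.
Hypothesis selN_vertex : forall n t, vertices XN (n, selN n t).
Hypothesis selN_near : forall n t, mdist t (selN n t) < rad n / 2.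
Hypothesis selN_meas : forall n (g : N -> R),
  measurable_fun [set: TN] (fun t : TN => g (selN n t)).
Variables (s p : R) (q : \bar R).
Hypothesis (s01 : 0 < s < 1) (p0 : 0 < p) (q0 : (0 < q)%E).
Hypothesis cond : 0 < lam * p - lam * Num.max 0 (p - 1) + (s * p - Q).
Let sigma := s - (Q - lam) / p.
Hypothesis sigma0 : 0 < sigma.

Let FZ := triebel_lizorkin mu XZ s p q.
Let normFZ := triebel_lizorkin_norm mu XZ s p q.
Let BF := besov nu XN sigma p%:E p%:E.
Let normBF := besov_norm nu XN sigma p%:E p%:E.
Let RE (g : N -> R[i]) := fun y => complex.Re (g y).
Let IM (g : N -> R[i]) := fun y => complex.Im (g y).
Let D (g : N -> R[i]) := osc XN (discretize nu g).
Let a (g : N -> R[i]) := osc_tail XN lam id (D g).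
Let b (g : N -> R[i]) := near_sum XN Q io (a g).
Let D0 g v : (0 <= D g v)%E. Proof. exact: osc_ge0. Qed.
Let a0 g v : (0 <= a g v)%E.
Proof. by apply: esum_ge0 => x _; rewrite mule_ge0 ?lee_fin ?powR_ge0//; exact: D0. Qed.
Let b0 g x : (0 <= b g x)%E. Proof. by apply: near_sum_ge0 => v; exact: a0. Qed.
Let id_iso : forall x y : N, mdist (id x) (id y) = mdist x y. Proof. by []. Qed.
Let A : R := 2 * (CN * 2 `^ lam).
Let A0 : 0 <= A. Proof. exact: mulr_ge0 (ler0n _ 2) (mulr_ge0 (ltW CN0) (powR_ge0 _ _)). Qed.

Let sigmaE : sigma * p - lam = s * p - Q.
Proof. by rewrite /sigma; field; rewrite gt_eqF. Qed.

Lemma tail_besov (c : nat) : exists2 K : R, 0 <= K & forall g,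
  (\esum_(y in vertices XN) ((2 `^ ((y.1 - c%:Z)%:~R * (s * p - Q)))%:E *
     a g ((y.1 - c%:Z)%R, y.2) `^ p) <= K%:E * normBF g `^ p)%E.
Proof.
have [K K0 H] := schur_osc_tail XN XN id_iso lam0 lam0 mmN mmN rbN rbN c p0 cond.
exists (K * (CN * 4 `^ lam)); first exact: mulr_ge0 K0 (mulr_ge0 (ltW CN0) (powR_ge0 _ _)).
move=> g; apply: le_trans (H _ (D0 g)) _; rewrite EFinM -muleA.
apply: lee_wpmul2l; first by rewrite lee_fin.
by rewrite meeting_id -sigmaE; exact: (osc_besov XN lam0 mmN rbN sigma g p0).
Qed.

Lemma near_besov : exists2 K : R, 0 <= K & forall g,
  (\esum_(v in vertices XN) ((2 `^ (v.1%:~R * (s * p - Q)))%:E * a g v `^ p) +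
   \esum_(x in vertices XZ) ((2 `^ (x.1%:~R * (s * p - Q)))%:E * b g x `^ p) <=
   K%:E * normBF g `^ p)%E.
Proof.
have condZ : 0 < Q * p - lam * Num.max 0 (p - 1) + (s * p - Q).
  by apply: lt_le_trans cond _; rewrite !lerD2r ler_pM2r// ltW.
have [K1 K10 H1] := tail_besov 0.
have [K2 K20 H2] := schur_near_sum XZ XN io_isometry Q0 lam0 mmZ mmN rbZ rbN p0 condZ.
have c0 : 0 <= 2 `^ (14 * (s * p - Q)) * K2 by exact: mulr_ge0 (powR_ge0 _ _) K20.
exists (K1 + 2 `^ (14 * (s * p - Q)) * K2 * K1); first exact: addr_ge0 K10 (mulr_ge0 c0 K10).
move=> g; have Ha : (\esum_(v in vertices XN) ((2 `^ (v.1%:~R * (s * p - Q)))%:E * a g v `^ p) <=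
    K1%:E * normBF g `^ p)%E.
  apply: le_trans (H1 g); apply: le_esum => -[n y] _ /=; by rewrite subr0.
have n0 : (0 <= normBF g `^ p)%E by exact: poweR_ge0.
rewrite EFinD ge0_muleDl ?lee_fin//; last exact: mulr_ge0 c0 K10.
apply: leeD => //; rewrite (EFinM (_ * K2)) -muleA.
apply: le_trans (lee_wpmul2l _ Ha); last by rewrite lee_fin.
rewrite EFinM -muleA; apply: le_trans (lee_wpmul2l _ (H2 _ (a0 g))); last by rewrite lee_fin powR_ge0.
rewrite -esumZl ?lee_fin ?powR_ge0//; last by move=> x _; rewrite mule_ge0 ?lee_fin ?powR_ge0 ?poweR_ge0.
apply: le_esum => x _; rewrite muleA -EFinM -powRD_pos//.
by rewrite intrB (_ : 14 * _ + _ = x.1%:~R * (s * p - Q)); last by ring.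
Qed.

Section besov_function.
Variable g : N -> R[i].
Hypothesis Bg : BF g.

Let fin : (normBF g `^ p < +oo)%E. Proof. exact: poweR_lty Bg.2. Qed.

Let sums_fin :
  (\esum_(v in vertices XN) ((2 `^ (v.1%:~R * (s * p - Q)))%:E * a g v `^ p) < +oo)%E /\
  (\esum_(x in vertices XZ) ((2 `^ (x.1%:~R * (s * p - Q)))%:E * b g x `^ p) < +oo)%E.
Proof.
have [K K0 H] := near_besov.
have lt : (K%:E * normBF g `^ p < +oo)%E by rewrite lte_mul_pinfty.
have sa : (0 <= \esum_(v in vertices XN) ((2 `^ (v.1%:~R * (s * p - Q)))%:E * a g v `^ p))%E.
  by apply: esum_ge0 => v _; rewrite mule_ge0 ?lee_fin ?powR_ge0 ?poweR_ge0.
have sb : (0 <= \esum_(x in vertices XZ) ((2 `^ (x.1%:~R * (s * p - Q)))%:E * b g x `^ p))%E.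
  by apply: esum_ge0 => v _; rewrite mule_ge0 ?lee_fin ?powR_ge0 ?poweR_ge0.
split; apply: le_lt_trans lt; apply: le_trans (H g).
  by rewrite leeDl.
by rewrite leeDr.
Qed.

Let afin v : vertices XN v -> (a g v < +oo)%E.
Proof. by apply: (lty_esum_term p0 _ _ sums_fin.1) => ?; rewrite ?powR_gt0. Qed.

Let bfin x : vertices XZ x -> (b g x < +oo)%E.
Proof. by apply: (lty_esum_term p0 _ _ sums_fin.2) => ?; rewrite ?powR_gt0. Qed.

Let tail_fin y : vertices XN y -> (a g ((y.1 - 3)%R, y.2) < +oo)%E.
Proof.
have [K K0 H] := tail_besov 3.
have lt : (K%:E * normBF g `^ p < +oo)%E by rewrite lte_mul_pinfty.
by apply: (lty_esum_term p0 _ _ (le_lt_trans (H g) lt)) => ?; rewrite ?powR_gt0.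
Qed.

Let gi : locint nu (RE g). Proof. exact: (L1loc_locint Bg.1).1. Qed.
Let gj : locint nu (IM g). Proof. exact: (L1loc_locint Bg.1).2. Qed.
Let dR : dominates XN (bavg nu (RE g)) (D g). Proof. exact: dominates_Re. Qed.
Let dI : dominates XN (bavg nu (IM g)) (D g). Proof. exact: dominates_Im. Qed.
Let oR := vball_oscillation lam0 mmN rbN selN_vertex selN_near selN_meas gi dR tail_fin.
Let oI := vball_oscillation lam0 mmN rbN selN_vertex selN_near selN_meas gj dI tail_fin.

Lemma cext_besov_L1loc : L1loc mu (cext nu io g).
Proof.
exact: (cext_L1loc io_isometry lam0 lamQ mmZ mmN rbZ rbN cF selN_vertex selN_near
  Bg.1 A0 afin bfin oR oI).
Qed.

Lemma cext_edge_bounds : edge_bounds mu XZ XN io (cext nu io g) (a g) (b g)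
  (ext_lip_const lam CN A) (near_const Q lam CZ CN A).
Proof.
split.
  exact: (cext_edge_far io_isometry lam0 lamQ mmZ mmN rbZ rbN cF selN_vertex selN_near
    Bg.1 A0 afin bfin oR oI).
exact: (cext_edge_near io_isometry lam0 lamQ mmZ mmN rbZ rbN cF selN_vertex selN_near
    Bg.1 A0 afin bfin oR oI).
Qed.

(* Only the weights matter in osc_sum_ae: it is applied to Db and the zero
   function, and its finiteness forces near_sum to decay along the chain
   of net points approaching t. *)
Let Db (x : int * Z) := ((2 `^ (x.1%:~R * (sigma * p)))%:E * b g x `^ p)%E.

Lemma near_sum_decay : {ae cara nu, forall t, exists2 m : R, 0 <= m &
  forall k : nat, fine (b g (k%:Z, selZ k%:Z t)) <= m * 2 `^ (- k%:Z%:~R * sigma)}.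
Proof.
have Db0 x : (0 <= Db x)%E by rewrite mule_ge0 ?lee_fin ?powR_ge0 ?poweR_ge0.
have dom : dominates XZ (bavg mu (fun=> 0)) Db.
  by split=> // v w _ _ _ _; rewrite /bavg !(ravg_cst mmZ) ?rad_gt0// subrr normr0.
have tf y : vertices XN y -> (osc_tail XZ lam io Db ((y.1 - 3)%R, y.2) < +oo)%E.
  move=> _; set n := (y.1 - 3)%R.
  have lt : ((2 `^ (n%:~R * lam))%:E *
      (\esum_(x in vertices XZ) ((2 `^ (x.1%:~R * (s * p - Q)))%:E * b g x `^ p)) < +oo)%E.
    by rewrite lte_mul_pinfty ?lee_fin ?powR_ge0//; exact: sums_fin.2.
  apply: le_lt_trans lt; rewrite -esumZl ?lee_fin ?powR_ge0//; last first.
    by move=> x _; rewrite mule_ge0 ?lee_fin ?powR_ge0 ?poweR_ge0.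
  apply: (@le_trans _ _ (\esum_(x in meeting XZ io `&` tail_rel io (n, y.2))
     ((2 `^ (n%:~R * lam))%:E * ((2 `^ (x.1%:~R * (s * p - Q)))%:E * b g x `^ p)))%E).
    (* The factor 2^(-(x.1 - n) lam) of the tail turns the exponent sigma p into sigma p - lam = s p
       - Q, for which the sum is finite. *)
    apply: le_esum => x _; rewrite /Db !muleA -!EFinM -!powRD_pos// -sigmaE.
    by rewrite (_ : _ + _ = n%:~R * lam + x.1%:~R * (sigma * p - lam)); last by rewrite /= intrB; ring.
  apply: subset_le_esum => [x _|x [[]]//].
  by rewrite !mule_ge0 ?lee_fin ?powR_ge0 ?poweR_ge0.
apply: ae_imp (osc_sum_ae io_isometry Q0 mmZ mmN rbZ rbN dom tf) => t ft.
pose m := fine (osc_sum XZ io Db 0 t `^ p^-1).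
have T0 : (0 <= osc_sum XZ io Db 0 t)%E by exact: osc_sum_ge0.
have m0 : 0 <= m by rewrite fine_ge0 ?poweR_ge0.
have mE : (m%:E `^ p = osc_sum XZ io Db 0 t)%E.
  by rewrite fineK ?poweRK// ge0_fin_numE ?poweR_ge0//; exact: poweR_lty.
exists m => // k; set x := (k%:Z, _).
have Vx : vertices XZ x by exact: selZ_vertex.
have h : ((2 `^ (k%:Z%:~R * sigma))%:E * b g x <= m%:E)%E.
  apply: (poweR_le_inv p0) => //; first by rewrite mule_ge0 ?lee_fin ?powR_ge0.
  rewrite mE poweRM ?lee_fin ?powR_ge0// poweR_EFin -powRrM -mulrA.
  apply: (@le_trans _ _ (Db x * (\1_(vball x) (io t))%:E)%E).
    by rewrite indic_in ?mule1//; exact: (sel_vball selZ_near).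
  apply: (ge_esum_term (a := fun x => Db x * (\1_(vball x) (io t))%:E)%E).
    by move=> ? _; rewrite mule_ge0 ?lee_fin.
  by split => //; exact: (meeting_sel selZ_vertex selZ_near).
rewrite mulNr powRN mulrC -lee_fin fineK ?ge0_fin_numE ?bfin//.
by rewrite EFinM lee_pdivlMl ?powR_gt0.
Qed.

Hypothesis ess : exists n : int, essential N (rad n : R).

(** The average of the extension at the selected vertex of level k is compared with the average of h
    at the selected vertex of the subset 13 levels coarser; by [bavg_ext_near] the error is at most
    a multiple of 2^(-k sigma). Hence the threshold K1 + 13, while k >= |n0| makes the levels
    essential. *)
Let bavg_ext_cvg (h : N -> R) t (m : R) : locint nu h -> dominates XN (bavg nu h) (D g) ->
  (forall v, vertices XN v -> (Iabs nu (ball v.2 (rad v.1)) (fun t => (h t - bavg nu h v)%R) <=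
    (A * 2 `^ (- v.1%:~R * lam))%:E * a g v)%E) ->
  locint mu (ext nu io h) -> 0 <= m ->
  (forall k : nat, fine (b g (k%:Z, selZ k%:Z t)) <= m * 2 `^ (- k%:Z%:~R * sigma)) ->
  bavg nu h (k%:Z, selN k%:Z t) @[k --> \oo] --> h t ->
  bavg mu (ext nu io h) (k%:Z, selZ k%:Z t) @[k --> \oo] --> h t.
Proof.
move=> hi hd ho lh m0 bm hc; apply/cvgrPdist_le => e e0.
have e20 : 0 < e / 2 by rewrite divr_gt0.
have /cvgrPdist_le/(_ _ e20) [K1 _ K1P] := hc.
have c0 : 0 <= near_const Q lam CZ CN A / 4 by exact: divr_ge0 (near_const_ge0 rbZ rbN A0) (ler0n _ 4).
have [K2 K2P] := powR2_decay (mulr_ge0 c0 m0) sigma0 e20.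
have [n0 ess0] := ess.
exists (maxn (K1 + 13) (maxn K2 `|n0|))%N => // k /=.
rewrite !geq_max => /and3P[k1 k2 k3].
have k13 : (13 <= k)%N by apply: leq_trans k1; rewrite leq_addl.
have kE : k%:Z - 13 = (k - 13)%N%:Z by rewrite -subzn.
have n1 := K1P (k - 13)%N; rewrite /= leq_subRL// addnC in n1; have {}n1 := n1 k1.
have rk := @rad_gt0 R k%:Z.
have r13 : rad (k%:Z - 13) = 8192 * rad k%:Z :> R.
  by rewrite (rad_sub k%:Z 13); congr (_ * _); ring.
have near := selN_near (k%:Z - 13) t; rewrite r13 in near.
have essk : essential Z (rad k%:Z : R).
  apply: (essential_io io_isometry); apply: essential_le ess0; apply: le_rad.
  by apply: le_trans (lez_abs n0) _.
have H w : ball (selZ k%:Z t) (rad k%:Z) w -> 128 * io_dist io w <= rad (k%:Z - 13) /\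
    mdist w (io (selN (k%:Z - 13) t)) <= 3 / 4 * rad (k%:Z - 13).
  move=> /in_ball xw; rewrite r13; apply: (near_point_arith rk xw (selZ_near k%:Z t) _
    (io_dist_le io w t) near).
    by rewrite (metric_sym (io t)) (metric_sym _ w); exact: metric_triangle.
  by rewrite -(io_isometry t); exact: metric_triangle.
have kk : k%:Z - 14 <= k%:Z - 13 by rewrite lerD2l.
have d := bavg_ext_near io_isometry lam0 lamQ mmZ mmN rbZ rbN cF selN_vertex selN_near A0
  bfin hi hd ho lh (selZ_vertex k%:Z t) essk (selN_vertex (k%:Z - 13) t) kk H.
apply: le_trans (ler_distD (bavg nu h (k%:Z - 13, selN (k%:Z - 13) t)) _ _) _.
rewrite [leRHS](_ : e = e / 2 + e / 2); last by field.
apply: lerD; first by rewrite kE.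
rewrite distrC; apply: le_trans d _; apply: le_trans (K2P k k2).
by rewrite -[leRHS]mulrA; apply: ler_wpM2l => //; exact: bm.
Qed.

Theorem crestr_cext : {ae cara nu, forall t, crestr mu selZ (cext nu io g) t = g t}.
Proof.
have [lR lI] := L1loc_locint cext_besov_L1loc.
have cR := bavg_cvg_ae lam0 mmN rbN selN_vertex selN_near selN_meas gi dR tail_fin.
have cI := bavg_cvg_ae lam0 mmN rbN selN_vertex selN_near selN_meas gj dI tail_fin.
apply: ae_imp (ae_and near_sum_decay (ae_and cR cI)) => t [[m m0 bm] [tR tI]].
have hR := bavg_ext_cvg gi dR oR lR m0 bm tR.
have hI := bavg_ext_cvg gj dI oI lI m0 bm tI.
by rewrite /crestr /= (restr_cvg hR) (restr_cvg hI) /RE /IM; case: (g t).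
Qed.

End besov_function.

Let ext_num_ae (g h : N -> R) w : locint nu g -> locint nu h ->
  {ae cara nu, forall t, g t = h t} -> ext_num nu io g w = ext_num nu io h w.
Proof.
move=> gi hi gh; rewrite /ext_num /Rintegral; congr fine; apply: ae_eq_integral => //.
- by have /integrableP[] := integrable_kern io_isometry mmN w gi.
- by have /integrableP[] := integrable_kern io_isometry mmN w hi.
by apply: ae_imp gh => t -> _.
Qed.

Let ext_lin (c d : R) g h w : locint nu g -> locint nu h ->
  ext nu io (fun t => c * g t + d * h t) w = c * ext nu io g w + d * ext nu io h w.
Proof.
by move=> gi hi; rewrite /ext (ext_num_lin io_isometry mmN c d w gi hi) mulrDl !mulrA.
Qed.

Let ext_shift (c : R) g h w : locint nu g -> locint nu h -> 0 < io_dist io w ->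
  {ae cara nu, forall t, h t = g t + c} -> ext nu io h w = ext nu io g w + c.
Proof.
move=> gi hi d0 hg; have W0 := ext_weight_gt0 io_isometry mmN d0.
have li := locint_lin mmN 1 c gi (locint_cst mmN 1).
rewrite /ext (ext_num_ae w hi li); last by apply: ae_imp hg => t ->; rewrite mul1r mulr1.
rewrite (ext_num_lin io_isometry mmN 1 c w gi (locint_cst mmN 1)) mul1r mulrDl.
by rewrite mulfK// gt_eqF.
Qed.

Lemma cext_bounded : exists2 K : R, 0 <= K & forall g, BF g ->
  (normFZ (cext nu io g) <= K%:E * normBF g)%E.
Proof.
have [K1 K10 H1] := triebel_lizorkin_le XZ io_isometry Q0 lam0 lamQ mmZ mmN rbZ rbN cF
  selN_vertex selN_near s01 p0 q0 (ext_lip_const_ge0 rbN A0) (near_const_ge0 rbZ rbN A0).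
have [K2 K20 H2] := near_besov.
exists ((K1 * K2) `^ p^-1); first exact: powR_ge0.
move=> g Bg; apply: le_poweR_scale => //; first exact: mulr_ge0 K10 K20.
- exact: Lnorm_ge0.
- exact: lq_norm_ge0.
apply: le_trans (H1 _ _ _ (a0 g) (b0 g) (cext_edge_bounds Bg)) _.
by rewrite EFinM -muleA; apply: lee_wpmul2l (H2 g); rewrite lee_fin.
Qed.

Theorem cext_operator : bounded_linear_operator nu mu BF normBF FZ normFZ (cext nu io).
Proof.
have [K K0 HK] := cext_bounded; split.
- move=> g Bg; split; first exact: cext_besov_L1loc.
  by apply: le_lt_trans (HK g Bg) _; rewrite lte_mul_pinfty ?lee_fin//; exact: Bg.2.
- move=> f g [Lf _] [Lg _] fg; have [fr fim] := L1loc_locint Lf; have [gr gim] := L1loc_locint Lg.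
  apply: aeW => w; rewrite /cext /ext; congr (Complex (_ / _) (_ / _)).
    by apply: ext_num_ae => //; apply: ae_imp fg => y ->.
  by apply: ext_num_ae => //; apply: ae_imp fg => y ->.
- move=> f g [Lf _] [Lg _] [c fg].
  have [fr fim] := L1loc_locint Lf; have [gr gim] := L1loc_locint Lg.
  (* Constants are reproduced off the subset, where the total weight of the kernel is positive. *)
  exists c; apply: negligibleS (range_negligible XN io_isometry lam0 mmZ mmN rbZ rbN lamQ cF).
  move=> w /= nw; apply: contrapT => /(io_dist_gt0 cF) d0; apply: nw.
  have hR : {ae cara nu, forall t, RE f t = RE g t + complex.Re c}.
    by apply: ae_imp fg => t /(canRL (subrK _)); rewrite /RE => ->; case: (g t) (c) => ? ? [? ?] /=; ring.
  have hI : {ae cara nu, forall t, IM f t = IM g t + complex.Im c}.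
    by apply: ae_imp fg => t /(canRL (subrK _)); rewrite /IM => ->; case: (g t) (c) => ? ? [? ?] /=; ring.
  rewrite /cext (ext_shift gr fr d0 hR) (ext_shift gim fim d0 hI).
  by case: (c) => x y; simpc; congr Complex => /=; ring.
- move=> z f g [Lf _] [Lg _].
  have [fr fim] := L1loc_locint Lf; have [gr gim] := L1loc_locint Lg.
  apply: aeW => w.
  have hR : RE (fun x => z * f x + g x) = fun t =>
      1 * (complex.Re z * RE f t + - complex.Im z * IM f t) + 1 * RE g t.
    by apply/funext => y; rewrite !mul1r /RE /IM; case: (g y); case: (f y); case: (z) => ? ? ? ? ? ?; simpc => /=; ring.
  have hI : IM (fun x => z * f x + g x) = fun t =>
      1 * (complex.Re z * IM f t + complex.Im z * RE f t) + 1 * IM g t.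
    by apply/funext => y; rewrite !mul1r /RE /IM; case: (g y); case: (f y); case: (z) => ? ? ? ? ? ?; simpc => /=; ring.
  rewrite /cext -/(RE _) -/(IM (fun x => z * f x + g x)) hR hI.
  rewrite (ext_lin 1 1 w (locint_lin mmN (complex.Re z) (- complex.Im z) fr fim) gr).
  rewrite (ext_lin 1 1 w (locint_lin mmN (complex.Re z) (complex.Im z) fim fr) gim).
  rewrite (ext_lin _ _ w fr fim) (ext_lin _ _ w fim fr) !mul1r -/(RE f) -/(IM f) -/(RE g) -/(IM g).
  by case: (z) => x y; simpc; congr Complex => /=; ring.
- by exists K.
Qed.

End extension_operator.

(** Covering the space by itself costs 0^s = 0. This excludes a subset with a single point, since
    balls have positive measure; two distinct points then give the volume bounds. *)
Lemma hausdorff_measure_subsingleton {R : realType} {M : metricType R} (s : R) :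
  0 < s -> (forall x y : M, x = y) -> hausdorff_measure s [set: M] = 0%E.
Proof.
move=> s0 single; apply/eqP; rewrite eq_le hausdorff_measure_ge0 andbT.
have dT : diam [set: M] = 0%E.
  rewrite /diam setUidl ?ereal_sup1// => _ [[x y] _ <-] /=.
  by rewrite (single x y) mdistxx.
apply: ge_ereal_sup => _ [d /= d0 <-].
apply: ereal_inf_lbound; exists (fun i => if i is 0%N then [set: M] else set0).
  by split=> [[|i]|x _]; rewrite ?dT ?diam0 ?lee_fin ?(ltW d0)//; exists 0%N.
rewrite eseries0// => -[|i] _ _; last exact: hausdorff_gauge0.
by rewrite /hausdorff_gauge; case: pselect => // T0; rewrite dT poweR0r ?gt_eqF.
Qed.

(** The second conclusion restates p > (Q - lam)/s. The third, the gap in the Schur test, is lam + s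
    p > Q for p >= 1 and (lam + s) p > Q for p <= 1; the two bounds in the maximum cover these two
    cases. *)
Lemma sobolev_exponents {R : realType} (Q lam s p : R) : 0 < lam -> lam <= Q -> 0 < s ->
  Num.max (Q / (lam + s)) ((Q - lam) / s) < p ->
  [/\ 0 < p, 0 < s - (Q - lam) / p &
    0 < lam * p - lam * Num.max 0 (p - 1) + (s * p - Q)].
Proof.
move=> l0 lQ s0; rewrite gt_max => /andP[h1 h2].
rewrite ltr_pdivrMr ?addr_gt0// in h1; rewrite ltr_pdivrMr// in h2.
have Q0 : 0 < Q by exact: lt_le_trans lQ.
have p0 : 0 < p by rewrite -(pmulr_lgt0 p (addr_gt0 l0 s0)); exact: lt_trans h1.
split => //; first by rewrite subr_gt0 ltr_pdivrMr// mulrC.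
rewrite mulrDr in h1; rewrite [s * p]mulrC [lam * p]mulrC.
by case: (leP 0 (p - 1)) => _; rewrite ?mulrBr ?mulr1 ?mulr0; lra.
Qed.

Theorem theorem1p4 (R : realType) (Z : pmetricType R)
    (mu : {outer_measure set Z -> \bar R}) (F : set Z) (F0 : F !=set0)
    (XZ : hyperbolic_filling (M := Z))
    (XF : hyperbolic_filling (M := nonempty_subset F0))
    (Q lambda s p : R) (q : \bar R) :
  let nu : {outer_measure set (nonempty_subset F0) -> \bar R} :=
    hausdorff_measure lambda in
  let FZ := triebel_lizorkin mu XZ s p q in
  let normFZ := triebel_lizorkin_norm mu XZ s p q in
  let BF := besov nu XF (s - (Q - lambda) / p) p%:E p%:E in
  let normBF := besov_norm nu XF (s - (Q - lambda) / p) p%:E p%:E in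
  0 < Q -> metric_measure_space mu -> ahlfors_regular mu Q ->
  0 < lambda <= Q ->
  closed F -> porous F -> metric_measure_space nu -> ahlfors_regular nu lambda ->
  0 < s < 1 ->
  Num.max (Q / (lambda + s)) ((Q - lambda) / s) < p ->
  ((Q / (Q + s))%:E < q)%E ->
  exists (Rop : (Z -> R[i]) -> (nonempty_subset F0 -> R[i]))
         (Eop : (nonempty_subset F0 -> R[i]) -> (Z -> R[i])),
    [/\ bounded_linear_operator mu nu FZ normFZ BF normBF Rop,
        bounded_linear_operator nu mu BF normBF FZ normFZ Eop,
        forall f : Z -> R[i], FZ f -> continuous (f : Z -> R[i]^o) ->
          forall x : nonempty_subset F0, Rop f x = f (subset_incl x) &
        forall f : nonempty_subset F0 -> R[i], BF f ->
          {ae cara nu, forall x, Rop (Eop f) x = f x}].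
Proof.
move=> nu FZ normFZ BF normBF Q0 mmZ arZ /andP[l0 lQ] clF poF mmN arN s01 pmax qmin.
have [s0 s1] := andP s01; have [p0 sigma0 cond] := sobolev_exponents l0 lQ s0 pmax.
have q0 : (0 < q)%E by apply: le_lt_trans qmin; rewrite lee_fin divr_ge0// ltW// addr_gt0.
pose N : pmetricType R := nonempty_subset F0.
pose io : N -> Z := @subset_incl R Z F F0.
have io_iso x y : mdist (io x) (io y) = mdist x y by [].
have rF : range io = F.
  apply/seteqP; split => [_ [x _ <-]|z Fz]; first exact: set_mem (valP x).
  by exists (exist _ z (mem_set Fz)).
have cF : closed (range io) by rewrite rF.
have pF : porous (range io) by rewrite rF.
have [y1 [y2 y12]] : exists y1 y2 : N, y1 <> y2.
  apply: contrapT => single.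
  have nu0 : nu [set: N] = 0%E.
    apply: hausdorff_measure_subsingleton => // x y; apply: contrapT => xy.
    by apply: single; exists x, y.
  have /andP[+ _] := mmN.2 point 1 ltr01; rewrite lt0e => /andP[/eqP h _]; apply: h.
  by apply/eqP; rewrite eq_le outer_measure_ge0 andbT -nu0 le_outer_measure.
have z12 : io y1 <> io y2 by move=> /val_inj.
have [CZ rbZ] := ahlfors_regular_bounds Q0 mmZ arZ z12.
have [CN rbN] := ahlfors_regular_bounds l0 mmN arN y12.
have [n0 ess] : exists n : int, essential N (rad n : R).
  have d0 : 0 < mdist y1 y2 by rewrite mdist_gt0; apply/eqP.
  have [j /andP[jd _]] := exists_rad d0.
  by exists j, y1, y2; apply: le_trans jd _; rewrite ler_peMl ?ler1n// ltW.
have lamQ : lambda < Q by exact: (porous_dimension_lt XZ io_iso Q0 l0 mmZ mmN rbZ rbN pF ess).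
have [selZ [vZ nZ mZ]] := measurable_selection XZ Q0 mmZ rbZ (measurable_preimage_ball io_iso mmN).
have [selN [vN nN mN]] := measurable_selection XF l0 mmN rbN
  (io := id : caratheodory_type nu -> N) (measurable_ball_cara mmN).
exists (crestr mu selZ), (cext nu io); split.
- exact: (crestr_operator XF io_iso Q0 l0 mmZ mmN rbZ rbN vZ nZ mZ pF p0 q0 cond).
- exact: (cext_operator XZ io_iso Q0 l0 lamQ mmZ mmN rbZ rbN cF vN nN mN s01 p0 q0 cond).
- by move=> f [Lf _] cf x; exact: (crestr_continuous mmZ nZ Lf cf).
- move=> f Bf; apply: (crestr_cext io_iso Q0 l0 lamQ mmZ mmN rbZ rbN cF vZ nZ vN nN mN p0 cond sigma0 Bf).
  by exists n0.
Qed.
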